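(* Let $\mathsf{M}=(\mathbf{X},\mathbf{A},\{\mathbf{A}(x)\}_{x\in\mathbf{X}},Q,\eta,r)$ be a Markov control model satisfying the measurability conditions, with $\mathbf{A}$ compact and $r$ taking values in $\mathbb{R}^d$, and suppose that $\mathsf{M}$ is $\Delta$-absorbing. Let $\mathcal{O}$ be its set of occupancy measures and $\mathcal{C}$ the set of solutions of the characteristic equations. Let $\alpha\in\mathbb{R}^d$ be such that the convex set $\mathcal{O}(r,\alpha)=\{\nu\in\mathcal{O}:\nu(r)=\alpha\}$ is nonempty. Let $\mu\in\mathcal{O}(r,\alpha)$ and let $\mathscr{F}_\alpha(\mu)$ be the face of $\mathcal{O}(r,\alpha)$ generated by $\mu$. Then: 1. $\mathscr{F}_\alpha(\mu)=\{\nu\in\mathcal{C}:\nu(r)=\alpha\text{ and }\nu\le c\mu\text{ for some }c>1\}$. 2. $\mathrm{rai}[\mathscr{F}_\alpha(\mu)]=\{\nu\in\mathcal{C}:\nu(r)=\alpha\text{ and }\tfrac1c\mu\le\nu\le c\mu\text{ for some }c>1\}$. 3. $\mathrm{aff}\{\mathscr{F}_\alpha(\mu)\}$ is the set of all $\gamma\in\mathcal{M}(\mathbf{X}\times\mathbf{A})$ such that $\gamma(r)=\alpha$, $(\gamma-\mu)^{\mathbf{X}}=(\gamma-\mu)Q\mathbb{I}_{\Delta^c}$, and $-c\mu\le\gamma-\mu\le c\mu$ for some real $c>0$. 4. The linear subspace of $\mathcal{M}(\mathbf{X}\times\mathbf{A})$ parallel to $\mathrm{aff}\{\mathscr{F}_\alpha(\mu)\}$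 is $$\mathscr{V}_\alpha(\mu)=\{\nu\in\mathcal{M}(\mathbf{X}\times\mathbf{A}):\nu(r)=0,\ \nu^{\mathbf{X}}=\nu Q\mathbb{I}_{\Delta^c}\text{ and }-c\mu\le\nu\le c\mu\text{ for some real }c>0\}.$$
   Context: Notation. For a measurable space $\Omega$, $\mathcal{M}(\Omega)$ is the space of finite signed measures, $\mathcal{M}^{+}(\Omega)$ the set of finite nonnegative measures, $\mathcal{P}(\Omega)$ the set of probability measures. Inequalities between (signed) measures are setwise. For $\nu\in\mathcal{M}(\mathbf{X}\times\mathbf{A})$: $\nu(r)=\int r\,d\nu\in\mathbb{R}^d$ (componentwise); $\nu^{\mathbf{X}}(B)=\nu(B\times\mathbf{A})$ is the marginal on $\mathbf{X}$; $\nu Q(B)=\int Q(B|x,a)\,\nu(dx,da)$; and for a signed measure $\lambda$ on $\mathbf{X}$, $\lambda\mathbb{I}_{\Delta^c}(B)=\lambda(B\cap\Delta^c)$, so $\nu Q\mathbb{I}_{\Delta^c}(B)=\int Q(B\cap\Delta^c|x,a)\,\nu(dx,da)$. Model. A control model $\mathsf{M}=(\mathbf{X},\mathbf{A},\{\mathbf{A}(x)\}_{x\in\mathbf{X}},Q,\eta,r)$ consists of: a measurable state space $(\mathbf{X},\mathfrak{X})$; a Borel space $\mathbf{A}$ (action space, with its Borel $\sigma$-algebra $\mathfrak{B}(\mathbf{A})$; standing assumption: $\mathbf{A}$ is compact); nonempty measurable sets $\mathbf{A}(x)\subseteq\mathbf{A}$ of admissible actions, with $\mathbf{K}=\{(x,a)\in\mathbf{X}\times\mathbf{A}:a\in\mathbf{A}(x)\}$;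 a stochastic kernel $Q$ on $\mathbf{X}$ given $(\mathbf{X}\times\mathbf{A},\mathfrak{X}\otimes\mathfrak{B}(\mathbf{A}))$; an initial distribution $\eta\in\mathcal{P}(\mathbf{X})$; a bounded measurable function $r:\mathbf{X}\times\mathbf{A}\to\mathbb{R}^d$, $d\ge1$. It satisfies the measurability conditions if $\mathbf{K}\in\mathfrak{X}\otimes\mathfrak{B}(\mathbf{A})$ and there is a measurable function $\theta:\mathbf{X}\to\mathbf{A}$ with $\theta(x)\in\mathbf{A}(x)$ for all $x$. Policies. $\mathbf{H}_0=\mathbf{X}$ and $\mathbf{H}_n=\mathbf{H}_{n-1}\times\mathbf{A}\times\mathbf{X}$ for $n\ge1$, with product $\sigma$-algebras. A policy $\pi=\{\pi_n\}_{n\ge0}$ is a sequence of stochastic kernels $\pi_n$ on $\mathbf{A}$ given $\mathbf{H}_n$ with $\pi_n(\mathbf{A}(x_n)|h_n)=1$ for all $h_n=(x_0,a_0,\ldots,x_n)\in\mathbf{H}_n$; $\mathbf{\Pi}$ is the set of all policies. For $\pi\in\mathbf{\Pi}$, $\mathbb{P}_\pi$ is the unique probability measure on $(\mathbf{X}\times\mathbf{A})^\infty$, with coordinate processes $(X_n),(A_n)$ and $H_n=(X_0,A_0,\ldots,X_n)$, such that $X_0\sim\eta$, $\mathbb{P}_\pi(A_n\in\cdot\mid H_n)=\pi_n(\cdot|H_n)$ and $\mathbb{P}_\pi(X_{n+1}\in\cdot\mid H_n,A_n)=Q(\cdot|X_n,A_n)$ for all $n$; $\mathbb{E}_\pi$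 is the expectation under $\mathbb{P}_\pi$. Absorbing model. For $\Delta\in\mathfrak{X}$, let $T_\Delta=\min\{n\ge0:X_n\in\Delta\}$ ($+\infty$ if there is no such $n$). $\mathsf{M}$ is $\Delta$-absorbing if $Q(\Delta|x,a)=1$ and $r(x,a)=0$ for all $(x,a)\in\Delta\times\mathbf{A}$, and $\mathbb{E}_\pi[T_\Delta]<\infty$ for all $\pi\in\mathbf{\Pi}$. Occupancy measures. For $\pi\in\mathbf{\Pi}$, $\mu_\pi(\Gamma)=\mathbb{E}_\pi\big[\sum_{t=0}^\infty \mathbf{1}_{\{T_\Delta>t\}}\mathbf{1}_{\{(X_t,A_t)\in\Gamma\}}\big]$ for $\Gamma\in\mathfrak{X}\otimes\mathfrak{B}(\mathbf{A})$; this is a finite measure. $\mathcal{O}=\{\mu_\pi:\pi\in\mathbf{\Pi}\}$, a convex subset of $\mathcal{M}(\mathbf{X}\times\mathbf{A})$. Characteristic equations. $\mathcal{C}$ is the set of $\mu\in\mathcal{M}^+(\mathbf{X}\times\mathbf{A})$ with $\mu(\mathbf{K}^c)=0$ and $\mu^{\mathbf{X}}=(\eta+\mu Q)\mathbb{I}_{\Delta^c}$. Convexity. A face of a convex set $C$ is a nonempty convex subset $E\subseteq C$ such that $x\in E$, $x=ty+(1-t)z$ with $y,z\in C$, $0<t<1$, imply $y,z\in E$. The face of $C$ generated by $x\in C$ is the smallest face of $C$ containing $x$. $\mathrm{aff}$ denotes the affine hull. The relative algebraic interior $\mathrm{rai}[K]$ of a convex set $K$ is the set of $x\in K$ such that for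 every line $g$ in $\mathrm{aff}(K)$ containing $x$, $g\cap K$ includes an open segment containing $x$. *)

(* Defs.v *)
From HB Require Import structures.
From mathcomp Require Import all_boot all_order all_algebra.
From mathcomp Require Import all_classical all_reals all_analysis.

Set Implicit Arguments.
Unset Strict Implicit.
Unset Printing Implicit Defensive.

Import Order.TTheory GRing.Theory Num.Theory.
Import numFieldNormedType.Exports.

Local Open Scope classical_set_scope.
Local Open Scope ring_scope.

Section convexity.
Context (R : realType) (V : lmodType R).
Implicit Types (C E K L g : set V) (x y z v p : V).

Definition is_face C E :=
  [/\ E !=set0, convex_set (E : set (convex_lmodType V)), E `<=` C &
    forall x y z (t : R), E x -> C y -> C z -> 0 < t < 1 ->
      x = t *: y + (1 - t) *: z -> E y /\ E z].

Definition generated_face C x := smallest (is_face C) [set x].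

Definition is_affine L :=
  forall x y (t : R), L x -> L y -> L (t *: x + (1 - t) *: y).

Definition affine_hull K := smallest is_affine K.

Definition is_line g :=
  exists p v, v != 0 /\ g = [set p + t *: v | t in [set: R]].

Definition open_segment y z :=
  [set t *: y + (1 - t) *: z | t in [set t : R | 0 < t < 1]].

Definition rai K := [set x | K x /\
  forall g, is_line g -> g `<=` affine_hull K -> g x ->
    exists y z, [/\ y != z, open_segment y z x &
                    open_segment y z `<=` g `&` K]].

Definition is_linear_subspace (W : set V) :=
  W 0 /\ forall (a : R) u v, W u -> W v -> W (a *: u + v).

Definition parallel (W L : set V) :=
  is_linear_subspace W /\ exists p, L = [set p + v | v in W].

End convexity.

Section signed_measures.
Context d (T : measurableType d) (R : realType).

(* Measures and charges of the library are functions on all subsets of T, with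
   arbitrary values outside the sigma-algebra. Imposing the value 0 there makes
   Leibniz equality coincide with equality on measurable sets
   (smeasure_eqP), so that signed measures form a vector space. *)
Definition is_smeasure (m : set T -> R) :=
  [/\ m set0 = 0, semi_sigma_additive (EFin \o m) &
    forall B, ~ measurable B -> m B = 0].

Definition smeasure_pred : {pred set T -> R} := [pred m | `[< is_smeasure m >]].

Record smeasure := SMeasure {
  smeasure_fun :> set T -> R ;
  smeasureP : smeasure_fun \in smeasure_pred }.

HB.instance Definition _ := [isSub for smeasure_fun].
HB.instance Definition _ := [Choice of smeasure by <:].

Section charge_of_smeasure.
Variable m : smeasure.

Definition charge_of_smeasure : set T -> \bar R := EFin \o m.

Let c0 : charge_of_smeasure set0 = 0%E.
Proof.
by have /asboolP[m0 _ _] := smeasureP m; rewrite /charge_of_smeasure /= m0.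
Qed.

Let c_fin B : measurable B -> charge_of_smeasure B \is a fin_num.
Proof. by []. Qed.

Let c_sigma : semi_sigma_additive charge_of_smeasure.
Proof. by have /asboolP[] := smeasureP m. Qed.

HB.instance Definition _ := isCharge.Build _ _ _ charge_of_smeasure
  c0 c_fin c_sigma.

End charge_of_smeasure.

Lemma smeasure_submod_closed : submod_closed smeasure_pred.
Proof.
split.
  apply/asboolP; split => //.
  exact: (@charge_semi_sigma_additive _ _ _ (@czero _ T R)).
move=> a u v uS vS.
pose mu := SMeasure uS; pose mv := SMeasure vS.
move: (uS) (vS) => /asboolP[u0 _ uN] /asboolP[v0 _ vN].
apply/asboolP; split.
- by rewrite -[LHS]/(a * u set0 + v set0) u0 v0 mulr0 addr0.
- rewrite (_ : EFin \o _ = cadd (cscale a (charge_of_smeasure mu))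
                                (charge_of_smeasure mv)).
    exact: charge_semi_sigma_additive.
  by apply/funext.
- by move=> B mB; rewrite -[LHS]/(a * u B + v B) uN// vN// mulr0 addr0.
Qed.

HB.instance Definition _ :=
  GRing.isSubmodClosed.Build R (set T -> R) smeasure_pred
    smeasure_submod_closed.
HB.instance Definition _ := [SubChoice_isSubLmodule of smeasure by <:].

Lemma smeasure_eqP (m1 m2 : smeasure) :
  (forall B, measurable B -> m1 B = m2 B) <-> m1 = m2.
Proof.
split=> [m12|->//]; apply: val_inj; apply/funext => B /=.
have [mB|nB] := pselect (measurable B); first exact: m12.
have /asboolP[_ _ m10] := smeasureP m1; have /asboolP[_ _ m20] := smeasureP m2.
by rewrite m10// m20.
Qed.

(* The value does not depend on the Hahn decomposition chosen by cid. *)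
Definition sintegral (m : smeasure) (f : T -> R) : R :=
  let hP := cid (Hahn_decomposition (charge_of_smeasure m)) in
  let hN := cid (projT2 hP) in
  \int[jordan_pos (projT2 hN)]_x f x - \int[jordan_neg (projT2 hN)]_x f x.

Definition setwise_le (m1 m2 : smeasure) :=
  forall B, measurable B -> m1 B <= m2 B.

Definition setwise_eq (f g : set T -> R) :=
  forall B, measurable B -> f B = g B.

Definition nonnegative (m : smeasure) := forall B, measurable B -> 0 <= m B.

End signed_measures.
Arguments smeasure {d} T R.

Notation borel A := (g_sigma_algebraType (@open A)).

(* A is homeomorphic to a Borel subset of a Polish space P. *)
Definition borel_space (R : realType) (A : topologicalType) :=
  exists (P : completePseudoMetricType R) (e : A -> P),
    [/\ hausdorff_space P,
        exists2 S : set P, countable S & dense S,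
        injective e,
        forall U : set A, open U <-> exists2 W : set P, open W & U = e @^-1` W &
        <<s (@open P) >> (range e)].

Section cylinders.
Context d (T : measurableType d).

Definition cylinders : set (set (nat -> T)) :=
  \bigcup_n preimage_set_system setT (fun w : nat -> T => w n) measurable.

Definition sequence_space : measurableType cylinders.-sigma :=
  g_sigma_algebraType cylinders.

End cylinders.
Arguments sequence_space {d} T.

Record control_model d (X : measurableType d) (A : ptopologicalType)
    (R : realType) (k : nat) := ControlModel {
  adm : X -> set A ;
  trans : R.-pker (X * borel A) ~> X ;
  init : probability X R ;
  reward : X * borel A -> 'rV[R]_k ;
  adm_neq0 : forall x, adm x !=set0 ;
  measurable_adm : forall x, measurable (adm x : set (borel A)) ;
  measurable_reward : forall i, measurable_fun setT (fun z => reward z ord0 i) ;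
  bounded_reward : exists c : R, forall z i, `|reward z ord0 i| <= c }.

Section control_model_theory.
Context d (X : measurableType d) (A : ptopologicalType) (R : realType).
Context (k : nat) (M : control_model X A R k).

Definition graph_adm : set (X * borel A) := [set z | adm M z.1 z.2].

Definition measurability_conditions :=
  measurable graph_adm /\
  exists theta : X -> borel A,
    measurable_fun setT theta /\ forall x, adm M x (theta x).

Fixpoint hist_display n : measure_display :=
  match n with
  | 0 => d
  | m.+1 => ((hist_display m, (@open A).-sigma).-prod, d).-prod%mdisp
  end.

Fixpoint hist n : measurableType (hist_display n) :=
  match n with
  | 0 => X
  | m.+1 => (hist m * borel A * X)%type
  end.

Definition last_state n : hist n -> X :=
  match n with
  | 0 => id
  | m.+1 => snd
  end.

Record policy := Policy {
  policy_ker :> forall n, R.-pker (hist n) ~> borel A ;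
  policy_adm : forall n (h : hist n),
    policy_ker n h (adm M (last_state h)) = 1%E }.

Definition trajectory := sequence_space (X * borel A)%type.

Definition state (n : nat) (w : trajectory) : X := (w n).1.

Definition action (n : nat) (w : trajectory) : borel A := (w n).2.

Fixpoint history n (w : trajectory) : hist n :=
  match n with
  | 0 => state 0 w
  | m.+1 => (history m w, action m w, state m.+1 w)
  end.

(* P(fZ \in C | fY) = K(fY)(C) almost surely, in its integrated form. *)
Definition cond_law (P : probability trajectory R) dY (Y : measurableType dY)
    dZ (Z : measurableType dZ) (fY : trajectory -> Y) (fZ : trajectory -> Z)
    (K : Y -> {measure set Z -> \bar R}) :=
  forall B C, measurable B -> measurable C ->
    P (fY @^-1` B `&` fZ @^-1` C) = (\int[P]_(w in fY @^-1` B) K (fY w) C)%E.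

Definition is_strategic_measure (pi : policy) (P : probability trajectory R) :=
  [/\ forall B, measurable B -> P (state 0 @^-1` B) = init M B,
      forall n, cond_law P (@history n) (action n) (pi n) &
      forall n, cond_law P (fun w => (history n w, action n w)) (state n.+1)
        (fun ha => trans M (last_state ha.1, ha.2))].

Section absorbing_set.
Variable Delta : set X.

(* The infimum is a minimum, or +oo when the set is empty. *)
Definition hitting_time (w : trajectory) : \bar R :=
  ereal_inf [set n%:R%:E | n in [set n | Delta (state n w)]].

Definition absorbing :=
  (forall x a, Delta x -> trans M (x, a) Delta = 1%E /\ reward M (x, a) = 0) /\
  (forall pi P, is_strategic_measure pi P ->
    (\int[P]_w hitting_time w < +oo)%E).

Definition occupation (P : probability trajectory R) (G : set (X * borel A)) :=
  (\int[P]_w \sum_(0 <= t <oo)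
    (\1_[set w | (t%:R%:E < hitting_time w)%E] w *
     \1_[set w | G (state t w, action t w)] w)%:E)%E.

Definition occupancy_measures : set (smeasure (X * borel A)%type R) :=
  [set nu | exists pi P, is_strategic_measure pi P /\
    forall G, measurable G -> (nu G)%:E = occupation P G].

Definition marginal (nu : smeasure (X * borel A)%type R) (B : set X) : R :=
  nu (B `*` setT).

Definition kernel_image (nu : smeasure (X * borel A)%type R) (B : set X) : R :=
  sintegral nu (fun z => fine (trans M z B)).

Definition restrict_compl (l : set X -> R) (B : set X) : R := l (B `&` ~` Delta).

Definition characteristic_solutions : set (smeasure (X * borel A)%type R) :=
  [set nu | [/\ nonnegative nu, nu (~` graph_adm) = 0 &
    setwise_eq (marginal nu)
      (restrict_compl (fun B => fine (init M B) + kernel_image nu B))]].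

Definition reward_integral (nu : smeasure (X * borel A)%type R) : 'rV[R]_k :=
  \row_i sintegral nu (fun z => reward M z ord0 i).

Definition constrained_occupancy_measures (alpha : 'rV[R]_k) :=
  occupancy_measures `&` [set nu | reward_integral nu = alpha].

End absorbing_set.
End control_model_theory.

(* Main.v *)
(* Every occupancy measure solves the characteristic equations. The converse
   fails, but a solution [nu <= c mu] dominated by an occupancy measure [mu] is
   an occupancy measure. Disintegrate [nu = nu^X (x) phi] with an admissible
   kernel [phi] (Ionescu-Tulcea and bit-by-bit Radon-Nikodym derivatives, after
   coding the compact action space by binary sequences), and follow the
   stationary policy [phi]. Iterating the fixed-point equation of [nu^X] writes
   it as the occupation of the states up to time [n] plus the mass
   [int P_x(T > n) nu^X(dx)], which tends to [int P_x(T = oo) nu^X(dx)]. The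
   latter vanishes: by domination it is enough to integrate [P_x(T = oo)]
   against [mu], that is, to start [phi] from the state at time [t] of the
   policy of [mu], and switching to [phi] at time [t] is a policy, absorbed
   almost surely.

   The set of occupancy measures with reward [alpha] thus consists of
   nonnegative measures in the affine space [mu + W], [W] the solutions of the
   homogeneous linear equations, and contains every nonnegative element of
   [mu + W] dominated by a multiple of [mu]. The face of [mu], its affine hull
   and its relative algebraic interior are read off from this. *)
From HB Require Import structures.
Require Import Defs.
From mathcomp Require Import all_boot all_order all_algebra.
From mathcomp Require Import all_classical all_reals all_analysis.
From mathcomp Require Import measurable_realfun lra ring.

Set Implicit Arguments.
Unset Strict Implicit.
Unset Printing Implicit Defensive.

Import Order.TTheory GRing.Theory Num.Theory.
Import numFieldNormedType.Exports.

Local Open Scope classical_set_scope.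
Local Open Scope ring_scope.

(** * Operations on kernels *)

Local Open Scope ereal_scope.

(** The state space is an arbitrary measurable space, so no extension theorem resting on topological
    regularity applies to trajectories: their laws must come from the kernels alone, which is what
    Ionescu-Tulcea provides. It is used a second time to build the random bits of the
    disintegration. There the Radon-Nikodym densities are truncated so as to lie in [0, 1] at every
    point; each [x] then yields a genuine law on bit sequences, and no exceptional null set has to
    be removed along the prefixes.

    Policies must be admissible at every state, not almost everywhere; the selector [theta] repairs
    the kernel on the null set where it fails.

    The laws [P_x] of the stationary chain are never built. Survival probabilities are iterates of a
    one-step operator on functions, and [P_x(T = oo)] is their decreasing limit. Absorption is only
    assumed for trajectories started from [init], so it says nothing directly about the chain
    started from the marginal of [nu]; the switched policies and the domination by [mu] bridge this
    gap. *)

Section kbind.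
Context d1 d2 d3 (X : measurableType d1) (Y : measurableType d2)
  (Z : measurableType d3) (R : realType).
Variables (l : R.-pker X ~> Y) (k : R.-pker (X * Y) ~> Z).

Definition kbind : X -> {measure set Z -> \bar R} := mkcomp l k.

Let measurable_kbind U : measurable U -> measurable_fun setT (kbind ^~ U).
Proof.
move=> mU; apply: (measurable_fun_integral_finite_kernel (k ^~ U)) => //=.
exact/measurable_kernel.
Qed.

HB.instance Definition _ := isKernel.Build _ _ X Z R kbind measurable_kbind.

Let kbindT x : kbind x setT = 1.
Proof.
rewrite /kbind /= /kcomp; under eq_integral do rewrite prob_kernel.
by rewrite integral_cst// mul1e prob_kernel.
Qed.

HB.instance Definition _ := Kernel_isProbability.Build _ _ _ _ _ kbind kbindT.

Lemma kbindE x U : kbind x U = \int[l x]_y k (x, y) U.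
Proof. by []. Qed.

Lemma integral_kbind x f : (forall z, 0 <= f z) -> measurable_fun setT f ->
  \int[kbind x]_z f z = \int[l x]_y \int[k (x, y)]_z f z.
Proof. exact: integral_kcomp. Qed.

End kbind.

Section kpre.
Context d1 d2 d3 (X : measurableType d1) (Y : measurableType d2)
  (Z : measurableType d3) (R : realType).
Variables (k : R.-pker Y ~> Z) (f : X -> Y).

(** The measurability proof is an argument of the constant, so that the kernel instance is found
    from the term alone. *)
Definition kpre of measurable_fun setT f : X -> {measure set Z -> \bar R} :=
  fun x => k (f x).

Hypothesis mf : measurable_fun setT f.

Let measurable_kpre U : measurable U -> measurable_fun setT (kpre mf ^~ U).
Proof. by move=> mU; exact: measurableT_comp (measurable_kernel k U mU) mf. Qed.

HB.instance Definition _ :=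
  isKernel.Build _ _ X Z R (kpre mf) measurable_kpre.

Let kpreT x : kpre mf x setT = 1.
Proof. exact: prob_kernel. Qed.

HB.instance Definition _ :=
  Kernel_isProbability.Build _ _ _ _ _ (kpre mf) kpreT.

End kpre.

Section kmap.
Context d1 d2 d3 (X : measurableType d1) (Y : measurableType d2)
  (Z : measurableType d3) (R : realType).
Variables (k : R.-pker X ~> Y) (g : X * Y -> Z).
Hypothesis mg : measurable_fun setT g.

Definition kmap : R.-pker X ~> Z := kbind k (kdirac mg).

Lemma kmapE x U : measurable U -> kmap x U = k x [set y | U (g (x, y))].
Proof.
move=> mU; rewrite /kmap /= kbindE /kdirac /=.
rewrite (eq_integral (fun y => (\1_[set y | U (g (x, y))] y)%:E)).
  rewrite integral_indic ?setIT//.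
  rewrite -[X in measurable X]setTI.
  by have := measurableT_comp mg (pair1_measurable x); exact.
by move=> y _; rewrite diracE /indic; congr (_%:R%:E); apply/idP/idP => /set_mem ?; exact/mem_set.
Qed.

Lemma integral_kmap x f : (forall z, 0 <= f z) -> measurable_fun setT f ->
  \int[kmap x]_z f z = \int[k x]_y f (g (x, y)).
Proof.
move=> f0 mf; rewrite integral_kbind//; apply: eq_integral => y _.
by rewrite integral_dirac// diracT mul1e.
Qed.

End kmap.

Section kprod.
Context d1 d2 d3 (X : measurableType d1) (Y : measurableType d2)
  (Z : measurableType d3) (R : realType).
Variables (l : R.-pker X ~> Y) (k : R.-pker (X * Y) ~> Z).

Let mg : measurable_fun setT (fun p : X * Y * Z => (p.1.2, p.2)).
Proof.
apply: measurable_fun_pair => //.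
by apply: measurableT_comp => //; exact: measurable_fst.
Qed.

Definition kprod : R.-pker X ~> (Y * Z)%type := kbind l (kmap k mg).

Lemma kprodE x U : measurable U ->
  kprod x U = \int[l x]_y k (x, y) [set z | U (y, z)].
Proof.
by move=> mU; rewrite /kprod /= kbindE; apply: eq_integral => y _; rewrite kmapE.
Qed.

Lemma integral_kprod x f : (forall z, 0 <= f z) -> measurable_fun setT f ->
  \int[kprod x]_z f z = \int[l x]_y \int[k (x, y)]_z f (y, z).
Proof.
move=> f0 mf; rewrite integral_kbind//; apply: eq_integral => y _.
by rewrite integral_kmap.
Qed.

End kprod.

Section kcst.
Context d1 d2 (X : measurableType d1) (Y : measurableType d2) (R : realType).
Variable P : probability Y R.

Definition kcst (_ : X) : {measure set Y -> \bar R} := P.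

Let measurable_kcst U : measurable U -> measurable_fun setT (kcst ^~ U).
Proof. by move=> mU; exact: measurable_cst. Qed.

HB.instance Definition _ := isKernel.Build _ _ X Y R kcst measurable_kcst.

Let kcstT x : kcst x setT = 1.
Proof. exact: probability_setT. Qed.

HB.instance Definition _ := Kernel_isProbability.Build _ _ _ _ _ kcst kcstT.

End kcst.

Section kfamily.
Context d1 d2 (X : measurableType d1) (Y : measurableType d2) (R : realType).
Variable P : X -> probability Y R.

Definition kfamily of
    (forall U, measurable U -> measurable_fun setT (fun x => P x U)) :=
  fun x : X => (P x : {measure set Y -> \bar R}).

Hypothesis mP : forall U, measurable U -> measurable_fun setT (fun x => P x U).

HB.instance Definition _ := isKernel.Build _ _ X Y R (kfamily mP) mP.

Let kfamilyT x : kfamily mP x setT = 1.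
Proof. exact: probability_setT. Qed.

HB.instance Definition _ :=
  Kernel_isProbability.Build _ _ _ _ _ (kfamily mP) kfamilyT.

End kfamily.

Section mbind.
Context d2 d3 (Y : measurableType d2) (Z : measurableType d3) (R : realType).
Variables (m : {finite_measure set Y -> \bar R}) (k : R.-pker Y ~> Z).

(** A measure is a kernel from the one-point space; composition of kernels then gives
    sigma-additivity and iterated integration for [mbind]. *)
Let l (_ : unit) : {measure set Y -> \bar R} := m.

Let ml U : measurable U -> measurable_fun setT (l ^~ U).
Proof. by move=> mU; exact: measurable_cst. Qed.

HB.instance Definition _ := isKernel.Build _ _ unit Y R l ml.

Let l_fin : measure_fam_uub l.
Proof.
have mfin : m setT \is a fin_num by exact: fin_num_measure.
exists (fine (m setT) + 1)%R => x; rewrite EFinD fineK//.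
by rewrite /l lteDl.
Qed.

HB.instance Definition _ := Kernel_isFinite.Build _ _ unit Y R l l_fin.

Definition mbind : {measure set Z -> \bar R} :=
  mkcomp l (kpre k (@measurable_snd _ _ unit Y)) tt.

Lemma mbindE U : mbind U = \int[m]_y k y U.
Proof. by []. Qed.

Lemma integral_mbind f : (forall z, 0 <= f z) -> measurable_fun setT f ->
  \int[mbind]_z f z = \int[m]_y \int[k y]_z f z.
Proof. exact: integral_kcomp. Qed.

End mbind.

(** * The Ionescu-Tulcea theorem *)

Section sequence_space.
Context d (T : measurableType d).
Local Notation Omega := (sequence_space T).

Lemma measurable_coord n : measurable_fun setT (fun w : Omega => w n).
Proof.
move=> _ B mB; rewrite setTI; apply: sub_sigma_algebra.
by exists n => //; exists B => //; rewrite setTI.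
Qed.

Lemma measurable_sequenceP d' (X : measurableType d') (f : X -> Omega) :
  measurable_fun setT f <-> forall n, measurable_fun setT (fun x => f x n).
Proof.
split=> [mf n|mf]; first exact: measurableT_comp (measurable_coord n) mf.
apply: (@measurability _ _ X Omega setT f (@cylinders d T)) => // _ [_ [n _ [B mB <-]] <-].
by rewrite !setTI; have := mf n measurableT B mB; rewrite setTI.
Qed.

Definition upd n (p : Omega * T) : Omega :=
  fun i => if i == n then p.2 else p.1 i.

Lemma measurable_upd n : measurable_fun setT (upd n).
Proof.
apply/measurable_sequenceP => i; rewrite /upd.
case: (i == n); first exact: measurable_snd.
exact: measurableT_comp (measurable_coord i) measurable_fst.
Qed.

Definition agree n (v w : Omega) := forall i, (i < n)%N -> v i = w i.

(** Finite-dimensionality is a condition on points rather than measurability for a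
    sub-sigma-algebra; a measurable function of this kind factors through freezing the coordinates
    from [n] on. *)
Definition depends_below n (Y : Type) (f : Omega -> Y) :=
  forall v w, agree n v w -> f v = f w.

Lemma depends_belowW m n (Y : Type) (f : Omega -> Y) : (m <= n)%N ->
  depends_below m f -> depends_below n f.
Proof.
by move=> mn fm v w vw; apply: fm => i im; apply: vw; exact: leq_trans mn.
Qed.

Lemma agree_upd n v w t : agree n v w -> agree n.+1 (upd n (v, t)) (upd n (w, t)).
Proof.
move=> vw i; rewrite ltnS leq_eqVlt /upd /= => /orP[->//|ni].
by rewrite (ltn_eqF ni) vw.
Qed.

Lemma agree_upd_id n v t : agree n (upd n (v, t)) v.
Proof. by move=> i ni; rewrite /upd /= (ltn_eqF ni). Qed.

End sequence_space.

(** * Conditional expectations along a sequence of kernels *)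

Section tail_expectation.
Context d (T : measurableType d) (R : realType).
Local Notation Omega := (sequence_space T).
(** Kernels on whole trajectories that ignore the coordinates from [n] on stand for kernels on
    finite products, which would be dependent types. *)
Variable k : forall n : nat, R.-pker Omega ~> T.
Hypothesis k_dep : forall n v w B, measurable B -> agree n v w ->
  k n v B = k n w B.
Implicit Types f g : Omega -> \bar R.

Definition step n f : Omega -> \bar R := fun w => \int[k n w]_t f (upd n (w, t)).

(** Integrates out the coordinates [j + N - 1], ..., [j] in this order: the conditional expectation
    of [f] given the coordinates below [j], as soon as [f] depends only on those below [j + N]. *)
Fixpoint expect j N f := if N is N'.+1 then step j (expect j.+1 N' f) else f.

Lemma measurable_step n f : (forall w, 0 <= f w) -> measurable_fun setT f ->
  measurable_fun setT (step n f).
Proof.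
move=> f0 mf; apply: (measurable_fun_integral_finite_kernel (f \o upd n)) => //.
  by move=> z; exact: f0.
by apply: measurableT_comp => //; exact: measurable_upd.
Qed.

Lemma measurable_section n f w : measurable_fun setT f ->
  measurable_fun setT (fun t => f (upd n (w, t))).
Proof.
move=> mf; apply: measurableT_comp => //.
apply: measurableT_comp (measurable_upd n) _.
exact: pair1_measurable.
Qed.

Lemma step_ge0 n f w : (forall w, 0 <= f w) -> 0 <= step n f w.
Proof. by move=> f0; exact: integral_ge0. Qed.

Lemma step_dep n f : depends_below n.+1 f -> depends_below n (step n f).
Proof.
move=> fn v w vw; rewrite /step.
transitivity (\int[k n v]_t f (upd n (w, t))).
  by apply: eq_integral => t _; apply/fn/agree_upd.
by apply: eq_measure_integral => B mB _; exact: k_dep.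
Qed.

Lemma step_id n f : depends_below n f -> step n f = f.
Proof.
move=> fn; apply/funext => w; rewrite /step.
under eq_integral do rewrite (fn _ _ (@agree_upd_id _ _ _ _ _)).
by rewrite integral_cst// [X in _ * X]prob_kernel mule1.
Qed.

Lemma expect_ge0 j N f w : (forall w, 0 <= f w) -> 0 <= expect j N f w.
Proof. by move=> f0; elim: N j w => //= N IH j w; exact: step_ge0. Qed.

Lemma measurable_expect j N f : (forall w, 0 <= f w) -> measurable_fun setT f ->
  measurable_fun setT (expect j N f).
Proof.
move=> f0 mf; elim: N j => //= N IH j; apply: measurable_step => // w.
exact: expect_ge0.
Qed.

Lemma expect_dep m j N f : depends_below m f -> (m <= j + N)%N ->
  depends_below j (expect j N f).
Proof.
move=> fm; elim: N j => [|N IH] j /=.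
  by rewrite addn0 => mj; exact: depends_belowW fm.
by move=> mjN; apply/step_dep/IH; rewrite addSnnS.
Qed.

Lemma expect_stable m j N N' f : depends_below m f -> (m <= j + N)%N ->
  (N <= N')%N -> expect j N' f = expect j N f.
Proof.
move=> fm; elim: N' N j => [|N' IH] [|N] j //=; last first.
  by rewrite -addSnnS ltnS => mjN NN'; congr step; exact: IH.
rewrite addn0 => mj _; rewrite (IH 0%N j.+1)//=; last first.
  by rewrite addn0 ltnW.
by apply: step_id; exact: depends_belowW fm.
Qed.

Lemma expect_le j N f g : (forall w, 0 <= f w) -> measurable_fun setT f ->
  measurable_fun setT g -> (forall w, f w <= g w) ->
  forall w, expect j N f w <= expect j N g w.
Proof.
move=> f0 mf mg fg; have g0 w : 0 <= g w by exact: le_trans (fg w).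
elim: N j => //= N IH j w; apply: ge0_le_integral => //.
- by move=> t _; exact: expect_ge0.
- exact: measurable_section (measurable_expect _ _ _ _).
- exact: measurable_section (measurable_expect _ _ _ _).
Qed.

Lemma expect_cst1 j N : expect j N (cst 1) = cst 1.
Proof. by elim: N j => //= N IH j; rewrite IH; exact: step_id. Qed.

Lemma step_cvg n (f : nat -> Omega -> \bar R) g :
  (forall i, measurable_fun setT (f i)) ->
  (forall i w, 0 <= f i w) -> (forall i w, f i w <= 1) ->
  (forall w, f ^~ w @ \oo --> g w) ->
  forall w, step n (f i) w @[i --> \oo] --> step n g w.
Proof.
move=> mf f0 f1 fg w.
have mg : measurable_fun setT g.
  by apply: (emeasurable_fun_cvg f) => // x _; exact: fg.
apply: (@dominated_cvg _ _ _ (k n w) setT measurableT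
  (fun i t => f i (upd n (w, t))) (fun t => g (upd n (w, t))) (cst 1)) => //.
- by move=> i; exact: measurable_section.
- apply/integrableP; split; first exact: measurable_cst.
  under eq_integral do rewrite /= normr1.
  by rewrite integral_cst// mul1e [ltLHS]prob_kernel ltry.
- by move=> i t _; rewrite gee0_abs.
Qed.

End tail_expectation.

(* A copy of [nat -> T] bearing the algebra of finite-dimensional measurable
   sets, the domain of the content to be extended. *)
Definition cyl_space d (T : measurableType d) : Type := nat -> T.

(** An opaque tag, giving the algebra of cylinders a display distinct from that of [T]. *)
Definition cyl_display : measure_display -> measure_display.
Proof. by []. Qed.

Section cylinder_algebra.
Context d (T : measurableType d).
Local Notation Omega := (sequence_space T).

Definition finite_dim (B : set (cyl_space T)) :=
  measurable (B : set Omega) /\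
  exists n, @depends_below _ T n Prop (B : set Omega).

HB.instance Definition _ := Pointed.copy (cyl_space T) (nat -> T).

Let finite_dim0 : finite_dim set0.
Proof. by split; [exact: measurable0|exists 0%N]. Qed.

Let finite_dimU : setU_closed finite_dim.
Proof.
move=> A B [mA [m Am]] [mB [n Bn]]; split; first exact: measurableU.
exists (maxn m n) => v w vw; rewrite /setU /mkset.
by rewrite (depends_belowW (leq_maxl m n) Am vw)
           (depends_belowW (leq_maxr m n) Bn vw).
Qed.

Let finite_dimC : setC_closed finite_dim.
Proof.
move=> A [mA [m Am]]; split; first exact: measurableC.
by exists m => v w vw; rewrite /setC /mkset (Am v w vw).
Qed.

HB.instance Definition _ := @isAlgebraOfSets.Build (cyl_display d)
  (cyl_space T) finite_dim finite_dim0 finite_dimU finite_dimC.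

Lemma measurable_cyl_sigma (B : set Omega) :
  measurable B -> <<s (@measurable _ (cyl_space T)) >> B.
Proof.
apply: smallest_sub; first exact: smallest_sigma_algebra.
move=> _ [n _ [C mC <-]]; apply: sub_sigma_algebra; rewrite setTI; split.
  by rewrite -[X in measurable X]setTI; exact: measurable_coord.
by exists n.+1 => v w vw; rewrite /preimage /mkset (vw n).
Qed.

Lemma depends_below_indic (R : realType) n (B : set Omega) :
  depends_below n B -> depends_below n (EFin \o (\1_B : Omega -> R)).
Proof.
move=> Bn v w vw /=; rewrite !indicE.
suff -> : (v \in B) = (w \in B) by [].
by apply/idP/idP => /set_mem Bx; apply/mem_set; rewrite ?(Bn _ _ vw)// -(Bn _ _ vw).
Qed.

End cylinder_algebra.

Section expect_extra.
Context d (T : measurableType d) (R : realType).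
Local Notation Omega := (sequence_space T).
Variable k : forall n : nat, R.-pker Omega ~> T.
Implicit Types f g : Omega -> \bar R.

Lemma expectD j N f g : (forall w, 0 <= f w) -> measurable_fun setT f ->
  (forall w, 0 <= g w) -> measurable_fun setT g ->
  expect k j N (f \+ g) = expect k j N f \+ expect k j N g.
Proof.
move=> f0 mf g0 mg; elim: N j => //= N IH j; rewrite IH; apply/funext => w.
rewrite /step ge0_integralD//.
- by move=> t _; exact: expect_ge0.
- exact: measurable_section (measurable_expect _ _ _ _ _).
- by move=> t _; exact: expect_ge0.
- exact: measurable_section (measurable_expect _ _ _ _ _).
Qed.

(** Peels off the innermost integration, where the recursive definition peels off the outermost one;
    this is the order in which [marginal_law] adds coordinates. *)
Lemma expectSr j N f : expect k j N.+1 f = expect k j N (step k (j + N) f).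
Proof.
elim: N j => [|N IH] j; first by rewrite addn0.
by rewrite -[LHS]/(step k j (expect k j.+1 N.+1 f)) IH addSnnS.
Qed.

(** Redraws the coordinates below [n] and keeps the others from the starting trajectory; the start
    [point] gives the finite-dimensional laws. *)
Fixpoint marginal_law n : R.-pker Omega ~> Omega :=
  match n with
  | 0 => kdirac (@measurable_id _ Omega setT)
  | m.+1 => kbind (marginal_law m)
              (kpre (kmap (k m) (@measurable_upd _ T m)) measurable_snd)
  end.

Lemma integral_marginal_law n f w : (forall w, 0 <= f w) ->
  measurable_fun setT f -> \int[marginal_law n w]_v f v = expect k 0 n f w.
Proof.
elim: n f => [|n IH] f f0 mf; first by rewrite /= integral_dirac// diracT mul1e.
rewrite expectSr add0n -IH; last 2 first.
- by move=> v; exact: step_ge0.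
- exact: measurable_step.
rewrite integral_kbind//; apply: eq_integral => v _.
exact: (integral_kmap (k n) (@measurable_upd _ T n) v f0 mf).
Qed.

End expect_extra.

(** * The content on cylinders and its continuity at the empty set *)

Section ionescu_tulcea.
Context d (T : measurableType d) (R : realType).
Local Notation Omega := (sequence_space T).
Variable k : forall n : nat, R.-pker Omega ~> T.
Hypothesis k_dep : forall n v w B, measurable B -> agree n v w ->
  k n v B = k n w B.

Let ind (B : set Omega) : Omega -> \bar R := EFin \o \1_B.

Let ind_ge0 B w : 0 <= ind B w.
Proof. by rewrite lee_fin. Qed.

Let ind_le1 B w : ind B w <= 1.
Proof. by rewrite lee_fin indicE; case: (_ \in _). Qed.

Let mind B : measurable B -> measurable_fun setT (ind B).
Proof. by move=> mB; apply/measurable_EFinP. Qed.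

(** By [expect_stable] every admissible number of coordinates gives the same value, so the one
    picked by [xget] is immaterial. *)
Definition cyl_content (B : set (cyl_space T)) : \bar R :=
  expect k 0 (xget 0%N [set n | depends_below n (B : set Omega)])
    (EFin \o \1_(B : set Omega)) point.

Lemma cyl_contentE n (B : set Omega) : depends_below n B ->
  cyl_content B = expect k 0 n (EFin \o \1_B) point.
Proof.
move=> Bn; rewrite /cyl_content; set N := xget _ _.
have BN : depends_below N B by apply: (@xgetPex _ 0%N [set n | depends_below n B]); exists n.
have iN := depends_below_indic R BN; have i_n := depends_below_indic R Bn.
by case/orP: (leq_total n N) => le;
  [rewrite (expect_stable k i_n _ le)|rewrite (expect_stable k iN _ le)];
  rewrite ?add0n.
Qed.

Lemma cyl_content_ge0 B : 0 <= cyl_content B.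
Proof. by apply: expect_ge0 => w; exact: ind_ge0. Qed.

Lemma cyl_contentD : additive2 cyl_content.
Proof.
move=> A B [mA [m Am]] [mB [n Bn]] AB0.
have A' := depends_belowW (leq_maxl m n) Am.
have B' := depends_belowW (leq_maxr m n) Bn.
have AB' : depends_below (maxn m n) ((A `|` B) : set Omega).
  by move=> v w vw; rewrite /setU /mkset (A' v w vw) (B' v w vw).
rewrite (cyl_contentE A') (cyl_contentE B') (cyl_contentE AB').
rewrite (_ : EFin \o _ = ind A \+ ind B).
  by rewrite expectD//; exact: mind.
apply/funext => w /=; rewrite /ind /= -EFinD; congr (_%:E).
rewrite !indicE in_setU; case: (boolP (w \in A)) => Aw; last by rewrite add0r.
case: (boolP (w \in B)) => Bw; last by rewrite addr0.
have : (A `&` B) w by split; exact: set_mem.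
by rewrite AB0.
Qed.

Lemma cyl_content0 : cyl_content set0 = 0.
Proof.
have d0 : depends_below 0 (set0 : set Omega) by [].
by rewrite (cyl_contentE d0) /= indicE in_set0.
Qed.

Lemma cyl_contentT : cyl_content setT = 1.
Proof.
have d0 : depends_below 0 (setT : set Omega) by [].
by rewrite (cyl_contentE d0) /= indicE in_setT.
Qed.

HB.instance Definition _ := isContent.Build _ _ _ cyl_content cyl_content_ge0
  ((additive2P cyl_content0).2 cyl_contentD).

Section decreasing_cylinders.
Variable F : nat -> set Omega.
Hypothesis mF : forall i, measurable (F i).
Variable n : nat -> nat.
Hypothesis Fn : forall i, depends_below (n i) (F i).
Hypothesis F_dec : forall i, F i.+1 `<=` F i.
Hypothesis F_pos : 0 < ereal_inf (range (fun i => cyl_content (F i))).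

(* [tail i j w] is the conditional probability of [F i] given the first [j]
   coordinates of [w]. *)
Let tail i j := expect k j (n i) (ind (F i)).
Let glb j w := ereal_inf (range (fun i => tail i j w)).

Let tailE i j N : (n i <= j + N)%N -> tail i j = expect k j N (ind (F i)).
Proof.
move=> niN; have Fi := depends_below_indic R (@Fn i).
have ni : (n i <= j + n i)%N by rewrite leq_addl.
by case/orP: (leq_total (n i) N) => le;
  rewrite /tail (expect_stable k Fi _ le).
Qed.

Let tail_dep i j : depends_below j (tail i j).
Proof.
by apply: expect_dep k_dep _ _ _ _ (depends_below_indic R (@Fn i)) _; rewrite ?leq_addl.
Qed.

Let tail_ge0 i j w : 0 <= tail i j w.
Proof. by apply: expect_ge0 => v; exact: ind_ge0. Qed.

Let measurable_tail i j : measurable_fun setT (tail i j).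
Proof. by apply: measurable_expect => //; exact: mind. Qed.

Let tail_le1 i j w : tail i j w <= 1.
Proof.
apply: (le_trans (expect_le k j (n i) (ind_ge0 (F i)) _ _ (ind_le1 (F i)) w)).
- exact: mind.
- exact: measurable_cst.
- by rewrite expect_cst1.
Qed.

Let tail_cvg j w : tail i j w @[i --> \oo] --> glb j w.
Proof.
apply: ereal_nonincreasing_cvgn; apply/nonincreasing_seqP => i.
pose N := maxn (n i) (n i.+1).
rewrite (@tailE i j N); last by rewrite (leq_trans _ (leq_addl j N))// leq_maxl.
rewrite (@tailE i.+1 j N); last by rewrite (leq_trans _ (leq_addl j N))// leq_maxr.
apply: expect_le => //; [exact: mind|exact: mind|].
move=> v; rewrite lee_fin !indicE ler_nat.
by case: (boolP (v \in F i.+1)) => // /set_mem /F_dec /mem_set ->.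
Qed.

Let glb_dep j : depends_below j (glb j).
Proof.
move=> v w vw; rewrite /glb.
suff -> : (fun i => tail i j v) = (fun i => tail i j w) by [].
by apply/funext => i; exact: (@tail_dep i j _ _ vw).
Qed.

(** By dominated convergence, the limits of the conditional probabilities given [j + 1] coordinates
    average to the limit given [j] coordinates. *)
Let glb_step j w : step k j (glb j.+1) w = glb j w.
Proof.
have h := @step_cvg _ _ _ k j _ _ (fun i => measurable_tail i j.+1) (fun i => @tail_ge0 i j.+1)
  (fun i => @tail_le1 i j.+1) (@tail_cvg j.+1).
apply: (cvg_unique _ (h w)); first exact: ereal_hausdorff.
rewrite (_ : (fun i => _) = (fun i => tail i j w)); first exact: tail_cvg.
apply/funext => i; rewrite (@tailE i j (n i).+1)//.
by rewrite addnS ltnW// ltnS leq_addl.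
Qed.

(** If the limit vanished for every choice of the next coordinate, so would its average, which is
    [glb j w]. *)
Let glb_next j w : exists t, 0 < glb j w -> 0 < glb j.+1 (upd j (w, t)).
Proof.
have [[t gt0]|noex] := pselect (exists t, 0 < glb j.+1 (upd j (w, t))).
  by exists t.
exists point => gt0; exfalso; move: gt0.
rewrite -glb_step /step integral0_eq ?ltxx// => t _.
apply/eqP; rewrite eq_le; apply/andP; split.
  by rewrite leNgt; apply/negP => ?; apply: noex; exists t.
by apply: le_ereal_inf_tmp => _ [i _ <-].
Qed.

Let next j w := projT1 (cid (glb_next j w)).

Fixpoint approx j : Omega :=
  if j is i.+1 then upd i (approx i, next i (approx i)) else point.

(** The point is built coordinate by coordinate, keeping the limiting conditional probability
    positive. Once the first [n i] coordinates are fixed, the conditional probability of [F i] is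
    its indicator, so positivity means membership. *)
Lemma decreasing_cylinders_meet : exists w, forall i, F i w.
Proof.
have glb_approx j : 0 < glb j (approx j).
  elim: j => [|j IH]; last by rewrite /= /next; case: cid => t /=; exact.
  rewrite /= /glb (_ : (fun i => _) = fun i => cyl_content (F i))//.
  by apply/funext => i; rewrite (cyl_contentE (@Fn i)).
pose w : Omega := fun i => approx i.+1 i.
have agree_w j : agree j (approx j) w.
  move=> i; elim: j => // j IH; rewrite ltnS leq_eqVlt => /orP[/eqP->//|ij].
  by rewrite -IH//= /upd /= (ltn_eqF ij).
exists w => i; have := glb_approx (n i); rewrite (glb_dep (@agree_w _)).
have : glb (n i) w <= tail i (n i) w by apply: ereal_inf_lbound; exists i.
move=> /[swap] /lt_le_trans /[apply].
rewrite (@tailE i (n i) 0%N) ?addn0//= /ind /= indicE.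
by case: (boolP (w \in F i)) => [/set_mem//|_]; rewrite ltxx.
Qed.

End decreasing_cylinders.
End ionescu_tulcea.

(** * Extension of the content to a law on trajectories *)

Section ionescu_tulcea_extension.
Context d (T : measurableType d) (R : realType).
Local Notation Omega := (sequence_space T).
Variable k : forall n : nat, R.-pker Omega ~> T.
Hypothesis k_dep : forall n v w B, measurable B -> agree n v w ->
  k n v B = k n w B.

Lemma cyl_content_le1 (B : set (cyl_space T)) : measurable B ->
  cyl_content k B <= 1.
Proof.
move=> mB; rewrite -(cyl_contentT k); apply: le_measure; rewrite ?inE//.
Qed.

Lemma cyl_content_cvg0 (F : nat -> set (cyl_space T)) :
  (forall i, measurable (F i)) -> (forall i, F i.+1 `<=` F i) ->
  \bigcap_i F i = set0 -> cyl_content k (F i) @[i --> \oo] --> 0.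
Proof.
move=> mF F_dec F0.
have mu_dec : nonincreasing_seq (cyl_content k \o F).
  apply/nonincreasing_seqP => i /=.
  by apply: le_measure; rewrite ?inE//; exact: F_dec.
suff <- : ereal_inf (range (cyl_content k \o F)) = 0.
  exact: ereal_nonincreasing_cvgn.
apply/eqP; rewrite eq_le; apply/andP; split; last first.
  by apply: le_ereal_inf_tmp => _ [i _ <-] /=; exact: cyl_content_ge0.
rewrite leNgt; apply/negP => inf_gt0.
pose n i := projT1 (cid (mF i).2).
have Fn i : depends_below (n i) (F i : set Omega).
  by rewrite /n; case: cid.
have [w Fw] := decreasing_cylinders_meet k_dep (fun i => (mF i).1) Fn F_dec inf_gt0.
have : (\bigcap_i F i) w by move=> i _; exact: Fw.
by rewrite F0.
Qed.

Let semi_sigma_additive_cyl_content : semi_sigma_additive (cyl_content k).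
Proof.
move=> F mF tF mUF.
(* Sigma-additivity follows from continuity at the empty set, applied to the remainders [D n] of the
   union. *)
pose D n := (\bigcup_i F i) `\` \big[setU/set0]_(i < n) F i.
have mS n : measurable (\big[setU/set0]_(i < n) F i).
  exact: bigsetU_measurable.
have mD n : measurable (D n) by exact: measurableD.
have D_cvg : cyl_content k (D n) @[n --> \oo] --> 0.
  apply: cyl_content_cvg0 => //.
    by move=> n; apply: setDS; rewrite big_ord_recr/=; exact: subsetUl.
  rewrite -subset0 => w Dw; have [[i _ Fiw] _] := Dw 0%N I.
  have [_] := Dw i.+1 I; apply.
  by rewrite big_ord_recr/=; right.
have fD n : cyl_content k (D n) \is a fin_num.
  rewrite ge0_fin_numE ?cyl_content_ge0//.
  by rewrite (le_lt_trans (cyl_content_le1 (mD n)))// ltry.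
have sumE n : \sum_(0 <= i < n) cyl_content k (F i) =
    cyl_content k (\bigcup_i F i) - cyl_content k (D n).
  rewrite big_mkord -(@measure_semi_additive _ _ _ (cyl_content k) F n mF tF (mS n)).
  have UE : \big[setU/set0]_(i < n) F i `|` D n = \bigcup_i F i.
    by rewrite setDUK// -bigcup_mkord => w [i _ Fw]; exists i.
  rewrite -[X in _ = cyl_content k X - _]UE cyl_contentD//.
    by rewrite addeK.
  by rewrite /D setDE setIC -setIA setICl setI0.
rewrite (_ : (fun n => _) = fun n =>
  cyl_content k (\bigcup_i F i) - cyl_content k (D n)); last by apply/funext.
rewrite -[X in _ --> X]sube0; apply: cvgeB; [|exact: cvg_cst|exact: D_cvg].
by rewrite fin_num_adde_defl.
Qed.

HB.instance Definition _ := Content_isMeasure.Build _ _ _ (cyl_content k)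
  semi_sigma_additive_cyl_content.

Definition trajectory_law (B : set Omega) : \bar R :=
  measure_extension (cyl_content k : {measure set (cyl_space T) -> \bar R}) B.

Let trajectory_law0 : trajectory_law set0 = 0.
Proof. exact: measure0. Qed.

Let trajectory_law_ge0 B : 0 <= trajectory_law B.
Proof. exact: measure_ge0. Qed.

Let semi_sigma_additive_trajectory_law : semi_sigma_additive trajectory_law.
Proof.
move=> F mF tF mUF; apply: (@measure_semi_sigma_additive _ _ _
  (measure_extension (cyl_content k : {measure set (cyl_space T) -> \bar R}))).
- by move=> i; exact: measurable_cyl_sigma.
- exact: tF.
- exact: measurable_cyl_sigma.
Qed.

HB.instance Definition _ := isMeasure.Build _ _ _ trajectory_law
  trajectory_law0 trajectory_law_ge0 semi_sigma_additive_trajectory_law.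

Lemma trajectory_lawE n (B : set Omega) : measurable B -> depends_below n B ->
  trajectory_law B = marginal_law k n point B.
Proof.
move=> mB Bn.
have cylB : measurable (B : set (cyl_space T)) by split => //; exists n.
rewrite /trajectory_law /measure_extension measurable_mu_extE//.
rewrite [LHS](cyl_contentE k Bn) -integral_marginal_law.
- by rewrite integral_indic ?setIT.
- by move=> w; rewrite lee_fin.
- exact/measurable_EFinP.
Qed.

Let trajectory_lawT : trajectory_law setT = 1.
Proof. by rewrite (@trajectory_lawE 0%N)//; exact: prob_kernel. Qed.

HB.instance Definition _ := Measure_isProbability.Build _ _ _ trajectory_law
  trajectory_lawT.

Lemma integral_trajectory_law n (f : Omega -> \bar R) :
  (forall w, 0 <= f w) -> measurable_fun setT f -> depends_below n f ->
  \int[trajectory_law]_w f w = \int[marginal_law k n point]_w f w.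
Proof.
move=> f0 mf fn.
(* [cut] freezes the coordinates from [n] on. Since [f = f \o cut], it is enough to compare the
   images of the two laws under [cut], and preimages under [cut] are cylinders. *)
pose cut (w : Omega) : Omega := fun i => if (i < n)%N then w i else point.
have mcut : measurable_fun setT cut.
  apply/measurable_sequenceP => i; rewrite /cut; case: (i < n)%N.
    exact: measurable_coord.
  exact: measurable_cst.
have fcut : f = f \o cut.
  by apply/funext => w; apply: fn => i ni; rewrite /cut ni.
rewrite fcut -!(@ge0_integral_pushforward _ _ _ _ _ _ mcut _ setT)//.
apply: eq_measure_integral => B mB _; apply: trajectory_lawE.
  by rewrite -[X in measurable X]setTI; exact: mcut.
move=> v w vw; rewrite /preimage /mkset; suff -> : cut v = cut w by [].
by apply/funext => i; rewrite /cut; case: ifPn => // /vw.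
Qed.

(** The one-step form is the one from which conditional laws are read off; the finite-dimensional
    marginals stay inside the proof. *)
Theorem ionescu_tulcea : exists P : probability Omega R,
  forall n (f : Omega -> \bar R), (forall w, 0 <= f w) ->
    measurable_fun setT f -> depends_below n.+1 f ->
    \int[P]_w f w = \int[P]_w \int[k n w]_t f (upd n (w, t)).
Proof.
exists trajectory_law => n f f0 mf fn.
rewrite (@integral_trajectory_law n.+1)// integral_marginal_law// expectSr add0n.
have s0 w : 0 <= step k n f w by exact: step_ge0.
have ms : measurable_fun setT (step k n f) by exact: measurable_step.
rewrite -integral_marginal_law// -(@integral_trajectory_law n)//.
exact: step_dep.
Qed.

End ionescu_tulcea_extension.

(** * Existence of strategic measures *)

Section strategic_measure.
Context d (X : measurableType d) (A : ptopologicalType) (R : realType).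
Context (k : nat) (M : control_model X A R k).
Local Notation Omega := (trajectory X A).
Local Notation XA := (X * borel A)%type.

Lemma measurable_state n : measurable_fun setT (@state _ X A n).
Proof.
exact: measurableT_comp measurable_fst (@measurable_coord _ XA n).
Qed.

Lemma measurable_action n : measurable_fun setT (@action _ X A n).
Proof.
exact: measurableT_comp measurable_snd (@measurable_coord _ XA n).
Qed.

Lemma measurable_history n : measurable_fun setT (@history _ X A n).
Proof.
elim: n => [|n IH]; first exact: measurable_state.
apply: measurable_fun_pair; last exact: measurable_state.
by apply: measurable_fun_pair => //; exact: measurable_action.
Qed.

Lemma measurable_last_state n : measurable_fun setT (@last_state _ X A n).
Proof. by case: n => [|n]; [exact: measurable_id|exact: measurable_snd]. Qed.

Lemma last_state_history n (w : Omega) : last_state (history n w) = state n w.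
Proof. by case: n. Qed.

Lemma history_agree n (v w : Omega) : agree n v w -> state n v = state n w ->
  history n v = history n w.
Proof.
elim: n => //= n IH vw Sn; congr (_, _, _) => //.
- by apply: IH; [move=> i ni; apply: vw; exact: ltnW|rewrite /state vw].
- by rewrite /action vw.
Qed.

Lemma history_dep n : depends_below n.+1 (@history _ X A n).
Proof.
move=> v w vw; apply: history_agree; last by rewrite /state vw.
by move=> i ni; apply: vw; exact: ltnW.
Qed.

Lemma state_upd n (w : Omega) z : state n (upd n (w, z)) = z.1.
Proof. by rewrite /state /upd eqxx. Qed.

Lemma action_upd n (w : Omega) z : action n (upd n (w, z)) = z.2.
Proof. by rewrite /action /upd eqxx. Qed.

Section existence.
Variable pi : policy M.

Definition state_ker n : R.-pker Omega ~> X :=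
  match n with
  | 0 => kcst (init M)
  | m.+1 => kpre (trans M) (@measurable_coord _ XA m)
  end.

(* [history n] does not look at the n-th action, so [point] is a dummy. *)
Definition extend_history n (p : Omega * X) : hist X A n :=
  history n (upd n (p.1, (p.2, point : borel A))).

Lemma measurable_extend_history n : measurable_fun setT (extend_history n).
Proof.
have mp : measurable_fun setT
    (fun p : Omega * X => (p.1, (p.2, point : borel A))).
  apply: measurable_fun_pair; first exact: measurable_fst.
  by apply: measurable_fun_pair; [exact: measurable_snd|exact: measurable_cst].
have mu := measurableT_comp (@measurable_upd _ XA n) mp.
by have := measurableT_comp (@measurable_history n) mu.
Qed.

Lemma extend_historyE n (w : Omega) (x : X) (a : borel A) :
  extend_history n (w, x) = history n (upd n (w, (x, a))).
Proof.
apply: history_agree; first by move=> i ni; rewrite /upd /= (ltn_eqF ni).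
by rewrite /state /upd eqxx.
Qed.

(** A coordinate is a state-action pair: the state is drawn first, then the action from the history
    completed by that state. *)
Definition step_ker n : R.-pker Omega ~> XA :=
  kprod (state_ker n) (kpre (pi n) (@measurable_extend_history n)).

Lemma step_ker_dep n (v w : Omega) B : measurable B -> agree n v w ->
  step_ker n v B = step_ker n w B.
Proof.
move=> mB vw; rewrite !kprodE//.
have -> : state_ker n v = state_ker n w.
  by case: n vw => // n vw; rewrite /= /kpre vw.
apply: eq_integral => x _.
have E : extend_history n (v, x) = extend_history n (w, x).
  by apply: history_dep; exact: agree_upd.
by rewrite /= /kpre E.
Qed.

Lemma strategic_measure_exists : exists P, is_strategic_measure pi P.
Proof.
have [P Pstep] := ionescu_tulcea step_ker_dep.
have stepE n (f : Omega -> \bar R) : (forall w, 0 <= f w) ->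
    measurable_fun setT f -> depends_below n.+1 f ->
    \int[P]_w f w = \int[P]_w \int[state_ker n w]_x
      \int[pi n (extend_history n (w, x))]_a f (upd n (w, (x, a))).
  move=> f0 mf fn; rewrite (Pstep n)//; apply: eq_integral => w _.
  by rewrite integral_kprod//; exact: measurable_section.
have i0 (Y : Type) (B : set Y) (y : Y) : 0 <= (\1_B y)%:E :> \bar R.
  by rewrite lee_fin.
have mi dY (Y : measurableType dY) (B : set Y) (y : Omega -> Y) :
    measurable B -> measurable_fun setT y ->
    measurable_fun setT (fun w => (\1_B (y w))%:E : \bar R).
  by move=> mB my; apply/measurable_EFinP; apply: measurableT_comp my.
(* A conditional law stated on sets reduces to an identity between integrals over the whole space,
   to which [stepE] applies. *)
have condE dY dZ (Y : measurableType dY) (Z : measurableType dZ) (B : set Y)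
    (C : set Z) (y : Omega -> Y) (z : Omega -> Z) (K : Y -> {measure set Z -> \bar R}) :
    measurable B -> measurable C -> measurable_fun setT y -> measurable_fun setT z ->
    \int[P]_w ((\1_B (y w))%:E * (\1_C (z w))%:E) =
    \int[P]_w ((\1_B (y w))%:E * K (y w) C) ->
    P (y @^-1` B `&` z @^-1` C) = \int[P]_(w in y @^-1` B) K (y w) C.
  move=> mB mC my mz E.
  have mS : measurable (y @^-1` B `&` z @^-1` C).
    by apply: measurableI; rewrite -[X in measurable X]setTI; [exact: my|exact: mz].
  rewrite -[X in P X]setIT -integral_indic// [RHS]integral_mkcond.
  transitivity (\int[P]_w ((\1_B (y w))%:E * K (y w) C)).
    by rewrite -E; apply: eq_integral => w _; rewrite indicI /= EFinM.
  by apply: eq_integral => w _; rewrite epatch_indic muleC.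
exists P; split.
- move=> B mB.
  have mS : measurable (@state _ X A 0 @^-1` B).
    by rewrite -[X in measurable X]setTI; exact: measurable_state.
  rewrite -[X in P X]setIT -integral_indic// (stepE 0%N)//; last 2 first.
  + by apply: (mi _ _ B) => //; exact: measurable_state.
  + by apply: depends_below_indic => v w vw; rewrite /preimage /mkset /state vw.
  under eq_integral => w _.
    under eq_integral => x _.
      rewrite (_ : \int[_]_a _ = (\1_B x)%:E); last first.
        under eq_integral do rewrite (_ : (\1_(_ @^-1` _) _)%:E = (\1_B x)%:E)//.
        by rewrite integral_cst// [X in _ * X]prob_kernel mule1.
      over.
    rewrite integral_indic// setIT.
    over.
  by rewrite /= integral_cst// [X in _ * X]probability_setT mule1.
- move=> n B C mB mC; apply: condE => //.
  + exact: measurable_history.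
  + exact: measurable_action.
  have mK : measurable_fun setT (fun w : Omega => pi n (history n w) C).
    exact: measurableT_comp (measurable_kernel (pi n) C mC) (@measurable_history n).
  rewrite (stepE n); last 3 first.
  + by move=> w; exact: mule_ge0.
  + by apply: emeasurable_funM; apply: mi => //;
      [exact: measurable_history|exact: measurable_action].
  + by move=> v w vw; rewrite (history_dep vw) /action vw.
  rewrite [RHS](stepE n); last 3 first.
  + by move=> w; exact: mule_ge0.
  + by apply: emeasurable_funM => //; apply: mi => //; exact: measurable_history.
  + by move=> v w vw; rewrite (history_dep vw).
  apply: eq_integral => w _; apply: eq_integral => x _.
  under eq_integral => a _ do rewrite -extend_historyE action_upd.
  under [RHS]eq_integral => a _ do rewrite -extend_historyE.
  rewrite integral_cst// [X in _ = _ * X]prob_kernel mule1 ge0_integralZl//.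
    by rewrite integral_indic// setIT.
  by apply/measurable_EFinP; exact: measurable_indic.
- move=> n B C mB mC.
  have mha : measurable_fun setT (fun w : Omega => (history n w, action n w)).
    by apply: measurable_fun_pair; [exact: measurable_history|exact: measurable_action].
  have mla : measurable_fun setT
      (fun ha : hist X A n * borel A => (last_state ha.1, ha.2)).
    apply: measurable_fun_pair; last exact: measurable_snd.
    exact: measurableT_comp (@measurable_last_state n) measurable_fst.
  apply: (condE _ _ _ _ _ _ _ _ (kpre (trans M) mla)) => //.
  + exact: measurable_state.
  rewrite (stepE n.+1); last 3 first.
  + by move=> w; exact: mule_ge0.
  + by apply: emeasurable_funM; apply: mi => //; exact: measurable_state.
  + move=> v w vw; rewrite (@history_dep n v w); last first.
      by move=> i ni; apply: vw; exact: ltnW.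
    by rewrite /action /state !vw.
  apply: eq_integral => w _ /=.
  transitivity (\int[trans M (w n)]_x
      ((\1_B (history n w, action n w))%:E * (\1_C x)%:E)).
    apply: eq_integral => x _.
    transitivity (\int[pi n.+1 (extend_history n.+1 (w, x))]_a
        cst ((\1_B (history n w, action n w))%:E * (\1_C x)%:E) a); last first.
      by rewrite integral_cst// [X in _ * X]prob_kernel mule1.
    apply: eq_integral => a _ /=.
    rewrite state_upd /= (_ : history n _ = history n w); last first.
      by apply: history_dep; exact: agree_upd_id.
    by rewrite (_ : action n _ = action n w)// /action agree_upd_id.
  rewrite ge0_integralZl//.
    by rewrite integral_indic// setIT /kpre /= last_state_history -surjective_pairing.
  by apply/measurable_EFinP; exact: measurable_indic.
Qed.

End existence.

End strategic_measure.

(** * Disintegration over a compact Borel space *)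

Section radon_nikodym_le.
Context d (X : measurableType d) (R : realType).
Variables m1 m2 : {finite_measure set X -> \bar R}.
Hypothesis m12 : forall B, measurable B -> m1 B <= m2 B.

(** The density [f] can be truncated at 1: on the set where [f > 1], the inequality [m1 <= m2]
    forces [m1 = m2], so 1 is a density there too. Bounds at every point make [p x] a Bernoulli
    parameter for each [x]; the last clause is the density for the opposite bit. *)
Lemma radon_nikodym_le : exists p : X -> R, [/\ measurable_fun setT p,
  (forall x, 0 <= p x <= 1)%R,
  (forall B, measurable B -> m1 B = \int[m2]_(x in B) (p x)%:E) &
  (forall B, measurable B -> m2 B - m1 B = \int[m2]_(x in B) (1 - p x)%:E)].
Proof.
have dom : m1 `<< m2.
  apply/null_content_dominatesP => B mB m2B0; apply/eqP; rewrite eq_le.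
  by rewrite measure_ge0 andbT -m2B0 m12.
pose f := Radon_Nikodym_SigmaFinite.f m1 m2.
have f0 x : 0 <= f x by exact: Radon_Nikodym_SigmaFinite.f_ge0.
have ff x : f x \is a fin_num by exact: Radon_Nikodym_SigmaFinite.f_fin_num.
have mf : measurable_fun setT f.
  exact: measurable_int (Radon_Nikodym_SigmaFinite.f_integrable dom).
have fE B : measurable B -> m1 B = \int[m2]_(x in B) f x.
  exact: Radon_Nikodym_SigmaFinite.f_integral.
pose p x := Num.min (fine (f x)) 1%R.
have mp : measurable_fun setT p.
  by apply: measurable_minr => //; exact: measurableT_comp mf.
have p01 x : (0 <= p x <= 1)%R.
  by rewrite /p le_min ler01 fine_ge0//= ge_min lexx orbT.
pose D := [set x | 1 < f x].
have mD : measurable D.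
  have := emeasurable_fun_o_infty measurableT mf 1.
  by rewrite setTI.
have DE B : measurable B -> B `<=` D -> m1 B = m2 B.
  move=> mB BD; apply/eqP; rewrite eq_le m12//= fE//.
  rewrite -[leLHS]mul1e -integral_cst//; apply: ge0_le_integral => //.
  - exact: measurable_funTS.
  - by move=> x /BD /ltW.
have pE B : measurable B -> m1 B = \int[m2]_(x in B) (p x)%:E.
  move=> mB; have mBD := measurableI _ _ mB mD; have mBnD := measurableD mB mD.
  have dBD : [disjoint B `&` D & B `\` D].
    by apply/disj_set2P; rewrite setDE setIACA setICr setI0.
  have mpB : measurable_fun B (EFin \o p).
    by apply: measurable_funTS; exact/measurable_EFinP.
  rewrite -{2}(setUIDK B D) ge0_integral_setU//.
  - rewrite -{1}(setUIDK B D) measureU//; last by apply/disj_set2P.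
    congr (_ + _).
      apply: (etrans (DE _ mBD (@subIsetr _ B D))).
      rewrite -[LHS]mul1e -integral_cst//; apply: eq_integral => x.
      rewrite inE => -[_ xD]; rewrite /p/=; congr (_%:E); apply/esym/min_idPr.
      by rewrite -lee_fin fineK// ltW.
    apply: (etrans (fE _ mBnD)); apply: eq_integral => x; rewrite inE => -[_ xD].
    rewrite /p -{1}(fineK (ff x)); congr (_%:E); apply/esym/min_idPl.
    by rewrite -lee_fin fineK// leNgt; apply/negP.
  - by rewrite setUIDK.
  - by move=> x _; rewrite lee_fin; case/andP: (p01 x).
exists p; split => // B mB.
rewrite pE//; have -> : m2 B = \int[m2]_(x in B) ((p x)%:E + (1 - p x)%:E).
  under eq_integral do rewrite -EFinD subrKC.
  by rewrite integral_cst// mul1e.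
rewrite ge0_integralD//.
- rewrite [X in X - _]addeC addeK// -pE//; exact: fin_num_measure.
- by move=> x _; rewrite lee_fin; case/andP: (p01 x).
- by apply: measurable_funTS; exact/measurable_EFinP.
- by move=> x _; rewrite lee_fin subr_ge0; case/andP: (p01 x).
- by apply: measurable_funTS; apply/measurable_EFinP; exact: measurable_funB.
Qed.

End radon_nikodym_le.

Section slice.
Context d1 d2 (X : measurableType d1) (Y : measurableType d2) (R : realType).
Variables (nu : {finite_measure set (X * Y)%type -> \bar R}) (C : set Y).

(** The marginal when [C] is the whole space; with prefix sets for [C], the measures that are
    compared bit by bit. *)
Definition slice of measurable C := fun B : set X => nu (B `*` C).

Hypothesis mC : measurable C.

Let slice0 : slice mC set0 = 0.
Proof. by rewrite /slice set0X measure0. Qed.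

Let slice_ge0 B : 0 <= slice mC B.
Proof. exact: measure_ge0. Qed.

Let slice_sigma_additive : semi_sigma_additive (slice mC).
Proof.
move=> F mF tF mUF; rewrite /slice.
have -> : (\bigcup_n F n) `*` C = \bigcup_n (F n `*` C).
  apply/seteqP; split=> [[x y] [[n _ Fx] Cy]|[x y] [n _ [Fx Cy]]].
    by exists n.
  by split => //; exists n.
apply: measure_semi_sigma_additive.
- by move=> n; exact: measurableX.
- apply/trivIsetP => i j _ _ ij; rewrite -subset0 => -[x y] [[Fi _] [Fj _]].
  have /trivIsetP/(_ i j I I ij) Fij := tF.
  by have : (F i `&` F j) x by []; rewrite Fij.
- by apply: bigcup_measurable => n _; exact: measurableX.
Qed.

HB.instance Definition _ := isMeasure.Build _ _ _ (slice mC)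
  slice0 slice_ge0 slice_sigma_additive.

Let slice_fin : fin_num_fun (slice mC).
Proof. by move=> B mB; apply: fin_num_measure; exact: measurableX. Qed.

HB.instance Definition _ := Measure_isFinite.Build _ _ _ (slice mC) slice_fin.

End slice.

Section integral_density.
Context d (X : measurableType d) (R : realType).
Variables (m1 m2 : {finite_measure set X -> \bar R}) (h : X -> \bar R).
Hypothesis mh : measurable_fun setT h.
Hypothesis m1E : forall B, measurable B -> m1 B = \int[m2]_(x in B) h x.

(** The Radon-Nikodym derivative of [m1] agrees with [h] almost everywhere, so its change of
    variables carries over to [h]. *)
Lemma integral_density (r : X -> \bar R) B : measurable B ->
  (forall x, 0 <= r x) -> measurable_fun setT r ->
  \int[m1]_(x in B) r x = \int[m2]_(x in B) (r x * h x).
Proof.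
move=> mB r0 mr.
have dom : m1 `<< m2.
  apply/null_content_dominatesP => C mC m2C; rewrite m1E//.
  by apply: null_set_integral => //; exact: measurable_funTS.
pose f := Radon_Nikodym_SigmaFinite.f m1 m2.
have fint := Radon_Nikodym_SigmaFinite.f_integrable dom.
have mf : measurable_fun setT f by exact: measurable_int fint.
have fh : ae_eq m2 setT f h.
  apply: integral_ae_eq => // C _ mC.
  by rewrite -Radon_Nikodym_SigmaFinite.f_integral// m1E.
rewrite -(Radon_Nikodym_SigmaFinite.change_of_variables dom)//; last first.
  exact: measurable_funTS.
apply: ae_eq_integral => //.
- by apply: measurable_funTS; exact: emeasurable_funM.
- by apply: measurable_funTS; exact: emeasurable_funM.
- exact/ae_eqe_mul2l/(ae_eq_subset _ fh).
Qed.

End integral_density.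

(** * Laws of random bit sequences *)

Section bool_sequences.
Local Notation Omega := (sequence_space bool).

Definition prefix_set (c : seq bool) : set Omega :=
  [set w | mkseq w (size c) = c].

Lemma prefix_set_rcons c b :
  prefix_set (rcons c b) = prefix_set c `&` [set w | w (size c) = b].
Proof.
apply/seteqP; split=> w; rewrite /prefix_set /= size_rcons mkseqS.
  by move=> /rcons_inj[].
by move=> [-> ->].
Qed.

Lemma prefix_set_nil : prefix_set [::] = setT.
Proof. by apply/seteqP; split. Qed.

Lemma measurable_prefix_set c : measurable (prefix_set c).
Proof.
elim/last_ind: c => [|c b IH]; first by rewrite prefix_set_nil.
rewrite prefix_set_rcons; apply: measurableI => //.
have := @measurable_coord _ bool (size c) measurableT [set b] I.
by rewrite setTI.
Qed.

Lemma prefix_set_dep c : depends_below (size c) (prefix_set c).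
Proof.
move=> v w vw; rewrite /prefix_set /mkset; congr (_ = c).
apply: (@eq_from_nth _ false); rewrite ?size_mkseq// => i ic.
by rewrite !nth_mkseq// vw.
Qed.

(** Finite bit sequences are countably many, so any preimage is a countable union of prefix sets. *)
Lemma measurable_mkseq d (Y : measurableType d) (f : seq bool -> Y) n :
  measurable_fun setT (fun w : Omega => f (mkseq w n)).
Proof.
move=> _ B mB; rewrite setTI.
rewrite (_ : _ @^-1` B = \bigcup_c
    (if (size c == n) && (f c \in B) then prefix_set c else set0)).
  apply: countable_bigcupT_measurable; first exact: countableP.
  by move=> c; case: ifP => // _; exact: measurable_prefix_set.
apply/seteqP; split=> [w Bw|w [c _]].
  exists (mkseq w n) => //; rewrite size_mkseq eqxx /=.
  by rewrite mem_set//= /prefix_set/= size_mkseq.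
case: ifP => // /andP[/eqP cn /set_mem Bc].
by rewrite /prefix_set /= cn /preimage /= => ->.
Qed.

Definition prefix_sets : set (set Omega) :=
  [set C | C = set0 \/ exists c, C = prefix_set c].

Lemma measurable_prefix_sets : @measurable _ Omega = <<s prefix_sets >>.
Proof.
apply/seteqP; split; last first.
  apply: smallest_sub; first exact: sigma_algebra_measurable.
  by move=> _ [->|[c ->]]; [exact: measurable0|exact: measurable_prefix_set].
apply: smallest_sub; first exact: smallest_sigma_algebra.
move=> _ [n _ [B _ <-]]; rewrite setTI.
rewrite (_ : _ @^-1` B = \bigcup_c
   (if (size c == n.+1) && (last false c \in B) then prefix_set c else set0)).
  apply: (@countable_bigcupT_measurable _ (g_sigma_algebraType prefix_sets)).
    exact: countableP.
  move=> c; apply: sub_sigma_algebra.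
  by case: ifP => _; [right; exists c|left].
apply/seteqP; split=> [w Bw|w [c _]].
  exists (mkseq w n.+1) => //; rewrite size_mkseq eqxx mkseqS last_rcons.
  by rewrite mem_set//= /prefix_set /mkset size_rcons size_mkseq mkseqS.
case: ifP => // /andP[/eqP cn /set_mem Bc].
by rewrite /prefix_set /mkset cn mkseqS => wc; move: Bc; rewrite -wc last_rcons.
Qed.

(** Two prefix sets are nested or disjoint, whence the empty set among [prefix_sets]. This makes
    them a pi-system for the Dynkin argument. *)
Lemma prefix_setsI : setI_closed prefix_sets.
Proof.
suff h c c' : (size c <= size c')%N -> prefix_sets (prefix_set c `&` prefix_set c').
  move=> _ _ [->|[c ->]] [->|[c' ->]]; rewrite ?set0I ?setI0; try by left.
  by have [/h//|/ltnW/h] := leqP (size c) (size c'); rewrite setIC.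
move=> cc'; have takeE w : take (size c) (mkseq w (size c')) = mkseq w (size c).
  by rewrite /mkseq -map_take take_iota (minn_idPl cc').
have [<-|cNc'] := eqVneq (take (size c) c') c; [right; exists c'|left].
  apply/seteqP; split=> [w []//|w]; rewrite /prefix_set/= => wc'; split => //.
  by rewrite size_takel// -takeE wc'.
rewrite -subset0 => w []; rewrite /prefix_set/= => wc wc'.
by move: cNc'; rewrite -wc' takeE wc eqxx.
Qed.

End bool_sequences.

Lemma bernoulli_prob1 (R : realType) (p : R) b : (0 <= p <= 1)%R ->
  bernoulli_prob p [set b] = (bernoulli_pmf p b)%:E.
Proof. by move=> p01; rewrite /bernoulli_prob p01 fsbig_set1. Qed.

Section prefix_kernel.
Context (R : realType) (q : seq bool -> R) (n : nat).
Local Notation Omega := (sequence_space bool).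

Definition prefix_kernel (w : Omega) : {measure set bool -> \bar R} :=
  bernoulli_prob (q (mkseq w n)).

Let measurable_prefix_kernel U : measurable U ->
  measurable_fun setT (prefix_kernel ^~ U).
Proof.
by move=> _; exact: (measurable_mkseq (fun c => bernoulli_prob (q c) U) n).
Qed.

HB.instance Definition _ :=
  isKernel.Build _ _ Omega bool R prefix_kernel measurable_prefix_kernel.

Let prefix_kernelT w : prefix_kernel w setT = 1.
Proof. exact: probability_setT. Qed.

HB.instance Definition _ :=
  Kernel_isProbability.Build _ _ _ _ _ prefix_kernel prefix_kernelT.

Lemma prefix_kernel_dep v w B : agree n v w ->
  prefix_kernel v B = prefix_kernel w B.
Proof.
move=> vw; rewrite /prefix_kernel; suff -> : mkseq v n = mkseq w n by [].
apply: (@eq_from_nth _ false); rewrite ?size_mkseq// => i ic.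
by rewrite !nth_mkseq// vw.
Qed.

End prefix_kernel.

Section random_prefixes.
Context (R : realType) (q : seq bool -> R).
Hypothesis q01 : forall c, (0 <= q c <= 1)%R.

(** Ionescu-Tulcea for coin tosses whose bias [q c] depends on the prefix [c] drawn so far. *)
Lemma prefix_law_exists : exists P : probability (sequence_space bool) R,
  forall c b, P (prefix_set (rcons c b)) =
    P (prefix_set c) * (bernoulli_pmf (q c) b)%:E.
Proof.
have [P Pstep] := @ionescu_tulcea _ bool R (fun n => prefix_kernel q n)
  (fun n v w B _ vw => prefix_kernel_dep q B vw).
exists P => c b.
have mc := measurable_prefix_set (rcons c b).
rewrite -[X in P X]setIT -integral_indic// (Pstep (size c)); last 3 first.
- by move=> w; rewrite lee_fin.
- exact/measurable_EFinP.
- apply: depends_below_indic.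
  by have := @prefix_set_dep (rcons c b); rewrite size_rcons.
rewrite -[X in P X * _]setIT -integral_indic//; last exact: measurable_prefix_set.
rewrite muleC -ge0_integralZl//; last 2 first.
- by apply/measurable_EFinP; apply: measurable_indic; exact: measurable_prefix_set.
- by rewrite lee_fin bernoulli_pmf_ge0.
apply: eq_integral => w _.
have updE t : \1_(prefix_set (rcons c b)) (upd (size c) (w, t)) =
    (\1_(prefix_set c) w * \1_[set b] t)%R :> R.
  rewrite prefix_set_rcons indicI /=; congr (_ * _)%R.
    rewrite !indicE; suff -> : (upd (size c) (w, t) \in prefix_set c) =
      (w \in prefix_set c) by [].
    have e := @prefix_set_dep c _ _ (@agree_upd_id _ _ (size c) w t).
    by apply/idP/idP => /set_mem h; apply/mem_set; [rewrite -e|rewrite e].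
  rewrite !indicE; suff -> : (upd (size c) (w, t) \in [set w | w (size c) = b]) =
    (t \in [set b]) by [].
  by apply/idP/idP => /set_mem h; apply/mem_set; move: h;
    rewrite /mkset /upd eqxx.
under eq_integral do rewrite updE EFinM.
rewrite ge0_integralZl// integral_indic// setIT muleC.
case: (boolP (w \in prefix_set c)) => [/set_mem wc|/negbTE wc]; last first.
  by rewrite indicE wc !mule0.
by rewrite -bernoulli_prob1//= /prefix_kernel wc.
Qed.

End random_prefixes.

(** * Disintegration over bit sequences *)

Section disintegration_bool.
Context d (X : measurableType d) (R : realType).
Local Notation Omega := (sequence_space bool).
Variable nu : {finite_measure set (X * Omega)%type -> \bar R}.
Local Notation N := (slice nu measurableT).

(** The density [p c] of [nuc (rcons c true)] with respect to [nuc c] is the conditional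
    probability, given [x] and the prefix [c], that the next bit is [true]. Tossing bits with these
    biases gives [phi x]; the formula holds for prefix sets by induction on the prefix. *)
Lemma disintegration_bool : exists phi : R.-pker X ~> Omega,
  forall B C, measurable B -> measurable C ->
    nu (B `*` C) = \int[N]_(x in B) phi x C.
Proof.
pose nuc c := slice nu (measurable_prefix_set c).
have nuc_le c B : measurable B -> nuc (rcons c true) B <= nuc c B.
  move=> mB; apply: le_measure; rewrite ?inE.
  - exact: measurableX (measurable_prefix_set _).
  - exact: measurableX (measurable_prefix_set _).
  - by move=> [x w] [Bx]; rewrite prefix_set_rcons => -[].
have /choice[p pP] := fun c => radon_nikodym_le (@nuc_le c).
have mp c : measurable_fun setT (p c) by case: (pP c).
have p01 c x : (0 <= p c x <= 1)%R by case: (pP c).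
have nucS c b B : measurable B ->
    nuc (rcons c b) B = \int[nuc c]_(x in B) (bernoulli_pmf (p c x) b)%:E.
  move=> mB; case: b; first by case: (pP c) => _ _ /(_ B mB).
  have E0 : nuc c B - nuc (rcons c true) B =
      \int[nuc c]_(x in B) (bernoulli_pmf (p c x) false)%:E.
    by case: (pP c) => _ _ _ /(_ B mB).
  rewrite -E0.
  have -> : nuc c B = nuc (rcons c true) B + nuc (rcons c false) B.
    rewrite /nuc /slice -measureU.
    - congr (nu _); apply/seteqP; split=> [[x w] [Bx cw]|[x w]].
        rewrite !prefix_set_rcons; case E : (w (size c)); [by left|by right].
      by rewrite !prefix_set_rcons => -[] [Bx []].
    - exact: measurableX (measurable_prefix_set _).
    - exact: measurableX (measurable_prefix_set _).
    - rewrite -subset0 => -[x w] []; rewrite !prefix_set_rcons.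
      by move=> [_ [_ /= ->]] [_ []].
  rewrite [X in X - _]addeC addeK//.
  exact: fin_num_measure.
(* [P x] is chosen separately for each [x], so its measurability in [x] is proved together with the
   integral formula, on prefixes and then by Dynkin induction. *)
have /choice[P PE] := fun x => prefix_law_exists (fun c => p01 c x).
have mb c b : measurable_fun setT (fun x => (bernoulli_pmf (p c x) b)%:E).
  apply/measurable_EFinP; case: b => //=; exact: measurable_funB.
have h c : measurable_fun setT (fun x => P x (prefix_set c)) /\
    forall B, measurable B -> nuc c B = \int[N]_(x in B) P x (prefix_set c).
  elim/last_ind: c => [|c b [mc cE]].
    split.
      under eq_fun do rewrite prefix_set_nil probability_setT.
      exact: measurable_cst.
    move=> B mB; under eq_integral do rewrite prefix_set_nil probability_setT.
    by rewrite integral_cst// mul1e /nuc /slice prefix_set_nil.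
  split.
    by under eq_fun do rewrite PE; exact: emeasurable_funM.
  move=> B mB; rewrite nucS// (integral_density mc cE)//; last first.
    by move=> x; rewrite lee_fin bernoulli_pmf_ge0.
  by apply: eq_integral => x _; rewrite PE muleC.
have H C : measurable C -> measurable_fun setT (fun x => P x C) /\
    forall B, measurable B -> nu (B `*` C) = \int[N]_(x in B) P x C.
  rewrite measurable_prefix_sets; move: C.
  apply: (dynkin_induction measurable_prefix_sets prefix_setsI).
  - split; first by under eq_fun do rewrite probability_setT; exact: measurable_cst.
    move=> B mB; under eq_integral do rewrite probability_setT.
    by rewrite integral_cst// mul1e.
  - move=> _ [->|[c ->]]; last exact: h.
    split; first by under eq_fun do rewrite measure0; exact: measurable_cst.
    move=> B mB; under eq_integral do rewrite measure0.
    by rewrite integral0 setX0 measure0.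
  - move=> C mC [mPC CE]; split.
      under eq_fun do rewrite probability_setC//.
      exact: emeasurable_funB.
    move=> B mB.
    have fin : nu (B `*` C) \is a fin_num.
      by apply: fin_num_measure; exact: measurableX.
    rewrite -[LHS](addeK _ fin) -[RHS](addeK _ fin); congr (_ - _).
    rewrite [in RHS]CE// -ge0_integralD//; last 2 first.
    + apply: measurable_funTS; under eq_fun do rewrite probability_setC//.
      exact: emeasurable_funB.
    + exact: measurable_funTS.
    under [RHS]eq_integral do
      rewrite probability_setC// subeK ?fin_num_measure//.
    rewrite integral_cst// mul1e /slice -measureU.
    + congr (nu _); apply/seteqP; split=> [[x w] [[]//|[]//]|[x w] [Bx _]].
      by have [Cw|nCw] := pselect (C w); [right|left].
    + by apply: measurableX => //; exact: measurableC.
    + exact: measurableX.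
    + by rewrite -setXI setICl setX0.
  - move=> F mF tF FE.
    have PF x : P x (\bigcup_k F k) = \sum_(k <oo) P x (F k).
      by rewrite measure_bigcup//; apply: eq_eseriesl => k; rewrite in_setT.
    split.
      under eq_fun do rewrite PF.
      by apply: ge0_emeasurable_sum => // k; case: (FE k).
    move=> B mB; under eq_integral do rewrite PF.
    rewrite integral_nneseries//; last first.
      by move=> k; apply: measurable_funTS; case: (FE k).
    rewrite (eq_eseriesr (fun k _ => esym ((FE k).2 B mB))) setX_bigcupr.
    rewrite measure_bigcup//.
    + by apply: eq_eseriesl => k; rewrite in_setT.
    + by move=> k _; exact: measurableX.
    + apply/trivIsetP => i j _ _ ij; rewrite -setXI.
      by have /trivIsetP/(_ i j I I ij) -> := tF; rewrite setX0.
exists (kfamily (fun U mU => (H U mU).1)).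
by move=> B C mB mC; exact: (H C mC).2.
Qed.

End disintegration_bool.

(** * Coding a compact Borel space by bits *)

Section separating_sequence.
Local Open Scope ring_scope.
Context (R : realType) (A : topologicalType).

(** The point [b] is kept away from the closure of [V i], not only from [V i], because decoding
    works with closed sets. *)
Lemma separating_sequence : borel_space R A -> exists V : nat -> set A,
  (forall i, open (V i)) /\
  forall a b, a <> b -> exists i, V i a /\ ~ closure (V i) b.
Proof.
move=> [P [e [hP [S /countable_injP[f finj] dS] einj eopen _]]].
pose p m : P := xget point [set x | S x /\ f x = m].
have pS x : S x -> p (f x) = x.
  move=> Sx; rewrite /p; case: xgetP => [y _ [Sy fyx]|/(_ x)]; last first.
    by move=> h; exfalso; apply: h.
  by apply: finj; rewrite ?inE.
(* Traces of balls of radius [1 / (n + 1)] around the points of a countable dense set; pairs of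
   indices are enumerated by [pickle]. *)
pose V0 (mn : nat * nat) : set A := e @^-1` (ball (p mn.1) (mn.2.+1%:R^-1 : R))°.
have V0open mn : open (V0 mn).
  by apply/eopen; exists (ball (p mn.1) (mn.2.+1%:R^-1 : R))° => //; exact: open_interior.
pose V i : set A := if unpickle i is Some mn then V0 mn else set0.
exists V; split.
  by move=> i; rewrite /V; case: unpickle => [mn|]; [exact: V0open|exact: open0].
move=> a b ab.
have [eps neps] : exists eps : {posnum R}, ~ ball (e a) eps%:num (e b).
  apply/existsNP => h; apply: ab; apply: einj; apply: (@close_eq P hP).
  by rewrite (@ball_close R).
(* If [b] were in the closure of the chosen [V i], a path from [e a] to [e b] through the centre [x]
   and a point of the ball would have length at most [r / 2 + r + r], less than [eps]. *)
have [n nlt] : exists n, (n.+1%:R^-1 : R) < eps%:num / 3.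
  have e3 : 0 < eps%:num / 3 by rewrite divr_gt0.
  by have [n] := filter_ex (near_infty_natSinv_lt (PosNum e3)); exists n.
pose r : R := n.+1%:R^-1.
have r0 : 0 < r by rewrite /r invr_gt0.
have r20 : 0 < r / 2 by rewrite divr_gt0.
have nb x s : 0 < s -> nbhs x (ball x s : set P).
  exact: nbhsx_ballx.
have [x [xa Sx]] : (ball (e a) (r / 2))° `&` S !=set0.
  apply: dS; last exact: open_interior.
  by exists (e a); exact: nb.
exists (pickle (f x, n)); rewrite /V pickleK /V0 /= (pS _ Sx) -/r; split.
  have xa' := @interior_subset _ (ball (e a) (r / 2)) _ xa.
  rewrite /preimage /= /interior; apply: filterS (nb (e a) (r / 2) r20) => z az.
  by rewrite [r]splitr; apply: ball_triangle az; exact: ball_sym.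
move=> clb.
have nbb : nbhs b (e @^-1` (ball (e b) r)°).
  apply: open_nbhs_nbhs; split.
    by apply/eopen; exists (ball (e b) r)° => //; exact: open_interior.
  by rewrite /preimage /=; exact: nb.
have [c [/= xc bc]] := clb _ nbb.
apply: neps.
have xc' := @interior_subset _ (ball x r) _ xc.
have bc' := @interior_subset _ (ball (e b) r) _ bc.
have xa' := @interior_subset _ (ball (e a) (r / 2)) _ xa.
have h : ball (e a) (r / 2 + r + r) (e b).
  apply: (ball_triangle _ (ball_sym bc')).
  exact: ball_triangle xa' xc'.
apply: le_ball h.
have : r < eps%:num / 3 by [].
have : 0 < r by [].
by move: (r) (eps%:num) => u v; lra.
Qed.

End separating_sequence.

Section compact_coding.
Local Open Scope ring_scope.
Context (A : ptopologicalType) (V : nat -> set A).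
Hypothesis Vopen : forall i, open (V i).
Hypothesis Vsep : forall a b, a <> b -> exists i, V i a /\ ~ closure (V i) b.
Hypothesis A_compact : compact [set: A].
Local Notation Omega := (sequence_space bool).

Definition code (a : borel A) : Omega := fun i => `[< V i a >].

Lemma measurable_code : measurable_fun setT code.
Proof.
apply/measurable_sequenceP => i; apply: (measurable_fun_bool true).
rewrite setTI; apply: sub_sigma_algebra.
rewrite (_ : _ @^-1` _ = V i)//; apply/seteqP.
by split=> a; rewrite /preimage /code /= => /asboolP.
Qed.

(* Both bits cut out closed sets, so that compactness applies; a bit [true] is
   only required to hold up to closure. *)
Let allowed i (b : bool) : set A := if b then closure (V i) else ~` V i.

Let closed_allowed i b : closed (allowed i b).
Proof.
by case: b; [exact: closed_closure|exact: open_closedC].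
Qed.

Let compatible (c : Omega) : set A := [set a | forall i, allowed i (c i) a].

Let compatible_code a : compatible (code a) a.
Proof.
by move=> i; rewrite /code; case: asboolP => // ?; exact: subset_closure.
Qed.

(** For [a <> b], take [V i] containing [a] with [b] outside its closure: the bit [true] excludes
    [b] and the bit [false] excludes [a]. *)
Let compatible_inj c a b : compatible c a -> compatible c b -> a = b.
Proof.
move=> ca cb; apply: contrapT => /Vsep[i [Via nVib]].
by move: (ca i) (cb i); rewrite /allowed; case: (c i).
Qed.

Definition decode (c : Omega) : borel A := xget (point : A) (compatible c).

Lemma codeK : cancel code decode.
Proof.
move=> a; rewrite /decode; case: xgetP => [b _ cb|/(_ a)/(_ (@compatible_code a))//].
exact: compatible_inj cb (@compatible_code a).
Qed.

Let meets (F : set A) : set Omega := [set c | exists2 a, F a & compatible c a].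

Let meets_upto F n (s : seq bool) :=
  `[< exists2 a, F a & forall i, (i < n)%N -> allowed i (nth false s i) a >].

(** By compactness, a point of [F] compatible with all bits exists as soon as, for every [n], some
    point of [F] is compatible with the first [n] bits. The latter conditions are countably many and
    each involves finitely many bits. *)
Let measurable_meets F : closed F -> measurable (meets F).
Proof.
move=> clF.
rewrite (_ : meets F =
    \bigcap_n (fun c : Omega => meets_upto F n (mkseq c n)) @^-1` [set true]).
  apply: bigcapT_measurable => n.
  have := @measurable_mkseq _ bool (meets_upto F n) n measurableT [set true] I.
  by rewrite setTI.
apply/seteqP; split=> [c [a Fa ca] n _|c cn].
  by apply/asboolP; exists a => // i ni; rewrite nth_mkseq.
have := A_compact; rewrite compact_In0.
move=> /(_ nat setT (fun i => F `&` allowed i (c i))) [].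
- exists (fun i => F `&` allowed i (c i)) => [i _|i _]; last by rewrite setTI.
  exact: closedI.
- move=> D _; pose n := (\max_(i <- finmap.enum_fset D) i).+1.
  have /asboolP[a Fa an] := cn n I; exists a => i /= iD; split => //.
  have ni : (i < n)%N by rewrite ltnS; exact: leq_bigmax_seq.
  by have := an i ni; rewrite nth_mkseq.
- move=> a ha; exists a; first by have [] := ha 0%N I.
  by move=> i; have [] := ha i I.
Qed.

Lemma measurable_decode : measurable_fun setT decode.
Proof.
(* The second term accounts for the sequences compatible with no action, all decoded as [point]. *)
have decodeE F : decode @^-1` F = meets F `|`
    (if point \in F then ~` meets setT else set0).
  apply/seteqP; split=> c.
    rewrite /preimage /= /decode; case: xgetP => [a _ ca Fa|nc Fp].
      by left; exists a.
    by right; rewrite mem_set// => -[a _ /nc].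
  rewrite /preimage /= /decode => -[[a Fa ca]|].
    case: xgetP => [b _ cb|/(_ a)//].
    by rewrite -(compatible_inj ca cb).
  case: ifPn => // /set_mem Fp nc; case: xgetP => // b _ cb.
  by exfalso; apply: nc; exists b.
apply: (@measurability _ _ Omega (borel A) setT decode (@open A)) => //.
move=> _ [U oU <-]; rewrite setTI -[U]setCK preimage_setC.
apply: measurableC; rewrite [X in measurable X](decodeE (~` U)).
apply: measurableU.
  by apply: measurable_meets; exact: open_closedC.
case: ifP => // _; apply: measurableC; apply: measurable_meets.
exact: closedT.
Qed.

End compact_coding.

Section finite_pushforward.
Context d1 d2 (X : measurableType d1) (Y : measurableType d2) (R : realType).
Variables (nu : {finite_measure set X -> \bar R}) (f : X -> Y).

Definition finite_pushforward of measurable_fun setT f :=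
  fun B : set Y => nu (f @^-1` B).

Hypothesis mf : measurable_fun setT f.

Let mpre B : measurable B -> measurable (f @^-1` B).
Proof. by move=> mB; rewrite -[X in measurable X]setTI; exact: mf. Qed.

Let push0 : finite_pushforward mf set0 = 0.
Proof. by rewrite /finite_pushforward preimage_set0 measure0. Qed.

Let push_ge0 B : 0 <= finite_pushforward mf B.
Proof. exact: measure_ge0. Qed.

Let push_sigma_additive : semi_sigma_additive (finite_pushforward mf).
Proof.
move=> F mF tF mUF; rewrite /finite_pushforward preimage_bigcup.
apply: measure_semi_sigma_additive.
- by move=> n; exact: mpre.
- apply/trivIsetP => i j _ _ ij; rewrite -preimage_setI.
  by have /trivIsetP/(_ i j I I ij) -> := tF; rewrite preimage_set0.
- by rewrite -preimage_bigcup; exact: mpre.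
Qed.

HB.instance Definition _ := isMeasure.Build _ _ _ (finite_pushforward mf)
  push0 push_ge0 push_sigma_additive.

Let push_fin : fin_num_fun (finite_pushforward mf).
Proof. by move=> B mB; apply: fin_num_measure; exact: mpre. Qed.

HB.instance Definition _ := Measure_isFinite.Build _ _ _
  (finite_pushforward mf) push_fin.

End finite_pushforward.

(** * Disintegration over the action space *)

Section disintegration.
Context d (X : measurableType d) (A : ptopologicalType) (R : realType).
Hypothesis A_borel : borel_space R A.
Hypothesis A_compact : compact [set: A].
Variable nu : {finite_measure set (X * borel A)%type -> \bar R}.
Local Notation N := (slice nu measurableT).

(** Transporting [nu] to bit sequences by [code] and pulling the kernel back by [decode] loses
    nothing, since [decode] inverts [code] on the whole action space. *)
Lemma disintegration : exists phi : R.-pker X ~> borel A,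
  forall B C, measurable B -> measurable C ->
    nu (B `*` C) = \int[N]_(x in B) phi x C.
Proof.
have [V [Vopen Vsep]] := separating_sequence A_borel.
have mcode : measurable_fun setT
    (fun z : X * borel A => (z.1, code V z.2)).
  apply: measurable_fun_pair; first exact: measurable_fst.
  exact: measurableT_comp (measurable_code Vopen) measurable_snd.
have mdecode : measurable_fun setT (fun z : X * sequence_space bool => decode V z.2).
  exact: measurableT_comp (measurable_decode Vopen Vsep A_compact) measurable_snd.
have [phi phiE] := disintegration_bool (finite_pushforward nu mcode).
exists (kmap phi mdecode) => B C mB mC.
have mdC : measurable (decode V @^-1` C).
  rewrite -[X in measurable X]setTI.
  exact: (measurable_decode Vopen Vsep A_compact).
rewrite (_ : B `*` C =
    (fun z : X * borel A => (z.1, code V z.2)) @^-1` (B `*` (decode V @^-1` C))).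
  rewrite [LHS](phiE _ _ mB mdC).
  transitivity (\int[N]_(x in B) phi x (decode V @^-1` C)).
    apply: eq_measure_integral => D mD _; rewrite /slice /finite_pushforward.
    by congr (nu _); apply/seteqP; split=> -[].
  by apply: eq_integral => x _; rewrite kmapE.
by apply/seteqP; split=> -[x a]; rewrite /preimage /= codeK.
Qed.

End disintegration.

Section measure_tools.
Context (R : realType).

Lemma prod_measure_eq d1 d2 (X : measurableType d1) (Y : measurableType d2)
    (m1 m2 : {measure set (X * Y)%type -> \bar R}) :
  m1 setT < +oo ->
  (forall B C, measurable B -> measurable C -> m1 (B `*` C) = m2 (B `*` C)) ->
  forall G, measurable G -> m1 G = m2 G.
Proof.
move=> m1fin m12 G mG.
apply: (measure_unique [set B `*` C | B in measurable & C in measurable]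
  (fun=> setT)) => //.
- exact: measurable_prod_measurableType.
- move=> _ _ [B1 mB1 [C1 mC1 <-]] [B2 mB2 [C2 mC2 <-]].
  exists (B1 `&` B2); first exact: measurableI.
  by exists (C1 `&` C2); [exact: measurableI|rewrite setXI].
- by move=> _; exists setT => //; exists setT => //; rewrite setXTT.
- by rewrite bigcup_const.
- by move=> _ [B mB [C mC <-]]; exact: m12.
Qed.

Lemma integral_mrestr d (X : measurableType d) (m : {measure set X -> \bar R})
    (D : set X) (mD : measurable D) (f : X -> \bar R) :
  (forall x, 0 <= f x) -> measurable_fun setT f ->
  \int[mrestr m mD]_x f x = \int[m]_(x in D) f x.
Proof.
move=> f0 mf; have mCD : measurable (~` D) by exact: measurableC.
rewrite -(setUv D) ge0_integral_setU//; last 2 first.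
- by rewrite setUv.
- exact/disj_set2P/setICr.
rewrite [X in _ + X]null_set_integral//; last 2 first.
- exact: measurable_funTS.
- by change (m (~` D `&` D) = 0); rewrite setICl measure0.
rewrite adde0; apply: eq_measure_integral => B mB BD.
by change (m (B `&` D) = m B); rewrite setIidl.
Qed.

Lemma eq_measure_ge0_integral d (X : measurableType d)
    (m1 m2 : {measure set X -> \bar R}) (f : X -> \bar R) :
  (forall B, measurable B -> m1 B = m2 B) ->
  \int[m1]_x f x = \int[m2]_x f x.
Proof. by move=> m12; apply: eq_measure_integral => B mB _; exact: m12. Qed.

Lemma integral_finite_pushforward d1 d2 (X : measurableType d1)
    (Y : measurableType d2) (m : {finite_measure set X -> \bar R}) (g : X -> Y)
    (mg : measurable_fun setT g) (f : Y -> \bar R) :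
  (forall y, 0 <= f y) -> measurable_fun setT f ->
  \int[finite_pushforward m mg]_y f y = \int[m]_x f (g x).
Proof. by move=> f0 mf; rewrite [LHS](ge0_integral_pushforward mg). Qed.

End measure_tools.

Section kite.
Context d1 d2 (X : measurableType d1) (Y : measurableType d2) (R : realType).
Variables (k1 k2 : R.-pker X ~> Y) (D : set X).

Definition kite of measurable D : X -> {measure set Y -> \bar R} :=
  fun x => if x \in D then k1 x else k2 x.

Hypothesis mD : measurable D.

Let measurable_kite U : measurable U -> measurable_fun setT (kite mD ^~ U).
Proof.
move=> mU; rewrite (_ : (fun x => _) =
    fun x => if x \in D then k1 x U else k2 x U); last first.
  by apply/funext => x; rewrite /kite; case: ifP.
apply: measurable_fun_ifT; [|exact: measurable_kernel..].
apply: (measurable_fun_bool true).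
by rewrite setTI preimage_mem_true.
Qed.

HB.instance Definition _ := isKernel.Build _ _ X Y R (kite mD) measurable_kite.

Let kiteT x : kite mD x setT = 1.
Proof. by rewrite /kite; case: ifP => _; exact: prob_kernel. Qed.

HB.instance Definition _ :=
  Kernel_isProbability.Build _ _ _ _ _ (kite mD) kiteT.

End kite.

Section kernel_section.
Context d1 d2 (X : measurableType d1) (Y : measurableType d2) (R : realType).
Variables (k : R.-pker X ~> Y).

(** The kernel [delta_x (x) k x], so that [mbind N (kgraph k)] is the measure [N (x) k]. *)
Definition kgraph : R.-pker X ~> (X * Y)%type :=
  kmap k (@measurable_id _ (X * Y)%type setT).

Lemma kgraphE x G : measurable G -> kgraph x G = k x [set y | G (x, y)].
Proof. exact: kmapE. Qed.

Lemma integral_kgraph x f : (forall z, 0 <= f z) -> measurable_fun setT f ->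
  \int[kgraph x]_z f z = \int[k x]_y f (x, y).
Proof. exact: integral_kmap. Qed.

Lemma measurable_integral_section (f : X * Y -> \bar R) :
  (forall z, 0 <= f z) -> measurable_fun setT f ->
  measurable_fun setT (fun x => \int[k x]_y f (x, y)).
Proof. by move=> f0 mf; exact: measurable_fun_integral_finite_kernel. Qed.

Lemma measurable_kernel_section G : measurable G ->
  measurable_fun setT (fun x => k x [set y | G (x, y)]).
Proof.
move=> mG; rewrite (_ : (fun x => _) = (kgraph ^~ G)); last first.
  by apply/funext => x; rewrite kgraphE.
exact: measurable_kernel.
Qed.

End kernel_section.

Section disintegrated.
Context d1 d2 (X : measurableType d1) (Y : measurableType d2) (R : realType).
Variables (nu : {finite_measure set (X * Y)%type -> \bar R}) (k : R.-pker X ~> Y).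
Local Notation N := (slice nu measurableT).
Hypothesis nuE : forall B C, measurable B -> measurable C ->
  nu (B `*` C) = \int[N]_(x in B) k x C.

Lemma disintegratedE G : measurable G -> nu G = mbind N (kgraph k) G.
Proof.
apply: prod_measure_eq.
  by rewrite ltey_eq fin_num_measure.
move=> B C mB mC; rewrite [LHS](nuE mB mC) mbindE integral_mkcond.
apply: eq_integral => x _; rewrite kgraphE; last exact: measurableX.
rewrite patchE; case: ifPn => [/set_mem|/negP] xB.
  by congr (k x _); apply/seteqP; split => y //= -[].
rewrite (_ : [set y | _] = set0) ?measure0//.
by rewrite -subset0 => y [Bx _]; apply: xB; exact: mem_set.
Qed.

Lemma integral_disintegrated f : (forall z, 0 <= f z) -> measurable_fun setT f ->
  \int[nu]_z f z = \int[N]_x \int[k x]_y f (x, y).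
Proof.
move=> f0 mf; rewrite (eq_measure_ge0_integral f disintegratedE).
by rewrite integral_mbind//; apply: eq_integral => x _; rewrite integral_kgraph.
Qed.

End disintegrated.

(** * Kernels carried by the sections of a measurable set *)

Section supported_disintegration.
Context d (X : measurableType d) (A : ptopologicalType) (R : realType).
Hypothesis A_borel : borel_space R A.
Hypothesis A_compact : compact [set: A].
Variable nu : {finite_measure set (X * borel A)%type -> \bar R}.
Local Notation N := (slice nu measurableT).
Variables (K : set (X * borel A)%type) (theta : X -> borel A).
Hypothesis mK : measurable K.
Hypothesis mtheta : measurable_fun setT theta.
Hypothesis thetaK : forall x, K (x, theta x).
Hypothesis nuK : nu (~` K) = 0.

(** Since [nu] does not charge the complement of [K], the states where [phi x] charges the
    complement of its section form an [N]-null set. Replacing [phi x] there by the Dirac mass at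
    [theta x] leaves the integrals unchanged and gives full mass at every [x]. *)
Lemma supported_disintegration : exists phi : R.-pker X ~> borel A,
  (forall x, phi x [set a | K (x, a)] = 1) /\
  forall B C, measurable B -> measurable C ->
    nu (B `*` C) = \int[N]_(x in B) phi x C.
Proof.
have [phi phiE] := disintegration A_borel A_compact nu.
pose D := [set x | phi x [set a | K (x, a)] = 1].
have mD : measurable D.
  have := measurable_kernel_section phi mK measurableT (emeasurable_set1 1).
  by rewrite setTI.
have mKx x : measurable [set a | K (x, a)].
  rewrite -[X in measurable X]setTI.
  by have := pair1_measurable x measurableT mK; rewrite setTI.
have ND : N (~` D) = 0.
  have mKC : measurable (~` K) by exact: measurableC.
  have h : \int[N]_x phi x [set a | (~` K) (x, a)] = 0.
    rewrite -nuK (disintegratedE phiE mKC) mbindE.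
    by apply: eq_integral => x _; rewrite kgraphE.
  have mh := measurable_kernel_section phi mKC.
  have : \int[N]_x `|phi x [set a | (~` K) (x, a)]| = 0.
    by rewrite -[RHS]h; apply: eq_integral => x _; rewrite gee0_abs.
  move=> /(ae_eq_integral_abs _ measurableT mh) [Z [mZ NZ DZ]].
  apply/eqP; rewrite eq_le measure_ge0 andbT -NZ; apply: le_measure.
  - by rewrite inE; exact: measurableC.
  - by rewrite inE.
  - move=> x nDx; apply: DZ => /= /(_ I) kx0; apply: nDx; rewrite /D /=.
    have : phi x ([set a | K (x, a)] `|` [set a | (~` K) (x, a)]) = 1.
      rewrite -(prob_kernel (s := phi) x); congr (phi x _); apply/seteqP; split => // a _.
      by have [?|?] := pselect (K (x, a)); [left|right].
    rewrite measureU//.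
    + by rewrite [X in _ + X]kx0 adde0.
    + exact: (measurableC (mKx x)).
    + by rewrite -subset0 => a [].
exists (kite phi (kdirac mtheta) mD); split=> [x|B C mB mC].
  rewrite /= /kite; case: ifPn => [/set_mem//|_].
  by rewrite /kdirac /= diracE mem_set//=; exact: thetaK.
rewrite phiE//; apply: ae_eq_integral => //.
- by apply: measurable_funTS; exact: measurable_kernel.
- by apply: measurable_funTS; exact: measurable_kernel.
- exists (~` D); split => //; first exact: measurableC.
  move=> x /= nx Dx; apply: nx => _.
  by rewrite /kite mem_set.
Qed.

End supported_disintegration.

(** * The state process before absorption *)

Section cond_law.
Context d (X : measurableType d) (A : ptopologicalType) (R : realType).
Local Notation Omega := (trajectory X A).
Context dY (Y : measurableType dY) dZ (Z : measurableType dZ).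
Variables (P : probability Omega R) (fY : Omega -> Y) (fZ : Omega -> Z).
Variable K : R.-pker Y ~> Z.
Hypothesis mY : measurable_fun setT fY.
Hypothesis mZ : measurable_fun setT fZ.
Hypothesis PK : cond_law P fY fZ K.

Let mYZ : measurable_fun setT (fun w => (fY w, fZ w)).
Proof. exact: measurable_fun_pair. Qed.

Lemma cond_law_joint G : measurable G ->
  finite_pushforward P mYZ G = mbind (finite_pushforward P mY) (kgraph K) G.
Proof.
apply: prod_measure_eq.
  by rewrite ltey_eq fin_num_measure.
move=> B C mB mC.
have mBC : measurable (B `*` C) by exact: measurableX.
rewrite mbindE integral_finite_pushforward//; last exact: measurable_kernel.
rewrite [LHS]/(P _) [LHS](PK mB mC) integral_mkcond.
apply: eq_integral => w _; rewrite kgraphE// patchE.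
case: ifPn => [/set_mem|/negP] yB.
  by congr (K (fY w) _); apply/seteqP; split => y //= -[].
rewrite (_ : [set y | _] = set0) ?measure0//.
by rewrite -subset0 => y [Bx _]; apply: yB; exact: mem_set.
Qed.

Lemma cond_law_integral (f : Y * Z -> \bar R) : (forall z, 0 <= f z) ->
  measurable_fun setT f ->
  \int[P]_w f (fY w, fZ w) = \int[P]_w \int[K (fY w)]_z f (fY w, z).
Proof.
move=> f0 mf; rewrite -(integral_finite_pushforward P mYZ f0 mf).
rewrite (eq_measure_ge0_integral f cond_law_joint) integral_mbind//.
rewrite integral_finite_pushforward; last 2 first.
- by move=> y; exact: integral_ge0.
- by apply: measurable_fun_integral_kernel => // U mU; exact: measurable_kernel.
by apply: eq_integral => w _; rewrite integral_kgraph.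
Qed.

End cond_law.

(** * Hitting times as sums of survival indicators *)

Section hitting_time.
Context d (X : measurableType d) (A : ptopologicalType) (R : realType).
Local Notation Omega := (trajectory X A).
Variable Delta : set X.
Hypothesis mDelta : measurable Delta.
Local Notation T := (@hitting_time _ X A R Delta).

(** The event [T > t], expressed through finitely many states. *)
Definition alive t : set Omega := [set w | forall i, (i <= t)%N -> ~ Delta (state i w)].

Lemma aliveS t : alive t.+1 = alive t `&` [set w | ~ Delta (state t.+1 w)].
Proof.
apply/seteqP; split=> [w h|w [h1 h2] i].
  by split=> [i it|]; apply: h => //; exact: ltnW.
by rewrite leq_eqVlt => /orP[/eqP->//|]; rewrite ltnS; exact: h1.
Qed.

Lemma measurable_stateN t : measurable [set w : Omega | ~ Delta (state t w)].
Proof.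
have := @measurable_state _ X A t measurableT _ (measurableC mDelta).
by rewrite setTI.
Qed.

Lemma alive0 : alive 0 = [set w | ~ Delta (state 0 w)].
Proof.
apply/seteqP; split=> [w h|w h i]; first exact: h.
by rewrite leqn0 => /eqP->.
Qed.

Lemma measurable_alive t : measurable (alive t).
Proof.
elim: t => [|t IH]; first by rewrite alive0; exact: measurable_stateN.
by rewrite aliveS; apply: measurableI => //; exact: measurable_stateN.
Qed.

Lemma hitting_time_gt t (w : Omega) : (t%:R%:E < T w) <-> alive t w.
Proof.
split=> [tT i it Di|h].
  have : T w <= i%:R%:E by apply: ereal_inf_lbound; exists i.
  by apply/negP; rewrite -ltNge (le_lt_trans _ tT)// lee_fin ler_nat.
apply: (@lt_le_trans _ _ t.+1%:R%:E); first by rewrite lte_fin ltr_nat.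
apply: le_ereal_inf_tmp => _ [i Di <-]; rewrite lee_fin ler_nat ltnNge.
by apply/negP => it; exact: h it Di.
Qed.

Lemma indic_alive t (w : Omega) :
  \1_[set w | (t%:R%:E < T w)] w = \1_(alive t) w :> R.
Proof.
rewrite !indicE; suff -> : (w \in [set w | t%:R%:E < T w]) = (w \in alive t) by [].
by apply/idP/idP => /set_mem /hitting_time_gt h; apply/mem_set => //.
Qed.

Lemma hitting_timeE (w : Omega) : T w = \sum_(0 <= t <oo) (\1_(alive t) w)%:E.
Proof.
have i0 t : 0 <= (\1_(alive t) w)%:E :> \bar R by rewrite lee_fin.
have sumE N : (forall t, (t < N)%N -> alive t w) ->
    N%:R%:E <= \sum_(0 <= t <oo) (\1_(alive t) w)%:E :> \bar R.
  move=> aN; apply: le_trans (nneseries_lim_ge N _) => //.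
  rewrite (eq_big_nat _ _ (F2 := fun=> 1%R%:E)).
    by rewrite sumEFin big_const_nat iter_addr_0 subn0.
  by move=> i /andP[_ iN]; rewrite indicE mem_set//; exact: aN.
apply/eqP; rewrite eq_le; apply/andP; split.
  have [[n Dn]|noD] := pselect (exists n, Delta (state n w)).
    have ex : exists n, `[< Delta (state n w) >] by exists n; exact/asboolP.
    have [m /asboolP Dm m_min] := ex_minnP ex.
    apply: (@le_trans _ _ m%:R%:E); first by apply: ereal_inf_lbound; exists m.
    apply: sumE => t tm i it Di.
    by have := leq_trans (m_min i (asboolT Di)) it; rewrite leqNgt tm.
  rewrite [leRHS](_ : _ = +oo) ?leey//; apply/eqyP => r r0.
  apply: le_trans (sumE (Num.truncn r).+1 _); last first.
    by move=> t _ i _ Di; apply: noD; exists i.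
  by rewrite lee_fin ltW// truncnS_gt.
apply: le_ereal_inf_tmp => _ [n Dn <-].
apply: lime_le; first exact: is_cvg_nneseries.
(* If [Delta] is visited at time [n], the trajectory is alive at most at the times before [n], so
   the partial sum over [N] times is at most [minn N n]. *)
apply: nearW => N; apply: (@le_trans _ _ (minn N n)%:R%:E); last first.
  by rewrite lee_fin ler_nat geq_minr.
elim: N => [|N IH]; first by rewrite big_geq.
rewrite big_nat_recr//= indicE; case: (boolP (w \in alive N)) => [/set_mem aN|_].
  have Nn : (N < n)%N by rewrite ltnNge; apply/negP => nN; exact: aN nN Dn.
  rewrite (minn_idPl Nn) -natr1 EFinD leeD2r//.
  by move: IH; rewrite (minn_idPl (ltnW Nn)).
rewrite adde0 (le_trans IH)// lee_fin ler_nat leq_min geq_minr andbT.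
by rewrite (leq_trans (geq_minl _ _)).
Qed.

Lemma integral_hitting_time (P : probability Omega R) :
  \int[P]_w T w = \sum_(0 <= t <oo) P (alive t).
Proof.
under eq_integral do rewrite hitting_timeE.
rewrite integral_nneseries//; last first.
  move=> t; apply/measurable_EFinP; apply: measurable_indic.
  exact: measurable_alive.
apply: eq_eseriesr => t _.
by rewrite integral_indic ?setIT//; exact: measurable_alive.
Qed.

End hitting_time.

(** * One-step dynamics of the killed process *)

Section dynamics.
Context d (X : measurableType d) (A : ptopologicalType) (R : realType).
Context (k : nat) (M : control_model X A R k) (Delta : set X).
Hypothesis mDelta : measurable Delta.
Local Notation Omega := (trajectory X A).
Local Notation XA := (X * borel A)%type.

(** The event [alive] as a set of histories, the form in which it can be carried through the
    conditional laws. *)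
Fixpoint alive_history n : set (hist X A n) :=
  match n with
  | 0 => ~` Delta
  | m.+1 => [set h | alive_history h.1.1 /\ ~ Delta h.2]
  end.

Lemma alive_historyE n (w : Omega) : alive Delta n w <-> alive_history (history n w).
Proof.
elim: n => [|n IH]; first by rewrite alive0.
rewrite aliveS /=; split=> [[/IH]//|[/IH]//].
Qed.

Lemma measurable_alive_history n : measurable (@alive_history n).
Proof.
elim: n => [|n IH]; first exact: measurableC.
have m1 : measurable_fun setT (fun h : hist X A n.+1 => h.1.1).
  exact: measurableT_comp measurable_fst measurable_fst.
have m2 : measurable_fun setT (fun h : hist X A n.+1 => h.2).
  exact: measurable_snd.
have := measurableI _ _ (m1 measurableT _ IH) (m2 measurableT _ (measurableC mDelta)).
by rewrite !setTI.
Qed.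

Lemma indic_alive_history n (w : Omega) :
  \1_(alive Delta n) w = \1_(@alive_history n) (history n w) :> R.
Proof.
rewrite !indicE.
suff -> : (w \in alive Delta n) = (history n w \in @alive_history n) by [].
by apply/idP/idP => /set_mem h; apply/mem_set; exact/alive_historyE.
Qed.

Definition occ_state (P : probability Omega R) t (f : X -> \bar R) :=
  \int[P]_w ((\1_(alive Delta t) w)%:E * f (state t w)).

Definition occ_pair (P : probability Omega R) t (g : XA -> \bar R) :=
  \int[P]_w ((\1_(alive Delta t) w)%:E * g (state t w, action t w)).

(** The transition operator killed on entering [Delta], dual to [nu Q] restricted to the complement
    of [Delta]. *)
Definition next_alive (f : X -> \bar R) (z : XA) :=
  \int[trans M z]_y ((\1_(~` Delta) y)%:E * f y).

Lemma measurable_indic_mule d' (Y : measurableType d') (D : set Y) (f : Y -> \bar R) :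
  measurable D -> measurable_fun setT f ->
  measurable_fun setT (fun y => (\1_D y)%:E * f y).
Proof.
move=> mD mf; apply: emeasurable_funM => //.
by apply/measurable_EFinP; exact: measurable_indic.
Qed.

Lemma indic_mule_ge0 Y (D : set Y) (f : Y -> \bar R) y : (forall y, 0 <= f y) ->
  0 <= (\1_D y)%:E * f y.
Proof. by move=> f0; rewrite mule_ge0// lee_fin. Qed.

Lemma next_alive_ge0 f z : (forall x, 0 <= f x) -> 0 <= next_alive f z.
Proof. by move=> f0; apply: integral_ge0 => y _; exact: indic_mule_ge0. Qed.

Lemma measurable_next_alive f : (forall x, 0 <= f x) -> measurable_fun setT f ->
  measurable_fun setT (next_alive f).
Proof.
move=> f0 mf; apply: measurable_fun_integral_kernel.
- by move=> U mU; exact: measurable_kernel.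
- by move=> y; exact: indic_mule_ge0.
- by apply: measurable_indic_mule => //; exact: measurableC.
Qed.

Section strategic.
Variables (pi : policy M) (P : probability Omega R).
Hypothesis piP : is_strategic_measure pi P.

Lemma occ_state0 f : (forall x, 0 <= f x) -> measurable_fun setT f ->
  occ_state P 0 f = \int[init M]_x ((\1_(~` Delta) x)%:E * f x).
Proof.
move=> f0 mf; have [Pinit _ _] := piP.
have mF : measurable_fun setT (fun x => (\1_(~` Delta) x)%:E * f x).
  by apply: measurable_indic_mule => //; exact: measurableC.
have F0 x : 0 <= (\1_(~` Delta) x)%:E * f x by exact: indic_mule_ge0.
transitivity (\int[finite_pushforward P (@measurable_state _ X A 0)]_x
    ((\1_(~` Delta) x)%:E * f x)).
  rewrite integral_finite_pushforward//.
  by apply: eq_integral => w _; rewrite indic_alive_history.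
by apply: eq_measure_ge0_integral => B mB; exact: Pinit.
Qed.

Lemma occ_pair_policy t g : (forall z, 0 <= g z) -> measurable_fun setT g ->
  occ_pair P t g = \int[P]_w ((\1_(alive Delta t) w)%:E *
    \int[pi t (history t w)]_a g (state t w, a)).
Proof.
move=> g0 mg; have [_ Pact _] := piP.
pose F (p : hist X A t * borel A) :=
  (\1_(@alive_history t) p.1)%:E * g (last_state p.1, p.2).
have mF : measurable_fun setT F.
  apply: emeasurable_funM.
    apply/measurable_EFinP; apply: measurableT_comp measurable_fst.
    by apply: measurable_indic; exact: measurable_alive_history.
  apply: measurableT_comp mg _; apply: measurable_fun_pair; last exact: measurable_snd.
  exact: measurableT_comp (@measurable_last_state _ X A t) measurable_fst.
have F0 p : 0 <= F p by rewrite /F mule_ge0// lee_fin.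
transitivity (\int[P]_w F (history t w, action t w)).
  by apply: eq_integral => w _; rewrite /F /= last_state_history indic_alive_history.
rewrite (cond_law_integral (@measurable_history _ X A t)
  (@measurable_action _ X A t) (Pact t) F0 mF).
apply: eq_integral => w _; rewrite /F /= last_state_history -indic_alive_history.
rewrite ge0_integralZl//.
have := measurableT_comp mg (@pair1_measurable _ _ X (borel A) (state t w)).
exact.
Qed.

Lemma occ_stateS t f : (forall x, 0 <= f x) -> measurable_fun setT f ->
  occ_state P t.+1 f = occ_pair P t (next_alive f).
Proof.
move=> f0 mf; have [_ _ Pnext] := piP.
pose F (p : hist X A t * borel A * X) :=
  (\1_(@alive_history t) p.1.1)%:E * ((\1_(~` Delta) p.2)%:E * f p.2).
have mG : measurable_fun setT (fun x => (\1_(~` Delta) x)%:E * f x).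
  by apply: measurable_indic_mule => //; exact: measurableC.
have mF : measurable_fun setT F.
  apply: emeasurable_funM.
    have mi : measurable_fun setT (\1_(@alive_history t) : _ -> R).
      by apply: measurable_indic; exact: measurable_alive_history.
    apply/measurable_EFinP; apply: measurableT_comp mi _.
    exact: measurableT_comp measurable_fst measurable_fst.
  exact: measurableT_comp mG measurable_snd.
have F0 p : 0 <= F p by rewrite /F mule_ge0// ?lee_fin//; exact: indic_mule_ge0.
have mha : measurable_fun setT (fun w : Omega => (history t w, action t w)).
  by apply: measurable_fun_pair; [exact: measurable_history|exact: measurable_action].
have mla : measurable_fun setT
    (fun ha : hist X A t * borel A => (last_state ha.1, ha.2)).
  apply: measurable_fun_pair; last exact: measurable_snd.
  exact: measurableT_comp (@measurable_last_state _ X A t) measurable_fst.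
transitivity (\int[P]_w F ((history t w, action t w), state t.+1 w)).
  apply: eq_integral => w _; rewrite /F /= muleA -EFinM -indic_alive_history.
  by rewrite aliveS indicI.
rewrite (@cond_law_integral _ _ _ _ _ _ _ _ P _ _ (kpre (trans M) mla) mha
  (@measurable_state _ X A t.+1) (Pnext t) F F0 mF).
apply: eq_integral => w _; rewrite /F /= /kpre /= last_state_history -indic_alive_history.
rewrite ge0_integralZl//.
by move=> x _; exact: indic_mule_ge0.
Qed.

End strategic.
End dynamics.

(** * Dependence of the history law on the policy *)

Section history_law.
Context d (X : measurableType d) (A : ptopologicalType) (R : realType).
Context (k : nat) (M : control_model X A R k).
Local Notation Omega := (trajectory X A).

Lemma eq_joint_law dY (Y : measurableType dY) dZ (Z : measurableType dZ)
    (P P' : probability Omega R) (fY : Omega -> Y) (fZ : Omega -> Z)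
    (K K' : R.-pker Y ~> Z) (mY : measurable_fun setT fY)
    (mZ : measurable_fun setT fZ) :
  cond_law P fY fZ K -> cond_law P' fY fZ K' ->
  (forall y C, measurable C -> K y C = K' y C) ->
  (forall B, measurable B -> P (fY @^-1` B) = P' (fY @^-1` B)) ->
  forall G, measurable G ->
    P [set w | G (fY w, fZ w)] = P' [set w | G (fY w, fZ w)].
Proof.
move=> PK PK' KK' PP' G mG.
apply: etrans (cond_law_joint mY mZ PK mG) _.
apply: etrans _ (esym (cond_law_joint mY mZ PK' mG)).
rewrite !mbindE.
transitivity (\int[finite_pushforward P' mY]_y kgraph K y G).
  by apply: eq_measure_ge0_integral => B mB; exact: PP'.
apply: eq_integral => y _; rewrite !kgraphE//; apply: KK'.
by have := pair1_measurable y measurableT mG; rewrite setTI.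
Qed.

(** The history at time [m] contains only the actions before [m], so a policy may be changed from
    time [m] on without altering its law. *)
Lemma eq_history_law (pi pi' : policy M) (P P' : probability Omega R) m :
  is_strategic_measure pi P -> is_strategic_measure pi' P' ->
  (forall n h C, (n < m)%N -> pi n h C = pi' n h C) ->
  forall B, measurable B ->
    P (@history _ X A m @^-1` B) = P' (@history _ X A m @^-1` B).
Proof.
move=> [Pi Pa Ps] [Pi' Pa' Ps']; elim: m => [|m IH] pipi' B mB.
  by rewrite [LHS]Pi// [RHS]Pi'.
have {}IH B' : measurable B' ->
    P (@history _ X A m @^-1` B') = P' (@history _ X A m @^-1` B').
  by apply: IH => n h C nm; apply: pipi'; exact: ltnW.
have mla : measurable_fun setT
    (fun ha : hist X A m * borel A => (last_state ha.1, ha.2)).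
  apply: measurable_fun_pair; last exact: measurable_snd.
  exact: measurableT_comp (@measurable_last_state _ X A m) measurable_fst.
have mha : measurable_fun setT (fun w : Omega => (history m w, action m w)).
  by apply: measurable_fun_pair; [exact: measurable_history|exact: measurable_action].
have h := @eq_joint_law _ _ _ _ P P' _ _ (kpre (trans M) mla)
  (kpre (trans M) mla) mha (@measurable_state _ X A m.+1) (Ps m) (Ps' m)
  (fun _ _ _ => erefl).
apply: (h _ B mB) => C mC.
apply: (eq_joint_law (@measurable_history _ X A m) (@measurable_action _ X A m)
  (Pa m) (Pa' m)) => //.
by move=> y D _; apply: pipi'.
Qed.

End history_law.

(** * Stationary continuation and absorption *)

Section stationary.
Context d (X : measurableType d) (A : ptopologicalType) (R : realType).
Context (k : nat) (M : control_model X A R k) (Delta : set X).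
Hypothesis mDelta : measurable Delta.
Local Notation Omega := (trajectory X A).

Lemma occ_state_history_law (P P' : probability Omega R) m f :
  (forall B, measurable B ->
    P (@history _ X A m @^-1` B) = P' (@history _ X A m @^-1` B)) ->
  (forall x, 0 <= f x) -> measurable_fun setT f ->
  occ_state Delta P m f = occ_state Delta P' m f.
Proof.
move=> PP' f0 mf.
pose F (h : hist X A m) := (\1_(@alive_history _ X A Delta m) h)%:E * f (last_state h).
have mF : measurable_fun setT F.
  apply: measurable_indic_mule; first exact: measurable_alive_history.
  exact: measurableT_comp mf (@measurable_last_state _ X A m).
have F0 h : 0 <= F h by rewrite /F mule_ge0// lee_fin.
have E (Q : probability Omega R) : occ_state Delta Q m f =
    \int[finite_pushforward Q (@measurable_history _ X A m)]_h F h.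
  rewrite integral_finite_pushforward//; apply: eq_integral => w _.
  by rewrite /F last_state_history indic_alive_history.
by rewrite !E; apply: eq_measure_ge0_integral => B; exact: PP'.
Qed.

Lemma occ_state1 (P : probability Omega R) t :
  occ_state Delta P t (cst 1) = P (alive Delta t).
Proof.
rewrite /occ_state; under eq_integral do rewrite mule1.
by rewrite integral_indic ?setIT//; exact: measurable_alive.
Qed.

Variable phi : R.-pker X ~> borel A.

(** The transition operator, killed on [Delta], of the chain driven by [phi]: [iter n qop f x] is
    the expectation of [f(X_n)] from [x] on the event that [X_1], ..., [X_n] avoid [Delta]. *)
Definition qop (f : X -> \bar R) (x : X) := \int[phi x]_a next_alive M Delta f (x, a).

Lemma qop_ge0 f : (forall x, 0 <= f x) -> forall x, 0 <= qop f x.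
Proof. by move=> f0 x; apply: integral_ge0 => a _; exact: next_alive_ge0. Qed.

Lemma measurable_qop f : (forall x, 0 <= f x) -> measurable_fun setT f ->
  measurable_fun setT (qop f).
Proof.
move=> f0 mf; apply: measurable_integral_section.
  by move=> z; exact: next_alive_ge0.
exact: measurable_next_alive.
Qed.

Lemma next_alive_le f g z : (forall x, 0 <= f x) -> measurable_fun setT f ->
  measurable_fun setT g -> (forall x, f x <= g x) ->
  next_alive M Delta f z <= next_alive M Delta g z.
Proof.
move=> f0 mf mg fg; apply: ge0_le_integral => //.
- by move=> y _; exact: indic_mule_ge0.
- by apply: measurable_indic_mule => //; exact: measurableC.
- by apply: measurable_indic_mule => //; exact: measurableC.
- by move=> y _; apply: lee_wpmul2l => //; rewrite lee_fin.
Qed.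

Lemma qop_le f g : (forall x, 0 <= f x) -> measurable_fun setT f ->
  measurable_fun setT g -> (forall x, f x <= g x) -> forall x, qop f x <= qop g x.
Proof.
move=> f0 mf mg fg x; have g0 y : 0 <= g y by exact: le_trans (fg y).
apply: ge0_le_integral => //.
- by move=> a _; exact: next_alive_ge0.
- have := measurableT_comp (measurable_next_alive M mDelta f0 mf)
    (@pair1_measurable _ _ X (borel A) x); exact.
- have := measurableT_comp (measurable_next_alive M mDelta g0 mg)
    (@pair1_measurable _ _ X (borel A) x); exact.
- by move=> a _; exact: next_alive_le.
Qed.

Lemma qop_cst1 x : qop (cst 1) x <= 1.
Proof.
have cst0 (y : X) : 0 <= (cst 1 y : \bar R) by exact: lee01.
apply: (@le_trans _ _ (\int[phi x]_a cst 1 a)); last first.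
  by rewrite integral_cst// [X in _ * X]prob_kernel mule1.
apply: ge0_le_integral => //.
- by move=> a _; exact: next_alive_ge0.
- have h := measurable_next_alive M mDelta cst0 (@measurable_cst _ _ _ _ _ _).
  have := measurableT_comp h (@pair1_measurable _ _ X (borel A) x); exact.
- move=> a _; apply: (@le_trans _ _ (\int[trans M (x, a)]_y cst 1 y)); last first.
    by rewrite integral_cst// [X in _ * X]prob_kernel mule1.
  apply: ge0_le_integral => //.
  + by move=> y _; exact: indic_mule_ge0.
  + by apply: measurable_indic_mule => //; exact: measurableC.
  + by move=> y _; rewrite mule1 lee_fin indicE; case: (_ \in _).
Qed.

Lemma iter_qop_ge0 n f : (forall x, 0 <= f x) -> forall x, 0 <= iter n qop f x.
Proof. by move=> f0; elim: n => //= n IH; exact: qop_ge0. Qed.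

Lemma measurable_iter_qop n f : (forall x, 0 <= f x) -> measurable_fun setT f ->
  measurable_fun setT (iter n qop f).
Proof.
move=> f0 mf; elim: n => //= n IH; apply: measurable_qop => //.
exact: iter_qop_ge0.
Qed.

Lemma iter_qop_le n f g : (forall x, 0 <= f x) -> measurable_fun setT f ->
  measurable_fun setT g -> (forall x, f x <= g x) ->
  forall x, iter n qop f x <= iter n qop g x.
Proof.
move=> f0 mf mg fg; have g0 y : 0 <= g y by exact: le_trans (fg y).
elim: n => [|n IH]; first exact: fg.
exact: (qop_le (iter_qop_ge0 n f0) (measurable_iter_qop n f0 mf)
  (measurable_iter_qop n g0 mg) IH).
Qed.

(* [survival n x] is the probability of not having reached [Delta] at time [n]
   for the chain started in [x], its state at time 0 not counting. *)
Definition survival n : X -> \bar R := iter n qop (cst 1).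

Lemma survival_ge0 n x : 0 <= survival n x.
Proof. by apply: iter_qop_ge0 => y; exact: lee01. Qed.

Lemma measurable_survival n : measurable_fun setT (survival n).
Proof. by apply: measurable_iter_qop => // x; exact: lee01. Qed.

Lemma survivalS n x : survival n.+1 x <= survival n x.
Proof.
rewrite /survival iterSr; apply: iter_qop_le => //.
- by apply: qop_ge0 => y; exact: lee01.
- by apply: measurable_qop => // y; exact: lee01.
- exact: qop_cst1.
Qed.

Lemma survival_le1 n x : survival n x <= 1.
Proof. by elim: n => // n IH; exact: le_trans (survivalS n x) IH. Qed.

Definition immortal x := ereal_inf (range (survival ^~ x)).

Lemma survival_cvg x : survival n x @[n --> \oo] --> immortal x.
Proof.
apply: ereal_nonincreasing_cvgn; apply/nonincreasing_seqP => n.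
exact: survivalS.
Qed.

Lemma immortal_ge0 x : 0 <= immortal x.
Proof. by apply: le_ereal_inf_tmp => _ [n _ <-]; exact: survival_ge0. Qed.

Lemma immortal_le n x : immortal x <= survival n x.
Proof. by apply: ereal_inf_lbound; exists n. Qed.

Lemma measurable_immortal : measurable_fun setT immortal.
Proof.
apply: (emeasurable_fun_cvg survival).
- exact: measurable_survival.
- by move=> x _; exact: survival_cvg.
Qed.

(** The Markov property at time [t]: the [n] steps played with [phi] are transferred to the
    function. *)
Lemma occ_state_stationary (pi : policy M) (P : probability Omega R) t n f :
  is_strategic_measure pi P ->
  (forall s h, (t <= s)%N -> pi s h = phi (last_state h)) ->
  (forall x, 0 <= f x) -> measurable_fun setT f ->
  occ_state Delta P (t + n) f = occ_state Delta P t (iter n qop f).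
Proof.
move=> piP stat; elim: n f => [|n IH] f f0 mf; first by rewrite addn0.
rewrite addnS (occ_stateS mDelta piP)// (occ_pair_policy mDelta piP); last 2 first.
- by move=> z; exact: next_alive_ge0.
- exact: measurable_next_alive.
transitivity (occ_state Delta P (t + n) (qop f)).
  apply: eq_integral => w _; rewrite stat ?leq_addr//.
  by rewrite last_state_history.
rewrite IH -?iterSr//; [exact: qop_ge0|exact: measurable_qop].
Qed.

Hypothesis phi_adm : forall x, phi x (adm M x) = 1.

Section switch.
Variables (pi : policy M) (m : nat).

Definition switch_ker n : R.-pker (hist X A n) ~> borel A :=
  if (n < m)%N then pi n else kpre phi (@measurable_last_state _ X A n).

Lemma switch_ker_adm n (h : hist X A n) :
  switch_ker n h (adm M (last_state h)) = 1.
Proof.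
rewrite /switch_ker; case: ifP => _; first exact: policy_adm.
exact: phi_adm.
Qed.

Definition switch_policy : policy M := Policy switch_ker_adm.

End switch.

Hypothesis M_absorbing : forall (pi : policy M) P, is_strategic_measure pi P ->
  \int[P]_w @hitting_time _ X A R Delta w < +oo.

(** Switching to [phi] at time [m] keeps the quantity [c] unchanged, as it depends on the history at
    time [m] only. Under the switched policy, [c] bounds every survival probability from below, so
    [c > 0] would make the expected hitting time infinite. *)
Lemma occ_state_immortal (pi : policy M) (P : probability Omega R) m :
  is_strategic_measure pi P -> occ_state Delta P m immortal = 0.
Proof.
move=> piP; have [P' piP'] := strategic_measure_exists (switch_policy pi m).
have PP' : forall B, measurable B ->
    P (@history _ X A m @^-1` B) = P' (@history _ X A m @^-1` B).
  apply: eq_history_law piP piP' _ => n h C nm.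
  by rewrite /= /switch_ker nm.
rewrite (occ_state_history_law PP' immortal_ge0 measurable_immortal).
have stat s (h : hist X A s) : (m <= s)%N ->
    switch_policy pi m s h = phi (last_state h).
  by move=> ms; rewrite /= /switch_ker ltnNge ms.
have aliveE n : P' (alive Delta (m + n)) = occ_state Delta P' m (survival n).
  by rewrite -occ_state1 (occ_state_stationary n piP' stat).
set c := occ_state Delta P' m immortal.
have c0 : 0 <= c by apply: integral_ge0 => w _; rewrite mule_ge0 ?lee_fin//; exact: immortal_ge0.
have cle n : c <= P' (alive Delta (m + n)).
  rewrite aliveE; apply: ge0_le_integral => //.
  - by move=> w _; rewrite mule_ge0 ?lee_fin//; exact: immortal_ge0.
  - apply: measurable_indic_mule; first exact: measurable_alive.
    exact: measurableT_comp measurable_immortal (@measurable_state _ X A m).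
  - apply: measurable_indic_mule; first exact: measurable_alive.
    exact: measurableT_comp (measurable_survival n) (@measurable_state _ X A m).
  - move=> w _; apply: lee_wpmul2l; first by rewrite lee_fin.
    exact: immortal_le.
have := M_absorbing piP'; rewrite integral_hitting_time// => fin.
apply/eqP; rewrite eq_le c0 andbT leNgt; apply/negP => cgt0.
move: fin; rewrite ltNge => /negP; apply; rewrite leye_eq; apply/eqP/eqyP => r r0.
have call t : c <= P' (alive Delta t).
  apply: le_trans (cle t) _; apply: le_measure; rewrite ?inE.
  - exact: measurable_alive.
  - exact: measurable_alive.
  - by move=> w h i it; apply: h; rewrite (leq_trans it)// leq_addl.
have cfin : c \is a fin_num.
  rewrite ge0_fin_numE// (le_lt_trans (call 0%N))//.
  by rewrite (le_lt_trans (probability_le1 _ _)) ?ltry//; exact: measurable_alive.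
have c1 : (0 < fine c)%R by rewrite fine_gt0// cgt0 -ge0_fin_numE.
(* [N] is chosen so that [N] terms, each at least [c], exceed the given real [r]. *)
pose N := (Num.truncn (r / fine c)).+1.
apply: le_trans (nneseries_lim_ge N _) => //.
apply: (@le_trans _ _ (\sum_(0 <= t < N) c)); last exact: lee_sum.
rewrite -(fineK cfin) sumEFin big_const_nat iter_addr_0 subn0 lee_fin -mulr_natr.
by rewrite mulrC -ler_pdivrMr// ltW// truncnS_gt.
Qed.

End stationary.

Local Close Scope ereal_scope.

(** * Integration against signed measures *)

(* The analysis library has another [sintegral], for simple functions. *)
Local Notation sintegral := Defs.sintegral.

Section signed_integral.
Context d (T : measurableType d) (R : realType).
Implicit Types (m : smeasure T R) (f : T -> R).

Definition bounded_measurable f :=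
  measurable_fun setT f /\ exists c : R, forall x, `|f x| <= c.

Lemma bounded_measurable_integrable (p : {measure set T -> \bar R}) f :
  (p setT < +oo)%E -> bounded_measurable f -> p.-integrable setT (EFin \o f).
Proof.
move=> pfin [mf [c fc]]; apply: measurable_bounded_integrable => //.
exists c; split; first exact: num_real.
by move=> x cx y _; exact: le_trans (fc y) (ltW cx).
Qed.

Lemma bounded_measurable_fin_num (p : {measure set T -> \bar R}) f :
  (p setT < +oo)%E -> bounded_measurable f ->
  (\int[p]_x (f x)%:E)%E \is a fin_num.
Proof.
by move=> pfin bf; apply: integrable_fin_num => //; exact: bounded_measurable_integrable.
Qed.

(** Opens the chosen Hahn decomposition once and for all; afterwards only a pair of finite measures
    with difference [m] is used. *)
Lemma smeasure_jordan m : exists p q : {measure set T -> \bar R},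
  [/\ (p setT < +oo)%E, (q setT < +oo)%E,
    (forall B, measurable B -> (m B)%:E = p B - q B)%E &
    forall f, sintegral m f = \int[p]_x f x - \int[q]_x f x].
Proof.
rewrite /sintegral.
case: cid => P [N hPN] /=; case: cid => N' hPN' /=.
exists (jordan_pos hPN'), (jordan_neg hPN'); split => // [| |B mB].
- by rewrite ltey_eq fin_num_measure.
- by rewrite ltey_eq fin_num_measure.
- by apply: etrans (jordan_decomp hPN' mB) _; rewrite /cadd /= cscaleN1.
Qed.

Lemma measure_fin_num (p : {measure set T -> \bar R}) B :
  (p setT < +oo)%E -> measurable B -> p B \is a fin_num.
Proof.
move=> pfin mB; rewrite ge0_fin_numE// (le_lt_trans _ pfin)//.
by apply: le_measure; rewrite ?inE.
Qed.

(** If [p - q = p' - q'], then [p' + q = p + q'] as nonnegative measures; integrating the bounded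
    [f] and rearranging finite terms gives independence of the decomposition. *)
Lemma sintegral_diff m (p q : {measure set T -> \bar R}) f :
  (p setT < +oo)%E -> (q setT < +oo)%E -> bounded_measurable f ->
  (forall B, measurable B -> (m B)%:E = p B - q B)%E ->
  sintegral m f = \int[p]_x f x - \int[q]_x f x.
Proof.
move=> pfin qfin bf mpq; have [p' [q' [p'fin q'fin mpq' ->]]] := smeasure_jordan m.
have E : (\int[measure_add p' q]_x (f x)%:E = \int[measure_add p q']_x (f x)%:E)%E.
  apply: eq_measure_integral => B mB _.
  rewrite [LHS]measure_addE [RHS]measure_addE.
  have := mpq B mB; rewrite mpq'//.
  move: (measure_fin_num pfin mB) (measure_fin_num qfin mB)
        (measure_fin_num p'fin mB) (measure_fin_num q'fin mB).
  move: (p B) (q B) (p' B) (q' B) => [a| |] [b| |] [a'| |] [b'| |] //= _ _ _ _.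
  by move=> -[h]; congr (_%:E); lra.
move: E; rewrite !integral_measure_add//; try exact: bounded_measurable_integrable.
rewrite /Rintegral.
move: (bounded_measurable_fin_num pfin bf) (bounded_measurable_fin_num qfin bf)
  (bounded_measurable_fin_num p'fin bf) (bounded_measurable_fin_num q'fin bf).
move: (integral p _ _) (integral q _ _) (integral p' _ _) (integral q' _ _).
move=> [a| |] [b| |] [a'| |] [b'| |] //= _ _ _ _.
by move=> -[h]; lra.
Qed.

Lemma integral_mscale (p : {measure set T -> \bar R}) (a : {nonneg R}) f :
  (p setT < +oo)%E -> bounded_measurable f ->
  (\int[mscale a p]_x (f x)%:E = a%:num%:E * \int[p]_x (f x)%:E)%E.
Proof.
move=> pfin bf; have mf : measurable_fun setT (EFin \o f).
  by case: bf => mf _; exact/measurable_EFinP.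
have intf := bounded_measurable_integrable pfin bf.
rewrite [LHS]integralE [X in (_ = _ * X)%E]integralE muleBr//.
  rewrite ge0_integral_mscale//; last exact: measurable_funepos.
  by rewrite ge0_integral_mscale//; exact: measurable_funeneg.
apply: fin_num_adde_defr.
by apply: integrable_fin_num => //; exact: integrable_funepos.
Qed.

Lemma sintegral_measureD m1 m2 f : bounded_measurable f ->
  sintegral (m1 + m2) f = sintegral m1 f + sintegral m2 f.
Proof.
move=> bf.
have [p1 [q1 [p1fin q1fin E1 ->]]] := smeasure_jordan m1.
have [p2 [q2 [p2fin q2fin E2 ->]]] := smeasure_jordan m2.
have fin2 (r s : {measure set T -> \bar R}) : (r setT < +oo)%E ->
    (s setT < +oo)%E -> (measure_add r s setT < +oo)%E.
  by move=> rfin sfin; rewrite [ltLHS]measure_addE lte_add_pinfty.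
rewrite (@sintegral_diff _ (measure_add p1 p2) (measure_add q1 q2)) ?fin2//.
  rewrite /Rintegral !integral_measure_add//; try exact: bounded_measurable_integrable.
  rewrite [X in X - _ = _]fineD ?bounded_measurable_fin_num//.
  rewrite [X in _ - X = _]fineD ?bounded_measurable_fin_num//.
  by lra.
move=> B mB.
rewrite [X in (_ = X - _)%E]measure_addE [X in (_ = _ - X)%E]measure_addE.
rewrite (_ : (m1 + m2) B = m1 B + m2 B)// EFinD E1// E2//.
move: (measure_fin_num p1fin mB) (measure_fin_num q1fin mB)
      (measure_fin_num p2fin mB) (measure_fin_num q2fin mB).
move: (p1 B) (q1 B) (p2 B) (q2 B) => [a| |] [b| |] [a'| |] [b'| |] //= _ _ _ _.
by congr (_%:E); lra.
Qed.

Lemma sintegral_measureN m f : bounded_measurable f -> sintegral (- m) f = - sintegral m f.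
Proof.
move=> bf; have [p [q [pfin qfin E ->]]] := smeasure_jordan m.
rewrite (@sintegral_diff _ q p)//; first by rewrite opprB.
move=> B mB; rewrite (_ : (- m) B = - m B)// EFinN E//.
by rewrite fin_num_oppeB ?measure_fin_num// addeC.
Qed.

Lemma sintegral_measureZ (a : R) m f : bounded_measurable f ->
  sintegral (a *: m) f = a * sintegral m f.
Proof.
move=> bf; wlog a0 : a / 0 <= a => [wlog_a0|].
  have [/wlog_a0//|a0] := leP 0 a.
  rewrite -[a]opprK scaleNr sintegral_measureN// wlog_a0 ?oppr_ge0 1?ltW//.
  by rewrite !mulNr.
have [p [q [pfin qfin E ->]]] := smeasure_jordan m.
have finZ (r : {measure set T -> \bar R}) : (r setT < +oo)%E ->
    (mscale (NngNum a0) r setT < +oo)%E.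
  by move=> rfin; rewrite ltey_eq fin_numM ?measure_fin_num.
rewrite (@sintegral_diff _ (mscale (NngNum a0) p) (mscale (NngNum a0) q)) ?finZ//.
  rewrite /Rintegral !integral_mscale// !fineM ?bounded_measurable_fin_num//=.
  by rewrite mulrBr.
move=> B mB; rewrite (_ : (a *: m) B = a * m B)// EFinM E//.
by rewrite muleBr// fin_num_adde_defr// measure_fin_num.
Qed.

Definition finite_of_smeasure m of nonnegative m := EFin \o m.

Section finite_of_smeasure.
Variables (m : smeasure T R) (m_ge0 : nonnegative m).

Let m0 : finite_of_smeasure m_ge0 set0 = 0%E.
Proof. by have /asboolP[h _ _] := smeasureP m; rewrite /finite_of_smeasure /= h. Qed.

Let mge0 B : (0 <= finite_of_smeasure m_ge0 B)%E.
Proof.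
rewrite /finite_of_smeasure /= lee_fin; have [mB|nB] := pselect (measurable B).
  exact: m_ge0.
(* Off the sigma-algebra the value is 0 by convention, so nonnegativity holds on all sets. *)
by have /asboolP[_ _ ->] := smeasureP m.
Qed.

Let m_sigma : semi_sigma_additive (finite_of_smeasure m_ge0).
Proof. by have /asboolP[] := smeasureP m. Qed.

HB.instance Definition _ := isMeasure.Build _ _ _ (finite_of_smeasure m_ge0)
  m0 mge0 m_sigma.

Let m_fin : fin_num_fun (finite_of_smeasure m_ge0).
Proof. by []. Qed.

HB.instance Definition _ := Measure_isFinite.Build _ _ _
  (finite_of_smeasure m_ge0) m_fin.

Lemma sintegral_nonneg f : bounded_measurable f ->
  sintegral m f = \int[finite_of_smeasure m_ge0]_x f x.
Proof.
move=> bf; rewrite (@sintegral_diff _ (finite_of_smeasure m_ge0) mzero)//.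
- by rewrite [X in _ - X]/Rintegral integral_measure_zero subr0.
- by rewrite ltey_eq fin_num_measure.
- exact: ltry.
- by move=> B mB; rewrite [X in (_ - X)%E](_ : _ = 0%E)// sube0.
Qed.

End finite_of_smeasure.

End signed_integral.

(** * Occupancy measures and the characteristic equations *)

Section occupation.
Local Open Scope ereal_scope.
Context d (X : measurableType d) (A : ptopologicalType) (R : realType).
Context (k : nat) (M : control_model X A R k) (Delta : set X).
Hypothesis mDelta : measurable Delta.
Local Notation Omega := (trajectory X A).
Local Notation XA := (X * borel A)%type.
Implicit Types (P : probability Omega R) (nu : smeasure XA R).

Lemma occ_pair_ge0 P t (g : XA -> \bar R) : (forall z, 0 <= g z) ->
  0 <= occ_pair Delta P t g.
Proof. by move=> g0; apply: integral_ge0 => w _; rewrite mule_ge0// lee_fin. Qed.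

Lemma measurable_pair t : measurable_fun setT (fun w : Omega => (state t w, action t w)).
Proof.
by apply: measurable_fun_pair; [exact: measurable_state|exact: measurable_action].
Qed.

Lemma occupationE P G : measurable G ->
  occupation Delta P G = \sum_(0 <= t <oo) occ_pair Delta P t (fun z => (\1_G z)%:E).
Proof.
move=> mG; rewrite /occupation integral_nneseries; last 3 first.
- exact: measurableT.
- move=> t; apply/measurable_EFinP; apply: measurable_funM.
    have -> : \1_[set w | t%:R%:E < @hitting_time _ X A R Delta w] =
        \1_(alive Delta t) :> (Omega -> R).
      by apply/funext => w; rewrite indic_alive.
    by apply: measurable_indic; exact: measurable_alive.
  have mi : measurable_fun setT (\1_G : XA -> R) by exact: measurable_indic.
  exact: measurableT_comp mi (measurable_pair t).
- by move=> t w _; rewrite lee_fin mulr_ge0.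
apply: eq_eseriesr => t _; apply: eq_integral => w _.
by rewrite indic_alive EFinM.
Qed.

Section occupation_measure.
Variables (P : probability Omega R) (m : {measure set XA -> \bar R}).
Hypothesis mE : forall G, measurable G -> m G = occupation Delta P G.

Lemma integral_occupation (g : XA -> \bar R) : (forall z, 0 <= g z) ->
  measurable_fun setT g ->
  \int[m]_z g z = \sum_(0 <= t <oo) occ_pair Delta P t g.
Proof.
move=> g0 mg.
(* [mt t] is the law of the state-action pair at time [t] restricted to [T > t]; the occupation
   measure is the sum of these. *)
pose mt t := finite_pushforward
  (mrestr P (@measurable_alive _ X A Delta mDelta t)) (measurable_pair t).
have mtE t f : (forall z, 0 <= f z) -> measurable_fun setT f ->
    \int[mt t]_z f z = occ_pair Delta P t f.
  move=> f0 mf; have mfp := measurableT_comp mf (measurable_pair t).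
  rewrite integral_finite_pushforward// integral_mrestr// integral_mkcond.
  by apply: eq_integral => w _; rewrite epatch_indic muleC.
transitivity (\int[mseries mt 0]_z g z).
  apply: eq_measure_ge0_integral => G mG.
  rewrite mE// occupationE//; apply: eq_eseriesr => t _.
  rewrite -mtE//; last exact/measurable_EFinP.
  by rewrite integral_indic ?setIT.
by rewrite ge0_integral_measure_series//; apply: eq_eseriesr => t _; rewrite mtE.
Qed.

End occupation_measure.

Lemma bounded_measurable_trans B : measurable B ->
  bounded_measurable (fun z => fine (trans M z B)).
Proof.
move=> mB; split.
  by apply: measurableT_comp => //; exact: measurable_kernel.
exists 1%R => z; have le1 : trans M z B <= 1.
  rewrite -(prob_kernel (s := trans M) z).
  by apply: le_measure; rewrite ?inE.
have fin : trans M z B \is a fin_num.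
  by rewrite ge0_fin_numE// (le_lt_trans le1)// ltry.
by rewrite ger0_norm ?fine_ge0// -lee_fin fineK.
Qed.

Lemma kernel_imageE nu (nu0 : nonnegative nu) B : measurable B ->
  (kernel_image M nu B)%:E = \int[finite_of_smeasure nu0]_z trans M z B.
Proof.
move=> mB; have bt := bounded_measurable_trans mB.
rewrite /kernel_image (sintegral_nonneg nu0 bt) /Rintegral fineK.
  apply: eq_integral => z _; rewrite fineK//.
  rewrite ge0_fin_numE// (@le_lt_trans _ _ (trans M z setT))//.
    by apply: le_measure; rewrite ?inE.
  by rewrite prob_kernel ltry.
apply: bounded_measurable_fin_num => //.
by rewrite ltey_eq fin_num_measure.
Qed.

Lemma next_alive_indic B z : measurable B ->
  next_alive M Delta (fun x => (\1_B x)%:E) z = trans M z (B `&` ~` Delta).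
Proof.
move=> mB; rewrite /next_alive.
under eq_integral do rewrite -EFinM mulrC.
rewrite (_ : (fun x => _) = EFin \o \1_(B `&` ~` Delta)); last first.
  by apply/funext => y; rewrite indicI.
by rewrite integral_indic ?setIT//; apply: measurableI => //; exact: measurableC.
Qed.

(** Time 0 contributes the initial law outside [Delta], and the term of time [t + 1] is that of time
    [t] pushed through the killed transition; summing over [t] gives [nu Q]. *)
Lemma occupancy_characteristic nu : measurable (graph_adm M) ->
  occupancy_measures M Delta nu -> characteristic_solutions M Delta nu.
Proof.
move=> mK [pi [P [piP nuE]]].
have nu0 : nonnegative nu.
  move=> G mG; rewrite -lee_fin nuE// occupationE//; apply: nneseries_ge0 => t _ _.
  by apply: occ_pair_ge0 => z; rewrite lee_fin.
pose m := finite_of_smeasure nu0.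
have mE G : measurable G -> m G = occupation Delta P G by exact: nuE.
split => // [|B mB].
- have mKC : measurable (~` graph_adm M) by exact: measurableC.
  suff : (nu (~` graph_adm M))%:E = 0 by move=> [].
  rewrite nuE// occupationE//; apply: eseries0 => t _ _.
  rewrite (occ_pair_policy mDelta piP); last 2 first.
  + by move=> z; rewrite lee_fin.
  + by apply/measurable_EFinP; exact: measurable_indic.
  apply: integral0_eq => w _; rewrite [X in _ * X](_ : _ = 0) ?mule0//.
  have madm := measurable_adm M (state t w).
  rewrite (_ : (fun a => _) = EFin \o \1_(~` adm M (state t w))); last first.
    apply/funext => a /=; rewrite !indicE.
    suff -> : ((state t w, a) \in ~` graph_adm M) =
      (a \in ~` adm M (state t w)) by [].
    by apply/idP/idP => /set_mem h; apply/mem_set.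
  rewrite integral_indic ?setIT//; last exact: measurableC.
  have := policy_adm pi (history t w); rewrite last_state_history => pi1.
  have fin1 : pi t (history t w) (adm M (state t w)) \is a fin_num by rewrite pi1.
  have : pi t (history t w) (adm M (state t w) `|` ~` adm M (state t w)) = 1.
    by rewrite setUv prob_kernel.
  rewrite measureU//; [|exact: measurableC|exact: setICr].
  rewrite [X in X + _]pi1 addeC => h.
  by rewrite -[LHS](@addeK _ 1)// [X in X - _ = _]h subee.
- have mBD : measurable (B `&` ~` Delta) by apply: measurableI => //; exact: measurableC.
  have mBi : measurable_fun setT (fun x => (\1_B x)%:E : \bar R).
    by apply/measurable_EFinP; exact: measurable_indic.
  have Bi0 x : 0 <= (\1_B x)%:E :> \bar R by rewrite lee_fin.
  apply: EFin_inj; rewrite /restrict_compl EFinD fineK; last first.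
    by apply: fin_num_measure.
  rewrite (kernel_imageE nu0 mBD) (integral_occupation mE); last 2 first.
  + by [].
  + exact: measurable_kernel.
  rewrite /marginal nuE ?occupationE; last 2 first.
  + exact: measurableX.
  + exact: measurableX.
  rewrite (eq_eseriesr (g := fun t => occ_state Delta P t (fun x => (\1_B x)%:E))); last first.
    move=> t _; apply: eq_integral => w _; rewrite !indicE.
    suff -> : ((state t w, action t w) \in B `*` setT) = (state t w \in B) by [].
    by apply/idP/idP => /set_mem h; apply/mem_set => //; case: h.
  have occ0 t : 0 <= occ_state Delta P t (fun x => (\1_B x)%:E).
    by apply: integral_ge0 => w _; rewrite mule_ge0// lee_fin.
  rewrite nneseries_recl//; congr (_ + _).
    rewrite (occ_state0 mDelta piP)//; under eq_integral do rewrite -EFinM mulrC.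
    rewrite (_ : (fun x => _) = EFin \o \1_(B `&` ~` Delta)); last first.
      by apply/funext => y; rewrite indicI.
    by rewrite integral_indic ?setIT.
  rewrite -(nneseries_addn 1)//; apply: eq_eseriesr => t _.
  rewrite addn1 (occ_stateS mDelta piP)//; apply: eq_integral => w _.
  by rewrite next_alive_indic.
Qed.

End occupation.

(** * Solutions dominated by an occupancy measure *)

Section dominated_solution.
Local Open Scope ereal_scope.
Context d (X : measurableType d) (A : ptopologicalType) (R : realType).
Context (k : nat) (M : control_model X A R k) (Delta : set X).
Hypothesis A_borel : borel_space R A.
Hypothesis A_compact : compact [set: A].
Hypothesis M_meas : measurability_conditions M.
Hypothesis mDelta : measurable Delta.
Hypothesis M_absorbing : absorbing M Delta.
Local Notation Omega := (trajectory X A).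
Local Notation XA := (X * borel A)%type.
Implicit Types (P : probability Omega R) (mu nu : smeasure XA R).

Lemma ae0_dominated d' (T : measurableType d') (m1 m2 : {measure set T -> \bar R})
    (c : R) (f : T -> \bar R) : (forall x, 0 <= f x) -> measurable_fun setT f ->
  (forall B, measurable B -> m1 B <= c%:E * m2 B) ->
  \int[m2]_x f x = 0 -> \int[m1]_x f x = 0.
Proof.
move=> f0 mf m12 f2.
have E (m : {measure set T -> \bar R}) : \int[m]_x `|f x| = \int[m]_x f x.
  by apply: eq_integral => x _; rewrite gee0_abs.
rewrite -E; apply/(ae_eq_integral_abs _ measurableT mf).
move: f2; rewrite -E => /(ae_eq_integral_abs _ measurableT mf)[Z [mZ Z0 fZ]].
exists Z; split => //; apply/eqP; rewrite eq_le measure_ge0 andbT.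
by have := m12 _ mZ; rewrite Z0 mule0.
Qed.

Section fixed_point.
Variables (nu : smeasure XA R) (nu0 : nonnegative nu).
Local Notation m := (finite_of_smeasure nu0).
Local Notation N := (slice m measurableT).
Hypothesis nu_char : characteristic_solutions M Delta nu.
Variable phi : R.-pker X ~> borel A.
Hypothesis phiE : forall B C, measurable B -> measurable C ->
  m (B `*` C) = \int[N]_(x in B) phi x C.

Let mDC : measurable (~` Delta).
Proof. exact: measurableC. Qed.

(** The characteristic equation is an equality of measures, hence of integrals; disintegrating
    through [phi] turns [nu Q] into [qop]. *)
Lemma marginal_fixed_point f : (forall x, 0 <= f x) -> measurable_fun setT f ->
  \int[N]_x f x = \int[init M]_x ((\1_(~` Delta) x)%:E * f x) +
                  \int[N]_x qop M Delta phi f x.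
Proof.
move=> f0 mf.
rewrite -(integral_disintegrated phiE (f := next_alive M Delta f)); last 2 first.
- by move=> z; exact: next_alive_ge0.
- exact: measurable_next_alive.
have -> : \int[init M]_x ((\1_(~` Delta) x)%:E * f x) =
    \int[mrestr (init M) mDC]_x f x.
  rewrite integral_mrestr// [RHS]integral_mkcond; apply: eq_integral => x _.
  by rewrite epatch_indic muleC.
have -> : \int[m]_z next_alive M Delta f z =
    \int[mrestr (mbind m (trans M)) mDC]_x f x.
  rewrite integral_mrestr// [RHS]integral_mkcond integral_mbind; last 2 first.
  - by move=> x; rewrite erestrict_ge0.
  - apply/(measurable_restrictT _ mDC).
    exact: measurable_funTS.
  apply: eq_integral => z _; apply: eq_integral => x _.
  by rewrite epatch_indic muleC.
rewrite -ge0_integral_measure_add//.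
apply: eq_measure_ge0_integral => B mB; rewrite [RHS]measure_addE.
have mBD : measurable (B `&` ~` Delta) by exact: measurableI.
have [_ _ /(_ B mB) E] := nu_char.
transitivity ((marginal nu B)%:E) => //.
rewrite E /restrict_compl EFinD fineK ?fin_num_measure//.
by rewrite (kernel_imageE M nu0 mBD).
Qed.

Lemma marginal_iter (pi : policy M) P n f : is_strategic_measure pi P ->
  (forall s h, pi s h = phi (last_state h)) ->
  (forall x, 0 <= f x) -> measurable_fun setT f ->
  \int[N]_x f x = \sum_(0 <= t < n) occ_state Delta P t f +
                  \int[N]_x iter n (qop M Delta phi) f x.
Proof.
move=> piP stat f0 mf; elim: n => [|n IH]; first by rewrite big_geq// add0e.
have q0 := iter_qop_ge0 M Delta phi n f0.
have mq := measurable_iter_qop M mDelta phi n f0 mf.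
rewrite IH big_nat_recr//= -addeA; congr (_ + _).
rewrite (marginal_fixed_point q0 mq); congr (_ + _).
rewrite -(occ_state0 mDelta piP q0 mq).
by rewrite -(occ_state_stationary mDelta n piP (fun s h _ => stat s h) f0 mf).
Qed.

Hypothesis N_immortal : \int[N]_x immortal M Delta phi x = 0.

(** For [f <= 1] the remainder in [marginal_iter] is at most the integral of [survival n], which
    tends to that of [immortal] by dominated convergence, [N] being finite. *)
Lemma marginal_series (pi : policy M) P f : is_strategic_measure pi P ->
  (forall s h, pi s h = phi (last_state h)) ->
  (forall x, 0 <= f x) -> (forall x, f x <= 1) -> measurable_fun setT f ->
  \sum_(0 <= t <oo) occ_state Delta P t f = \int[N]_x f x.
Proof.
move=> piP stat f0 f1 mf.
have survival_int : \int[N]_x survival M Delta phi n x @[n --> \oo] --> 0.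
  rewrite -N_immortal.
  apply: (@dominated_cvg _ _ _ N setT measurableT (survival M Delta phi)
    (immortal M Delta phi) (cst 1)) => //.
  - exact: measurable_survival.
  - by move=> x _; exact: survival_cvg.
  - exact: finite_measure_integrable_cst.
  - by move=> n x _; rewrite gee0_abs ?survival_ge0//; exact: survival_le1.
pose e n := \int[N]_x iter n (qop M Delta phi) f x.
have e0 n : 0 <= e n by apply: integral_ge0 => x _; exact: iter_qop_ge0.
have e_cvg : e n @[n --> \oo] --> 0.
  apply: (@squeeze_cvge _ _ _ _ (cst 0) _ (fun n => \int[N]_x survival M Delta phi n x)).
  - apply: nearW => n; rewrite e0/=; apply: ge0_le_integral => //.
    + by move=> x _; exact: iter_qop_ge0.
    + exact: measurable_iter_qop.
    + exact: measurable_survival.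
    + by move=> x _; exact: iter_qop_le.
  - exact: cvg_cst.
  - exact: survival_int.
have Nfin : \int[N]_x f x \is a fin_num.
  rewrite ge0_fin_numE ?integral_ge0//.
  apply: (@le_lt_trans _ _ (\int[N]_x cst 1 x)); first exact: ge0_le_integral.
  by rewrite integral_cst// mul1e ltey_eq fin_num_measure.
have efin n : e n \is a fin_num.
  rewrite ge0_fin_numE// (@le_lt_trans _ _ (\int[N]_x f x))//.
    rewrite (marginal_iter n piP stat f0 mf) leeDr// sume_ge0// => t _.
    by apply: integral_ge0 => w _; rewrite mule_ge0// lee_fin.
  by rewrite ltey_eq Nfin.
apply/cvg_lim => //.
rewrite (_ : (fun n => _) = fun n => \int[N]_x f x - e n); last first.
  apply/funext => n; rewrite (marginal_iter n piP stat f0 mf) -/(e n) addeK//.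
rewrite -[X in _ --> X]sube0; apply: cvgeB => //.
  by rewrite fin_num_adde_defl.
exact: cvg_cst.
Qed.

End fixed_point.

Lemma dominated_solution_occupancy mu nu (c : R) :
  occupancy_measures M Delta mu -> characteristic_solutions M Delta nu ->
  setwise_le nu (c *: mu) -> occupancy_measures M Delta nu.
Proof.
move=> muO nuC numu; have [mK [theta [mtheta thetaK]]] := M_meas.
have [mu0 _ _] := occupancy_characteristic mDelta mK muO.
have [pi [P [piP muE]]] := muO.
have [nu0 nuK _] := nuC.
pose m := finite_of_smeasure nu0.
have [phi [phi_adm phiE]] := @supported_disintegration _ X A R A_borel A_compact
  m (graph_adm M) theta mK mtheta thetaK (congr1 EFin nuK).
have ET (pi' : policy M) P' : is_strategic_measure pi' P' ->
    \int[P']_w @hitting_time _ X A R Delta w < +oo by case: M_absorbing => _; exact.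
have imm0 := immortal_ge0 M Delta phi.
have mimm := measurable_immortal M mDelta phi.
have mimm1 : measurable_fun setT (fun z : XA => immortal M Delta phi z.1).
  exact: measurableT_comp mimm measurable_fst.
have N_immortal : \int[slice m measurableT]_x immortal M Delta phi x = 0.
  transitivity (\int[m]_z immortal M Delta phi z.1).
    rewrite (integral_disintegrated phiE)//; apply: eq_integral => x _.
    apply/esym; transitivity (\int[phi x]_y cst (immortal M Delta phi x) y) => //.
    by rewrite integral_cst// [X in _ * X]prob_kernel mule1.
  (* Against [mu] the integral is a sum over times, each term of which vanishes by
     [occ_state_immortal]; [nu <= c mu] transfers the null set to [nu]. *)
  apply: (ae0_dominated (m2 := finite_of_smeasure mu0) (c := c)) => //.
  have mE G : measurable G -> finite_of_smeasure mu0 G = occupation Delta P G.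
    exact: muE.
  rewrite (integral_occupation mDelta mE)//; apply: eseries0 => t _ _.
  exact: (occ_state_immortal mDelta phi_adm ET t piP).
(* Switching at time 0 discards [pi] altogether: [pi'] is the stationary policy [phi]. *)
pose pi' := switch_policy phi_adm pi 0.
have [P' piP'] := strategic_measure_exists pi'.
exists pi', P'; split => // G mG.
rewrite occupationE//.
have mf := measurable_kernel_section phi mG.
have f0 x : 0 <= phi x [set a | G (x, a)] by [].
have f1 x : phi x [set a | G (x, a)] <= 1.
  rewrite -(prob_kernel (s := phi) x); apply: le_measure; rewrite ?inE//.
  by have := pair1_measurable x measurableT mG; rewrite setTI.
(* Integrating out the action replaces the indicator of [G] by a function of the state with values
   in [0, 1], as [marginal_series] requires. *)
transitivity (\sum_(0 <= t <oo)
    occ_state Delta P' t (fun x => phi x [set a | G (x, a)])); last first.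
  apply: eq_eseriesr => t _; rewrite (occ_pair_policy mDelta piP'); last 2 first.
  - by move=> z; rewrite lee_fin.
  - by apply/measurable_EFinP; exact: measurable_indic.
  apply: eq_integral => w _; congr (_ * _).
  rewrite /= /switch_ker /= /kpre last_state_history.
  rewrite -[X in phi _ X]setIT -integral_indic//.
  by have := pair1_measurable (state t w) measurableT mG; rewrite setTI.
rewrite (marginal_series nuC phiE N_immortal piP')//.
apply: etrans (disintegratedE phiE mG) _; rewrite mbindE.
by apply: eq_integral => x _; rewrite kgraphE.
Qed.

End dominated_solution.

(** * Faces of sets of measures cut out by linear equations *)

Section linear_subspace.
Context (R : realType) (V : lmodType R) (W : set V).
Hypothesis W_linear : is_linear_subspace W.

Lemma subspaceZ a u : W u -> W (a *: u).
Proof. by move=> Wu; rewrite -[_ *: _]addr0; case: W_linear => W0; apply. Qed.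

Lemma subspaceD u v : W u -> W v -> W (u + v).
Proof. by move=> Wu Wv; rewrite -[u]scale1r; case: W_linear => _; apply. Qed.

Lemma subspaceB u v : W u -> W v -> W (u - v).
Proof. by move=> Wu Wv; rewrite -scaleN1r; apply/subspaceD/subspaceZ. Qed.

Lemma subspace_comb p x y (t : R) : W (x - p) -> W (y - p) ->
  W (t *: x + (1 - t) *: y - p).
Proof.
move=> Wx Wy.
rewrite (_ : _ - p = t *: (x - p) + (1 - t) *: (y - p)).
  by apply: subspaceD; exact: subspaceZ.
rewrite !scalerBr addrACA -opprD -scalerDl.
by rewrite (_ : t + (1 - t) = 1) ?scale1r//; ring.
Qed.

End linear_subspace.

Section dominated_faces.
Context d (T : measurableType d) (R : realType).
Implicit Types (u v x y z nu gamma : smeasure T R) (c : R).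

Lemma smeasureE : ((forall u v B, ((u + v) B = u B + v B)%R) *
  (forall u B, ((- u) B = - u B)%R) * (forall a u B, ((a *: u) B = a * u B)%R) *
  (forall B, (0%R : smeasure T R) B = 0%R))%type.
Proof. by []. Qed.

Variables (O W : set (smeasure T R)) (mu : smeasure T R).
Hypotheses (W_linear : is_linear_subspace W) (O_mu : O mu).
Hypothesis O_sub : forall nu, O nu -> nonnegative nu /\ W (nu - mu).
Hypothesis O_dominated : forall nu c, nonnegative nu -> W (nu - mu) ->
  setwise_le nu (c *: mu) -> O nu.

Let mu0 : nonnegative mu. Proof. by case: (O_sub O_mu). Qed.

Definition dominated := [set nu | [/\ nonnegative nu, W (nu - mu) &
  exists2 c, 1 < c & setwise_le nu (c *: mu)]].

Definition comparable_directions := [set v | W v /\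
  exists2 c, 0 < c & setwise_le (- c *: mu) v /\ setwise_le v (c *: mu)].

Lemma setwise_le_scale c c' nu : c <= c' -> setwise_le nu (c *: mu) ->
  setwise_le nu (c' *: mu).
Proof.
move=> cc' nuc B mB; apply: le_trans (nuc B mB) _.
by rewrite !smeasureE ler_wpM2r// mu0.
Qed.

Lemma dominated_mu : dominated mu.
Proof.
split=> //; first by rewrite subrr; case: W_linear.
by exists 2; [lra|move=> B mB; rewrite !smeasureE; have := mu0 mB; lra].
Qed.

Lemma dominated_comb x y (t : R) : dominated x -> dominated y -> 0 <= t <= 1 ->
  dominated (t *: x + (1 - t) *: y).
Proof.
move=> [x0 Wx [c c1 xc]] [y0 Wy [c' c'1 yc]] /andP[t0 t1]; split.
- move=> B mB; rewrite !smeasureE.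
  by rewrite addr_ge0// mulr_ge0 ?subr_ge0 ?x0 ?y0.
- exact: subspace_comb.
- have {}xc : setwise_le x (Num.max c c' *: mu).
    by apply: setwise_le_scale xc; rewrite le_max lexx.
  have {}yc : setwise_le y (Num.max c c' *: mu).
    by apply: setwise_le_scale yc; rewrite le_max lexx orbT.
  exists (Num.max c c'); first by rewrite lt_max c1.
  move: (Num.max c c') xc yc => e xe ye B mB.
  have := xe B mB; have := ye B mB; rewrite !smeasureE => h1 h2.
  rewrite [e * _](_ : _ = t * (e * mu B) + (1 - t) * (e * mu B)); last by ring.
  by rewrite lerD// ler_wpM2l// subr_ge0.
Qed.

(** Dropping the nonnegative term [(1 - t) z] leaves [t y <= x <= c mu]. *)
Lemma dominated_factor x y z (t c : R) : nonnegative z -> 0 < t < 1 ->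
  x = t *: y + (1 - t) *: z -> setwise_le x (c *: mu) ->
  setwise_le y ((c / t) *: mu).
Proof.
move=> z0 /andP[t0 t1] -> xc B mB; have := xc B mB; have := z0 B mB.
rewrite !smeasureE => zB h.
have : 0 <= (1 - t) * z B by rewrite mulr_ge0 ?subr_ge0// ltW.
rewrite [c / t * _](_ : _ = (c * mu B) / t) ?ler_pdivlMr//; last by field; lra.
by lra.
Qed.

Lemma dominated_is_face : is_face O dominated.
Proof.
split.
- by exists mu; exact: dominated_mu.
- move=> x y l /set_mem xD /set_mem yD; apply/mem_set.
  by apply: dominated_comb => //; rewrite ge0 le1.
- by move=> nu [nu0 Wnu [c _]]; exact: O_dominated.
- have factor x y z (t : R) : dominated x -> O y -> O z -> 0 < t < 1 ->
      x = t *: y + (1 - t) *: z -> dominated y.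
    move=> [_ _ [c c1 xc]] /O_sub[y0 Wy] /O_sub[z0 _] t01 xE; split => //.
    (* Since [t < 1 < c], the constant [c / t] is still greater than 1. *)
    exists (c / t); last exact: (dominated_factor z0 t01 xE xc).
    case/andP: t01 => t0 t1; rewrite ltr_pdivlMr// mul1r; lra.
  move=> x y z t xD yO zO t01 xE; split; first exact: factor xE.
  apply: (factor x z y (1 - t)) => //; first by lra.
  by rewrite addrC subKr.
Qed.

Lemma generated_face_dominated : generated_face O mu = dominated.
Proof.
apply/seteqP; split; first by apply: smallest_sub;
  [exact: dominated_is_face|move=> _ ->; exact: dominated_mu].
move=> nu [nu0 Wnu [c c1 nuc]] G [[_ _ GO G_ext] Gmu].
(* [z] lies beyond [mu] on the ray from [nu], placed so that [mu = c^-1 nu + (1 - c^-1) z]. It is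
   nonnegative because [nu <= c mu] and bounded by [c / (c - 1) mu] because [nu >= 0]; every face
   containing [mu] therefore contains [nu]. *)
pose z := (c - 1)^-1 *: (c *: mu - nu).
have zO : O z.
  apply: (@O_dominated z (c / (c - 1))).
  - move=> B mB; have := nuc B mB; rewrite !smeasureE => h.
    by rewrite mulr_ge0 ?invr_ge0 ?subr_ge0// ltW.
  - rewrite (_ : z - mu = - (c - 1)^-1 *: (nu - mu)); first exact: subspaceZ.
    apply/smeasure_eqP => B _; rewrite !smeasureE; field; lra.
  - move=> B mB; have := nu0 B mB; rewrite !smeasureE => h.
    rewrite [c / _ * _](_ : _ = (c - 1)^-1 * (c * mu B)); last by field; lra.
    by rewrite ler_wpM2l ?invr_ge0 ?(ltW c1) ?subr_ge0//; lra.
have c0 : 0 < c by lra.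
have nuO : O nu by exact: O_dominated nuc.
case: (G_ext mu nu z c^-1) => //; first exact: Gmu.
  by rewrite invr_gt0 c0 invf_lt1.
apply/smeasure_eqP => B _; rewrite !smeasureE; field; lra.
Qed.

Lemma comparable_directions_linear : is_linear_subspace comparable_directions.
Proof.
split.
  split; first by case: W_linear.
  by exists 1 => //; split=> B mB; rewrite !smeasureE; have := mu0 mB; lra.
move=> a u v [Wu [c c0 [uc1 uc2]]] [Wv [c' c'0 [vc1 vc2]]]; split.
  by apply: subspaceD => //; exact: subspaceZ.
exists (`|a| * c + c'); first by rewrite ltr_wpDl// mulr_ge0// ltW.
have bound B : measurable B -> `|a * u B| <= `|a| * c * mu B.
  move=> mB; rewrite normrM -mulrA ler_wpM2l// ler_norml.
  by have := uc1 B mB; have := uc2 B mB; rewrite !smeasureE mulNr => -> ->.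
split=> B mB; have := bound B mB; rewrite ler_norml => /andP[h1 h2];
  have := vc1 B mB; have := vc2 B mB; rewrite !smeasureE; lra.
Qed.

Lemma affine_hull_dominated :
  affine_hull dominated = [set mu + v | v in comparable_directions].
Proof.
apply/seteqP; split.
  apply: smallest_sub.
    move=> _ _ t [v Vv <-] [w Vw <-]; exists (t *: v + (1 - t) *: w).
      have [_ Vcomb] := comparable_directions_linear; apply: (Vcomb t v) => //.
      exact: subspaceZ comparable_directions_linear _ _ Vw.
    by apply/smeasure_eqP => B _; rewrite !smeasureE; ring.
  move=> nu [nu0 Wnu [c c1 nuc]]; exists (nu - mu); last by rewrite addrC subrK.
  split => //; exists c; first lra.
  by split=> B mB; have := nuc B mB; have := nu0 B mB; have := mu0 mB;
    rewrite !smeasureE; nra.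
move=> _ [v [Wv [c c0 [cv vc]]] <-] L [L_affine DL].
(* Shrinking [v] by [c + 1] keeps [mu + v / (c + 1)] between 0 and [2 mu]; the affine combination
   with coefficient [c + 1] then recovers [mu + v]. *)
pose nu := mu + (c + 1)^-1 *: v.
have nuL : L nu.
  apply: DL; split.
  - move=> B mB; have := cv B mB; have := mu0 mB; rewrite !smeasureE => h1 h2.
    rewrite (_ : _ + _ = (c + 1)^-1 * ((c + 1) * mu B + v B)); last by field; lra.
    by rewrite mulr_ge0 ?invr_ge0//; [lra|nra].
  - by rewrite addrAC subrr add0r; exact: subspaceZ.
  - exists 2; first lra.
    move=> B mB; have := vc B mB; have := mu0 mB; rewrite !smeasureE => h1 h2.
    have : (c + 1)^-1 * v B <= mu B by rewrite mulrC ler_pdivrMr; [nra|lra].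
    by lra.
rewrite (_ : mu + v = (c + 1) *: nu + (1 - (c + 1)) *: mu).
  by apply: L_affine => //; apply: DL; exact: dominated_mu.
by apply/smeasure_eqP => B _; rewrite !smeasureE; field; lra.
Qed.

Lemma parallel_dominated : parallel comparable_directions (affine_hull dominated).
Proof.
split; first exact: comparable_directions_linear.
by exists mu; exact: affine_hull_dominated.
Qed.

(** A relative interior point [nu] can be pushed slightly away from [mu]: [nu - a (mu - nu) >= 0]
    reads [mu <= ((1 + a) / a) nu]. Conversely, a lower bound by a multiple of [mu] leaves room in
    every direction comparable with [mu]. *)
Lemma rai_dominated : rai dominated = [set nu | [/\ nonnegative nu, W (nu - mu) &
  exists2 c, 1 < c & setwise_le (c^-1 *: mu) nu /\ setwise_le nu (c *: mu)]].
Proof.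
have [V0 Vcomb] := comparable_directions_linear.
apply/seteqP; split=> nu.
- move=> [nuD nu_rai]; have [nu0 Wnu [c c1 nuc]] := nuD; split => //.
  (* When [nu = mu] there is no line through the two points, and the bounds are immediate. *)
  have [->|nuNmu] := eqVneq nu mu.
    exists 2; first lra.
    by split=> B mB; have := mu0 mB; rewrite !smeasureE; lra.
  pose g := [set nu + t *: (mu - nu) | t in [set: R]].
  have g_line : is_line g.
    by exists nu, (mu - nu); rewrite subr_eq0 eq_sym.
  have g_aff : g `<=` affine_hull dominated.
    move=> _ [t _ <-] L [L_affine DL].
    rewrite (_ : _ + _ = t *: mu + (1 - t) *: nu).
      by apply: L_affine; apply: DL => //; exact: dominated_mu.
    by apply/smeasure_eqP => B _; rewrite !smeasureE; ring.
  have [//|y [z [yz [s /andP[s0 s1] sE] seg]]] := nu_rai _ g_line g_aff.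
    by exists 0 => //; rewrite scale0r addr0.
  (* The orientation of the segment along the line is unknown, so both displacements are kept until
     the sign of [b] is settled. *)
  have [b [b0 nub nuNb]] : exists b : R, [/\ b != 0, nonnegative (nu + b *: (mu - nu)) &
      nonnegative (nu - b *: (mu - nu))].
    (* Half the distance from the parameter [s] of [nu] to the ends of (0, 1), so that [s - e] and
       [s + e] remain inside. *)
    pose e := Num.min s (1 - s) / 2.
    have e0 : 0 < e by rewrite divr_gt0// lt_min s0 subr_gt0.
    have [es es1] : e < s /\ e < 1 - s.
      have : Num.min s (1 - s) <= s by rewrite ge_min lexx.
      have : Num.min s (1 - s) <= 1 - s by rewrite ge_min lexx orbT.
      by rewrite /e; lra.
    have onseg r : `|r| <= e -> (g `&` dominated) (nu + r *: (y - z)).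
      rewrite ler_norml => /andP[r1 r2]; apply: seg.
      exists (s + r); first by apply/andP; split; lra.
      by rewrite -sE; apply/smeasure_eqP => B _; rewrite !smeasureE; ring.
    have [[b _ bE] [pos _ _]] : (g `&` dominated) (nu + e *: (y - z)).
      by apply: onseg; rewrite gtr0_norm.
    have {}bE : b *: (mu - nu) = e *: (y - z) by exact: (addrI nu).
    exists b; split.
    - apply: contraNneq yz => b0; move/eqP: bE; rewrite b0 scale0r eq_sym scaler_eq0.
      by rewrite (gt_eqF e0) subr_eq0.
    - by rewrite bE.
    - rewrite bE -scaleNr.
      have [_ [pos' _ _]] : (g `&` dominated) (nu + - e *: (y - z)).
        by apply: onseg; rewrite normrN gtr0_norm.
      exact: pos'.
  have {nub nuNb} [a a0 nua] : exists2 a : R, 0 < a & nonnegative (nu - a *: (mu - nu)).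
    have [b_gt0|b_lt0|b_eq0] := ltgtP 0 b; first by exists b.
    - by exists (- b); [rewrite oppr_gt0|rewrite scaleNr opprK].
    - by rewrite -b_eq0 eqxx in b0.
  exists (Num.max c ((1 + a) / a)); first by rewrite lt_max c1.
  split; last by apply: setwise_le_scale nuc; rewrite le_max lexx.
  move=> B mB; have := nua B mB; rewrite !smeasureE => h.
  apply: (@le_trans _ _ (((1 + a) / a)^-1 * mu B)).
    rewrite ler_wpM2r ?mu0// lef_pV2 ?posrE ?le_max ?lexx ?orbT//.
    by rewrite lt_max (lt_trans _ c1).
    by rewrite divr_gt0//; lra.
  rewrite invf_div mulrAC ler_pdivrMr; lra.
- move=> [nu0 Wnu [c c1 [cnu nuc]]].
  have nuD : dominated nu by split=> //; exists c.
  split => // g [p [v [v0 ->]]] g_aff [t0 _ tE].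
  have [Wv [e e0 [ev ve]]] : comparable_directions v.
    have [w Vw wE] : [set mu + w | w in comparable_directions] (nu + v).
      rewrite -affine_hull_dominated; apply: g_aff; exists (t0 + 1) => //.
      by rewrite scalerDl scale1r addrA tE.
    have [w' Vw' wE'] : [set mu + w | w in comparable_directions] nu.
      by rewrite -affine_hull_dominated => L [_]; exact.
    rewrite (_ : v = w - w'); first exact: subspaceB comparable_directions_linear _ _ Vw Vw'.
    apply: (addrI nu); rewrite -wE -{1}wE'.
    by apply/smeasure_eqP => B _; rewrite !smeasureE; ring.
  have c0 : 0 < c by lra.
  (* From [|v| <= e mu] follows [|f v| <= c^-1 mu <= nu], so the whole segment stays nonnegative;
     its points are bounded by [(c + c^-1) mu]. *)
  pose f := (c * e)^-1.
  have f0 : 0 < f by rewrite invr_gt0 mulr_gt0.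
  have segE (t : R) : t *: (nu + f *: v) + (1 - t) *: (nu - f *: v) =
      nu + ((2 * t - 1) * f) *: v.
    by apply/smeasure_eqP => B _; rewrite !smeasureE; ring.
  exists (nu + f *: v), (nu - f *: v); split.
  + rewrite -subr_eq0 (_ : _ - _ = (2 * f) *: v); last first.
      by apply/smeasure_eqP => B _; rewrite !smeasureE; ring.
    by rewrite scaler_eq0 negb_or v0 andbT; lra.
  + by exists 2^-1; [apply/andP; split; lra|rewrite segE divff ?subrr ?mul0r ?scale0r ?addr0].
  + move=> _ [t /andP[t0' t1] <-]; rewrite segE; split.
      exists (t0 + (2 * t - 1) * f) => //.
      by rewrite scalerDl addrA tE.
    have bound B : measurable B -> `|(2 * t - 1) * f * v B| <= c^-1 * mu B.
      move=> mB; rewrite normrM; apply: (@le_trans _ _ (f * (e * mu B))); last first.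
        by rewrite le_eqVlt; apply/orP; left; apply/eqP; rewrite /f; field; lra.
      apply: ler_pM => //.
        rewrite normrM (gtr0_norm f0) ler_piMl ?(ltW f0)//.
        by rewrite ler_norml; apply/andP; split; lra.
      rewrite ler_norml; have := ev B mB; have := ve B mB.
      by rewrite !smeasureE mulNr => -> ->.
    split.
    * move=> B mB; have := bound B mB; have := cnu B mB; rewrite !smeasureE.
      by rewrite ler_norml => h /andP[h1 h2]; lra.
    * rewrite addrAC; apply: subspaceD => //; exact: subspaceZ.
    * exists (c + c^-1).
        by have : 0 < c^-1; [rewrite invr_gt0|lra].
      move=> B mB; have := bound B mB; have := nuc B mB; rewrite !smeasureE.
      by rewrite ler_norml => h /andP[h1 h2]; lra.
Qed.

End dominated_faces.

(** * The linear space of the characteristic equations *)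

Section characteristic_directions.
Context d (X : measurableType d) (A : ptopologicalType) (R : realType).
Context (k : nat) (M : control_model X A R k) (Delta : set X).
Hypothesis mDelta : measurable Delta.
Local Notation XA := (X * borel A)%type.
Implicit Types (u v mu nu : smeasure XA R).

Definition characteristic_directions := [set nu : smeasure XA R |
  reward_integral M nu = 0 /\
  setwise_eq (marginal nu) (restrict_compl Delta (kernel_image M nu))].

Lemma bounded_measurable_reward i : bounded_measurable (fun z => reward M z ord0 i).
Proof.
split; first exact: measurable_reward.
by have [c Mc] := bounded_reward M; exists c => z; exact: Mc.
Qed.

Lemma reward_integral_comb (a : R) u v :
  reward_integral M (a *: u + v) = a *: reward_integral M u + reward_integral M v.
Proof.
apply/rowP => i; rewrite !mxE; have br := bounded_measurable_reward i.
by rewrite (sintegral_measureD (a *: u) v br) (sintegral_measureZ a u br).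
Qed.

Lemma kernel_image_comb (a : R) u v B : measurable B ->
  kernel_image M (a *: u + v) B = a * kernel_image M u B + kernel_image M v B.
Proof.
move=> mB; have bt := bounded_measurable_trans M mB.
by rewrite /kernel_image (sintegral_measureD (a *: u) v bt) (sintegral_measureZ a u bt).
Qed.

Lemma reward_integralB u v :
  reward_integral M (u - v) = reward_integral M u - reward_integral M v.
Proof.
by have := reward_integral_comb (-1) v u; rewrite !scaleN1r ![- _ + _]addrC.
Qed.

Lemma kernel_imageB u v B : measurable B ->
  kernel_image M (u - v) B = kernel_image M u B - kernel_image M v B.
Proof.
move=> mB; have := kernel_image_comb (-1) v u mB.
by rewrite scaleN1r mulN1r ![- _ + _]addrC.
Qed.

Lemma characteristic_directions_linear :
  is_linear_subspace characteristic_directions.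
Proof.
have dirC (a : R) u v : characteristic_directions u -> characteristic_directions v ->
    characteristic_directions (a *: u + v).
  move=> [ru uE] [rv vE]; split.
    by rewrite reward_integral_comb ru rv scaler0 addr0.
  move=> B mB; have mBD : measurable (B `&` ~` Delta).
    by apply: measurableI => //; exact: measurableC.
  rewrite /restrict_compl kernel_image_comb//.
  by have := uE B mB; have := vE B mB; rewrite /restrict_compl => <- <-.
split => //.
split; first by have := reward_integralB 0 0; rewrite !subrr.
move=> B mB; have mBD : measurable (B `&` ~` Delta).
  by apply: measurableI => //; exact: measurableC.
by have := kernel_imageB 0 0 mBD; rewrite !subrr /restrict_compl => ->.
Qed.

Lemma characteristic_solutions_sub alpha mu nu :
  characteristic_solutions M Delta mu -> reward_integral M mu = alpha ->
  characteristic_solutions M Delta nu -> reward_integral M nu = alpha ->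
  characteristic_directions (nu - mu).
Proof.
move=> [_ _ muE] rmu [_ _ nuE] rnu; split; first by rewrite reward_integralB rmu rnu subrr.
move=> B mB; have mBD : measurable (B `&` ~` Delta).
  by apply: measurableI => //; exact: measurableC.
rewrite /restrict_compl kernel_imageB//.
have := muE B mB; have := nuE B mB; rewrite /restrict_compl => nuB muB.
rewrite (_ : marginal _ B = marginal nu B - marginal mu B)// nuB muB.
by rewrite opprD addrACA subrr add0r.
Qed.

(** The linear constraints are recovered by adding those of [mu]. Concentration on the graph, which
    [characteristic_directions] does not record, is inherited from [mu] through [nu <= c mu]. *)
Lemma characteristic_solutions_dominated alpha mu nu (c : R) :
  measurable (graph_adm M) ->
  characteristic_solutions M Delta mu -> reward_integral M mu = alpha ->
  nonnegative nu -> characteristic_directions (nu - mu) -> setwise_le nu (c *: mu) ->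
  characteristic_solutions M Delta nu /\ reward_integral M nu = alpha.
Proof.
move=> mK [mu0 muK muE] rmu nu0 [rd dE] nuc; split; last first.
  by move/eqP: rd; rewrite reward_integralB rmu subr_eq0 => /eqP.
have mKC : measurable (~` graph_adm M) by exact: measurableC.
split => // [|B mB].
  apply/eqP; rewrite eq_le nu0// andbT (le_trans (nuc _ mKC))//.
  by rewrite !smeasureE [X in c * X]muK mulr0.
have mBD : measurable (B `&` ~` Delta).
  by apply: measurableI => //; exact: measurableC.
have := dE B mB; have := muE B mB; rewrite /restrict_compl kernel_imageB//.
rewrite (_ : marginal (nu - mu) B = marginal nu B - marginal mu B)// => -> h.
by lra.
Qed.

End characteristic_directions.

(** * Faces of the constrained occupancy measures *)

Theorem corollary3p3 (R : realType) (d : measure_display)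
    (X : measurableType d) (A : ptopologicalType) (k : nat)
    (M : control_model X A R k) (Delta : set X) (alpha : 'rV[R]_k)
    (mu : smeasure (X * borel A)%type R) :
  (0 < k)%N ->
  borel_space R A ->
  compact [set: A] ->
  measurability_conditions M ->
  measurable Delta ->
  absorbing M Delta ->
  constrained_occupancy_measures M Delta alpha !=set0 ->
  constrained_occupancy_measures M Delta alpha mu ->
  let F := generated_face (constrained_occupancy_measures M Delta alpha) mu in
  [/\ F = [set nu | [/\ characteristic_solutions M Delta nu,
                        reward_integral M nu = alpha &
                        exists2 c : R, 1 < c & setwise_le nu (c *: mu)]],
      rai F = [set nu | [/\ characteristic_solutions M Delta nu,
                            reward_integral M nu = alpha &
                            exists2 c : R, 1 < c &
                              setwise_le (c^-1 *: mu) nu /\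
                              setwise_le nu (c *: mu)]],
      affine_hull F =
        [set gamma | [/\ reward_integral M gamma = alpha,
            setwise_eq (marginal (gamma - mu))
              (restrict_compl Delta (kernel_image M (gamma - mu))) &
            exists2 c : R, 0 < c &
              setwise_le (- c *: mu) (gamma - mu) /\
              setwise_le (gamma - mu) (c *: mu)]] &
      parallel
        [set nu | [/\ reward_integral M nu = 0,
            setwise_eq (marginal nu)
              (restrict_compl Delta (kernel_image M nu)) &
            exists2 c : R, 0 < c &
              setwise_le (- c *: mu) nu /\ setwise_le nu (c *: mu)]]
        (affine_hull F)].
Proof.
move=> _ A_borel A_compact M_meas mDelta M_absorbing _ [muO rmu] F.
have [mK _] := M_meas.
have char nu : occupancy_measures M Delta nu -> characteristic_solutions M Delta nu.
  exact: occupancy_characteristic.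
have muC := char _ muO.
pose W := characteristic_directions M Delta.
have W_linear : is_linear_subspace W by exact: characteristic_directions_linear.
pose Oa := constrained_occupancy_measures M Delta alpha.
have Oa_sub nu : Oa nu -> nonnegative nu /\ W (nu - mu).
  move=> [nuO rnu]; have nuC := char _ nuO; split; first by case: nuC.
  exact: characteristic_solutions_sub muC rmu nuC rnu.
have Oa_dominated nu c : nonnegative nu -> W (nu - mu) ->
    setwise_le nu (c *: mu) -> Oa nu.
  move=> nu0 Wnu nuc.
  have [nuC rnu] := characteristic_solutions_dominated mDelta mK muC rmu nu0 Wnu nuc.
  by split => //; exact: dominated_solution_occupancy muO nuC nuc.
have FE : F = dominated W mu.
  exact: generated_face_dominated.
(* For measures dominated by a multiple of [mu], the characteristic equations with reward [alpha]
   amount to nonnegativity and membership in [mu + W]; this translates the abstract descriptions of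
   the face and of its relative interior. *)
have CE nu c : setwise_le nu (c *: mu) ->
    characteristic_solutions M Delta nu /\ reward_integral M nu = alpha <->
    nonnegative nu /\ W (nu - mu).
  move=> nuc; split.
    move=> [nuC rnu]; split; first by case: nuC.
    exact: characteristic_solutions_sub muC rmu nuC rnu.
  move=> [nu0 Wnu].
  exact: (characteristic_solutions_dominated mDelta mK muC rmu nu0 Wnu nuc).
have VE : comparable_directions W mu = [set nu | [/\ reward_integral M nu = 0,
    setwise_eq (marginal nu) (restrict_compl Delta (kernel_image M nu)) &
    exists2 c : R, 0 < c & setwise_le (- c *: mu) nu /\ setwise_le nu (c *: mu)]].
  by apply/seteqP; split => nu; [case=> -[] | case].
rewrite FE; split.
- apply/seteqP; split => nu [h1 h2 [c c1 nuc]].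
    by have [] := (CE nu c nuc).2 (conj h1 h2); split => //; exists c.
  by have [] := (CE nu c nuc).1 (conj h1 h2); split => //; exists c.
- rewrite (rai_dominated W_linear (conj muO rmu) Oa_sub).
  apply/seteqP; split => nu [h1 h2 [c c1 [cnu nuc]]].
    by have [] := (CE nu c nuc).2 (conj h1 h2); split => //; exists c.
  by have [] := (CE nu c nuc).1 (conj h1 h2); split => //; exists c.
- rewrite (affine_hull_dominated W_linear (conj muO rmu) Oa_sub) VE.
  apply/seteqP; split => [_ [nu [r0 nuE nuc] <-]|gamma [rg gE gc]].
    rewrite /= [mu + nu]addrC addrK; split => //.
    move: r0; rewrite -[in LHS](addrK mu nu) reward_integralB rmu => /eqP.
    by rewrite subr_eq0 => /eqP.
  exists (gamma - mu); last by rewrite addrC subrK.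
  by split => //; rewrite reward_integralB rg rmu subrr.
- rewrite -VE; exact: parallel_dominated W_linear (conj muO rmu) Oa_sub.
Qed.
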